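(* Let $\mathcal{H}$ be a well-behaved family of graphs, and let $\Pi$ be \textsc{Connected Vertex Cover} (or \textsc{Connected Dominating Set}). Then the following are equivalent: (1) $\Pi$ admits an FPT-AS parameterized by $\mathbf{mod}_{\mathcal{H}}(\cdot)$ and $\epsilon$; (2) $\Pi$ admits an FPT-AS parameterized by $\mathbf{ed}_{\mathcal{H}}(\cdot)$ and $\epsilon$; (3) $\Pi$ admits an FPT-AS parameterized by $\mathbf{tw}_{\mathcal{H}}(\cdot)$ and $\epsilon$.
   Context: A family is well-behaved if hereditary and closed under disjoint union. \textsc{Connected Vertex Cover}: minimum vertex cover $S$ with $G[S]$ connected. \textsc{Connected Dominating Set}: minimum dominating set $S$ with $G[S]$ connected. An FPT-AS parameterized by $p$ and $\epsilon$ returns a solution of size at most $(1+\epsilon)\mathrm{OPT}$ in time $f(p,\epsilon)n^{O(1)}$; by convention it is given a modulator / decomposition of size / depth / width equal to the parameter. $\mathbf{mod}_{\mathcal{H}}(G)$: minimum $|S|$ with $G-S\in\mathcal{H}$. $\mathcal{H}$-elimination decomposition $(T,\chi,L)$: $T$ rooted forest, $\chi:V(T)\to 2^{V(G)}$, $L\subseteq V(G)$; internal nodes have $|\chi(t)|\le1$, $\chi(t)\cap L=\emptyset$; bags partition $V(G)$; each leaf bag lies in $L$ and induces a graph of $\mathcal{H}$, leaf bags partition $L$; each edge joins bags of nodes in ancestor–descendant relation; $\mathbf{ed}_{\mathcal{H}}$ = minimum depth. $\mathcal{H}$-tree decomposition $(T,\chi,L)$: $T$ rooted tree; bags containing a vertex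 form a nonempty connected subtree; each edge in a bag; each $v\in L$ in the bag of a unique node, which is a leaf; each leaf $t$ has $G[\chi(t)\cap L]\in\mathcal{H}$; width $\max\{0,\max_t|\chi(t)\setminus L|-1\}$; $\mathbf{tw}_{\mathcal{H}}$ = minimum width. *)

(* Defs.v *)
From HB Require Import structures.
From mathcomp Require Import all_boot all_order all_algebra.

Set Implicit Arguments.
Unset Strict Implicit.
Unset Printing Implicit Defensive.

Import Order.TTheory GRing.Theory Num.Theory.

(** * Graphs *)

Record sgraph := SGraph {
  vert :> finType;
  adj : rel vert;
  adj_sym : symmetric adj;
  adj_irrefl : irreflexive adj }.

Section Induced.
Variables (G : sgraph) (A : {set G}).

Definition induced_adj : rel {x : G | x \in A} :=
  fun x y => adj (val x) (val y).

Fact induced_sym : symmetric induced_adj.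
Proof. by move=> x y; apply: adj_sym. Qed.

Fact induced_irrefl : irreflexive induced_adj.
Proof. by move=> x; apply: adj_irrefl. Qed.

Definition induced : sgraph := SGraph induced_sym induced_irrefl.
End Induced.

Section DisjointUnion.
Variables G1 G2 : sgraph.

Definition union_adj : rel (G1 + G2)%type := fun x y =>
  match x, y with
  | inl a, inl b => adj a b
  | inr a, inr b => adj a b
  | _, _ => false
  end.

Fact union_sym : symmetric union_adj.
Proof. by move=> [x|x] [y|y] //=; apply: adj_sym. Qed.

Fact union_irrefl : irreflexive union_adj.
Proof. by move=> [x|x] /=; apply: adj_irrefl. Qed.

Definition disjoint_union : sgraph := SGraph union_sym union_irrefl.
End DisjointUnion.

Definition isomorphic (G1 G2 : sgraph) : Prop :=
  exists2 f : G1 -> G2, bijective f & forall x y, adj (f x) (f y) = adj x y.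

Definition graph_family (H : sgraph -> Prop) : Prop :=
  forall G1 G2, isomorphic G1 G2 -> H G1 -> H G2.

Definition hereditary (H : sgraph -> Prop) : Prop :=
  forall (G : sgraph) (A : {set G}), H G -> H (induced A).

Definition closed_disjoint_union (H : sgraph -> Prop) : Prop :=
  forall G1 G2, H G1 -> H G2 -> H (disjoint_union G1 G2).

Definition well_behaved (H : sgraph -> Prop) : Prop :=
  hereditary H /\ closed_disjoint_union H.

(** * The two optimization problems *)

(* The empty set counts as connected, so that an edgeless graph has a connected
   vertex cover of size 0. *)
Definition connected_in (T : finType) (e : rel T) (A : {set T}) : Prop :=
  {in A &, forall x y,
    connect (fun u v => [&& u \in A, v \in A & e u v]) x y}.

Definition vertex_cover (G : sgraph) (S : {set G}) : Prop :=
  forall x y : G, adj x y -> (x \in S) || (y \in S).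

Definition dominating_set (G : sgraph) (S : {set G}) : Prop :=
  forall x : G, x \notin S -> exists2 y, y \in S & adj x y.

(* A minimization problem, given by its feasible solutions; the objective is
   the cardinality. *)
Definition vertex_subset_problem := forall G : sgraph, {set G} -> Prop.

Definition ConnectedVertexCover : vertex_subset_problem :=
  fun G S => vertex_cover S /\ connected_in (@adj G) S.

Definition ConnectedDominatingSet : vertex_subset_problem :=
  fun G S => dominating_set S /\ connected_in (@adj G) S.

Definition optimal (Pi : vertex_subset_problem) (G : sgraph) (S : {set G}) :
    Prop :=
  Pi G S /\ forall S' : {set G}, Pi G S' -> #|S| <= #|S'|.

(** * Modulators, elimination decompositions, tree decompositions *)

Definition is_modulator (H : sgraph -> Prop) (G : sgraph) (S : {set G}) : Prop :=
  H (induced (~: S)).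

(* The triple (T, chi, L); the forest T is given by its parent function, the
   roots being the nodes without a parent. *)
Record decomposition (G : sgraph) := Decomposition {
  node : finType;
  parent : node -> option node;
  bag : node -> {set G};
  base : {set G} }.

Section Decompositions.
Variables (H : sgraph -> Prop) (G : sgraph) (D : decomposition G).
Implicit Types s t r : node D.

Definition up : rel (node D) := fun t s => parent t == Some s.

Definition tree_adj : rel (node D) := fun t s => up t s || up s t.

(* [ancestor s t]: s lies on the path from t to its root, t included. *)
Definition ancestor s t : bool := connect up t s.

Definition root_node r : bool := parent r == None.

Definition leaf_node t : bool := [forall s, parent s != Some t].

Definition rooted_forest : Prop :=
  forall t, exists2 r, root_node r & ancestor r t.

Definition rooted_tree : Prop :=
  rooted_forest /\ exists! r, root_node r.

(* Number of edges on a longest path from a root to a leaf. *)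
Definition depth : nat := (\max_(t : node D) #|[set s | ancestor s t]|).-1.

Definition is_elimination_decomposition : Prop :=
  [/\ rooted_forest,
      forall t, ~~ leaf_node t ->
        #|bag t| <= 1 /\ [disjoint bag t & base D],
      forall v : G, exists! t, v \in bag t,
      (forall t, leaf_node t -> bag t \subset base D /\ H (induced (bag t))) /\
      (forall v, v \in base D -> exists! t, leaf_node t /\ v \in bag t) &
      forall (u v : G) s t, adj u v -> u \in bag s -> v \in bag t ->
        ancestor s t || ancestor t s].

(* Truncated predecessor: max {0, max_t |bag t \ L| - 1}. *)
Definition width : nat := (\max_(t : node D) #|bag t :\: base D|).-1.

Definition is_tree_decomposition : Prop :=
  [/\ rooted_tree,
      forall v : G, (exists t, v \in bag t) /\
        connected_in tree_adj [set t | v \in bag t],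
      forall u v : G, adj u v -> exists t, (u \in bag t) && (v \in bag t),
      forall v, v \in base D ->
        exists2 t, leaf_node t & forall s, (v \in bag s) = (s == t) &
      forall t, leaf_node t -> H (induced (bag t :&: base D))].
End Decompositions.

(** * Model of computation *)

(* Call-by-value lambda calculus with de Bruijn indices over binary trees.
   [tcase t u w] runs u if t is a leaf, and w with the two subtrees (left one at
   index 0) pushed on the environment otherwise.  [tfix t] is a recursive
   function: t is run with the argument at index 0 and the function itself at
   index 1. *)
Inductive term :=
| tvar of nat
| tleaf
| tnode of term & term
| tcase of term & term & term
| tfix of term
| tapp of term & term.

Inductive value :=
| VLeaf
| VNode of value & value
| VClosure of seq value & term.

(* [eval env t v k]: t evaluates to v in k steps.  Every rule is a bounded number
   of pointer operations on shared trees and environments, with no copying and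
   no comparison of values (a lookup costs at most the largest index in the
   fixed program), so k is the running time up to a constant factor depending on
   the program on a pointer machine, hence polynomially related to time on a
   Turing machine. *)
Inductive eval : seq value -> term -> value -> nat -> Prop :=
| EvalVar env i v :
    onth env i = Some v -> eval env (tvar i) v 1
| EvalLeaf env :
    eval env tleaf VLeaf 1
| EvalNode env t u a b k l :
    eval env t a k -> eval env u b l ->
    eval env (tnode t u) (VNode a b) (k + l).+1
| EvalCaseLeaf env t u w v k l :
    eval env t VLeaf k -> eval env u v l ->
    eval env (tcase t u w) v (k + l).+1
| EvalCaseNode env t u w a b v k l :
    eval env t (VNode a b) k -> eval [:: a, b & env] w v l ->
    eval env (tcase t u w) v (k + l).+1
| EvalFix env t :
    eval env (tfix t) (VClosure env t) 1
| EvalApp env env' t u b a v k l m :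
    eval env t (VClosure env' b) k -> eval env u a l ->
    eval [:: a, VClosure env' b & env'] b v m ->
    eval env (tapp t u) v (k + l + m).+1.

(* An algorithm is a term whose only free variable, index 0, is the input. *)
Definition runs (A : term) (input output : value) (time : nat) : Prop :=
  eval [:: input] A output time.

(** * Encoding of inputs and outputs *)

Definition enc_seq (s : seq value) : value := foldr VNode VLeaf s.

Definition enc_bool (b : bool) : value := if b then VNode VLeaf VLeaf else VLeaf.

(* Unary. *)
Definition enc_nat (n : nat) : value := enc_seq (nseq n VLeaf).

(* Characteristic vector along [enum T]. *)
Definition enc_set (T : finType) (A : {set T}) : value :=
  enc_seq [seq enc_bool (x \in A) | x <- enum T].

(* Adjacency matrix. *)
Definition enc_graph (G : sgraph) : value :=
  enc_seq [seq enc_set [set y | adj x y] | x <- enum G].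

Definition enc_option_elt (T : finType) (o : option T) : value :=
  if o is Some x then VNode VLeaf (enc_nat (index x (enum T))) else VLeaf.

Definition enc_decomposition (G : sgraph) (D : decomposition G) : value :=
  VNode (enc_seq [seq enc_option_elt (parent t) | t <- enum (node D)])
    (VNode (enc_seq [seq enc_set (bag t) | t <- enum (node D)])
           (enc_set (base D))).

Definition enc_rat (e : rat) : value :=
  VNode (enc_nat `|numq e|%N) (enc_nat `|denq e|%N).

(** * FPT approximation schemes *)

(* The parameter of G is the least [measure] of a [valid] witness for G. *)
Record graph_parameter := GraphParameter {
  witness : sgraph -> Type;
  valid : forall G, witness G -> Prop;
  measure : forall G, witness G -> nat;
  witness_size : forall G, witness G -> nat;
  enc_witness : forall G, witness G -> value }.

Definition mod_param (H : sgraph -> Prop) : graph_parameter :=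
  @GraphParameter (fun G => {set G}) (@is_modulator H) (fun _ S => #|S|)
    (fun _ _ => 0) (fun G S => enc_set S).

Definition ed_param (H : sgraph -> Prop) : graph_parameter :=
  @GraphParameter decomposition (@is_elimination_decomposition H) depth
    (fun _ D => #|node D|) enc_decomposition.

Definition tw_param (H : sgraph -> Prop) : graph_parameter :=
  @GraphParameter decomposition (@is_tree_decomposition H) width
    (fun _ D => #|node D|) enc_decomposition.

(* The scheme receives the accuracy eps, the graph and a witness, and the value
   of the parameter is the measure of that witness, which need not be minimum.
   It halts within the time bound on every instance; n counts the vertices of G
   and the nodes of the decomposition, which are not bounded in terms of G.
   When there is no feasible solution the output is unconstrained. *)
Definition FPT_AS (Pi : vertex_subset_problem) (P : graph_parameter) : Prop :=
  exists (A : term) (f : nat -> rat -> nat) (c : nat),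
  forall (G : sgraph) (w : witness P G) (eps : rat),
    valid w -> (0 < eps)%R ->
    exists (out : value) (time : nat),
      [/\ runs A (VNode (enc_rat eps) (VNode (enc_graph G) (enc_witness w)))
            out time,
          time <= f (measure w) eps * (#|G| + witness_size w).+1 ^ c &
          forall Sopt : {set G}, optimal Pi Sopt ->
            exists S : {set G},
              [/\ out = enc_set S, Pi G S &
                  (#|S|%:R <= (1 + eps) * #|Sopt|%:R)%R]].

(* Main.v *)
(** The hard implication is from modulators to tree decompositions.  Let [A] be
the set of vertices occurring below a node and [X] the part of its bag outside
the base.  What the rest of a solution [S] contributes to [A] is recorded by a set
[E] of pairs of boundary vertices: [(x, y)] with [y] in [S] and [x] joined to [y]
through [S] outside the interior of [A].  Adding [E] as edges to [G[A]] and
forcing the diagonal of [E] into the solution turns [S :&: A] into a solution of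
the modified graph, and conversely any solution of the modified graph can replace
[S :&: A] in [S].  So one keeps, for each of the boundedly many [E], a smallest
candidate.  At a leaf the modified graph has the boundary and some pendant
vertices as a modulator of bounded size, and the given scheme supplies the
candidate; with accuracy [1 / (b * (#|X| + 1))] its excess over [S :&: A], being an
integer, is at most [1 / b] times the number of interior vertices in [S].  The
interiors of the leaves are disjoint, so the excesses add up to at most [#|S| / b].

Running times are bounded compositionally: the families of values computed by one
term in FPT time are closed under pairing, case analysis, list recursion and calls
of the given scheme.  Elements of finite types are passed around as characteristic
vectors of singletons, and functions on them as tables. *)

Require Import Defs.
From Stdlib Require Import ClassicalEpsilon.
From mathcomp Require Import all_boot all_order all_algebra.
From mathcomp Require Import zify.

Set Implicit Arguments.
Unset Strict Implicit.
Unset Printing Implicit Defensive.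

(** * Enlarging the environment of an evaluation *)

(** A scheme promises nothing on an infeasible instance: its output may then be a closure, which no
    program can inspect. The feasibility of a modified graph is therefore decided before the call,
    by testing one canonical candidate. The excess at a leaf can be charged only to base vertices,
    since each of them belongs to one leaf, while a boundary vertex may occur in many bags. The
    factor [#|X|.+1] in the accuracy absorbs the boundary; [b] is the denominator of the accuracy
    requested. Routing the outside of [A] through the boundary uses connectivity together with a
    vertex of [S] in [A]. A solution that misses [A] is handled separately, by the empty candidate.
    The two other implications convert witnesses. In an elimination decomposition each bag absorbs
    those above it, at one vertex per level. A modulator becomes a path of singletons ending in the
    bag of all remaining vertices. *)

Inductive val_sub : value -> value -> Prop :=
| ValSubLeaf : val_sub VLeaf VLeaf
| ValSubNode a a' b b' :
    val_sub a a' -> val_sub b b' -> val_sub (VNode a b) (VNode a' b')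
| ValSubClosure env env' t :
    env_sub env env' -> val_sub (VClosure env t) (VClosure env' t)
with env_sub : seq value -> seq value -> Prop :=
| EnvSubNil env : env_sub [::] env
| EnvSubCons a a' env env' :
    val_sub a a' -> env_sub env env' -> env_sub (a :: env) (a' :: env').

Fixpoint val_sub_refl v : val_sub v v :=
  match v with
  | VLeaf => ValSubLeaf
  | VNode a b => ValSubNode (val_sub_refl a) (val_sub_refl b)
  | VClosure env t =>
      ValSubClosure t
        ((fix env_refl env : env_sub env env :=
            if env is a :: env' then EnvSubCons (val_sub_refl a) (env_refl env')
            else EnvSubNil [::]) env)
  end.

Lemma env_sub_onth env env' i v :
  env_sub env env' -> onth env i = Some v ->
  exists2 v', onth env' i = Some v' & val_sub v v'.
Proof.
move=> sub; elim: sub i => [e|a a' e e' sa _ IH] [|i] //=.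
  by case=> <-; exists a'.
exact: IH.
Qed.

(** A closure stores the environment in which it was formed, so extra entries at the end of the
    environment can change a result, but only inside closures. The number of steps is the same. *)
Lemma eval_env_sub env t v k :
  eval env t v k -> forall env', env_sub env env' ->
  exists2 v', eval env' t v' k & val_sub v v'.
Proof.
elim=> {env t v k}.
- move=> env i v onv env' sub; have [v' onv' vv'] := env_sub_onth sub onv.
  by exists v' => //; constructor.
- by move=> env env' _; exists VLeaf; constructor.
- move=> env t u a b k l _ IHt _ IHu env' sub.
  have [a' et aa'] := IHt _ sub; have [b' eu bb'] := IHu _ sub.
  by exists (VNode a' b'); constructor.
- move=> env t u w v k l _ IHt _ IHu env' sub.
  have [a' et aa'] := IHt _ sub; have [v' eu vv'] := IHu _ sub.
  by exists v' => //; apply: EvalCaseLeaf eu; inversion aa'; subst.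
- move=> env t u w a b v k l _ IHt _ IHw env' sub.
  have [ab' et sub_ab] := IHt _ sub.
  inversion sub_ab as [|? a' ? b' aa' bb'|]; subst.
  have [v' ew vv'] := IHw [:: a', b' & env'] (EnvSubCons aa' (EnvSubCons bb' sub)).
  by exists v' => //; apply: EvalCaseNode et ew.
- by move=> env t env' sub; exists (VClosure env' t); constructor.
- move=> env env1 t u b a v k l m _ IHt _ IHu _ IHb env' sub.
  have [f' et subf] := IHt _ sub; have [a' eu aa'] := IHu _ sub.
  inversion subf as [| |? env1' ? sub1]; subst.
  have [v' eb vv'] := IHb [:: a', VClosure env1' b & env1']
    (EnvSubCons aa' (EnvSubCons subf sub1)).
  by exists v' => //; apply: EvalApp et eu eb.
Qed.

(** Encoded sets contain no closures, so the output of a scheme on a feasible instance does not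
    depend on the surrounding environment. *)
Lemma val_sub_set (T : finType) (A : {set T}) w :
  val_sub (enc_set A) w -> w = enc_set A.
Proof.
rewrite /enc_set; elim: (enum T) w => [|x s IH] w /= sub.
  by inversion sub.
inversion sub as [|? a' ? b' aa' bb'|]; subst; rewrite (IH _ bb'); congr VNode.
case: (x \in A) aa' => /= aa'; inversion aa' as [|? a1 ? a2 a11 a22|]; subst => //.
by inversion a11; inversion a22.
Qed.

Lemma runs_env A a v k rest :
  runs A a v k -> exists2 v', eval (a :: rest) A v' k & val_sub v v'.
Proof.
move=> /eval_env_sub; apply; constructor; first exact: val_sub_refl.
exact: EnvSubNil.
Qed.

(** * Families of values computed in FPT time *)

(** [par] holds the parameter and the accuracy, on which a running time may depend arbitrarily;
    [len] is the size in which it must be polynomial. [inp] is the value found at index 0 of the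
    environment. *)
Record ctx := Ctx {
  idx :> Type;
  dom : idx -> Prop;
  inp : idx -> value;
  par : idx -> nat * rat;
  len : idx -> nat }.

Implicit Types C : ctx.

Definition fpt (C : ctx) (b : C -> nat) : Prop :=
  exists (f : nat * rat -> nat) (c : nat),
    forall i, dom i -> b i <= f (par i) * (len i).+1 ^ c.

(* The same term works under every environment tail, so that closed terms can be
   composed without shifting indices. *)
Definition computable (C : ctx) (v : C -> value) : Prop :=
  exists (t : term) (b : C -> nat), fpt b /\
    forall i rest, dom i ->
      exists2 k, k <= b i & eval (inp i :: rest) t (v i) k.

Lemma fpt_le C (b b' : C -> nat) :
  (forall i, dom i -> b i <= b' i) -> fpt b' -> fpt b.
Proof.
move=> le_b [f [c fb]]; exists f, c => i di.
exact: leq_trans (le_b _ di) (fb _ di).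
Qed.

Lemma fpt_par C (f : nat * rat -> nat) : @fpt C (fun i => f (par i)).
Proof. by exists f, 0 => i _; rewrite expn0 muln1. Qed.

Lemma fpt_const C n : @fpt C (fun=> n).
Proof. exact: (@fpt_par C (fun=> n)). Qed.

Lemma fpt_len C : @fpt C (@len C).
Proof. by exists (fun=> 1), 1 => i _; rewrite mul1n expn1. Qed.

Lemma fpt_add C (b b' : C -> nat) : fpt b -> fpt b' -> fpt (fun i => b i + b' i).
Proof.
move=> [f [c fb]] [f' [c' fb']]; exists (fun p => f p + f' p), (c + c') => i di.
rewrite mulnDl; apply: leq_add.
  apply: leq_trans (fb _ di) _; rewrite leq_mul2l; apply/orP; right.
  by apply: leq_pexp2l => //; apply: leq_addr.
apply: leq_trans (fb' _ di) _; rewrite leq_mul2l; apply/orP; right.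
by apply: leq_pexp2l => //; apply: leq_addl.
Qed.

Lemma fpt_mul C (b b' : C -> nat) : fpt b -> fpt b' -> fpt (fun i => b i * b' i).
Proof.
move=> [f [c fb]] [f' [c' fb']]; exists (fun p => f p * f' p), (c + c') => i di.
by rewrite expnD mulnACA; apply: leq_mul; [apply: fb|apply: fb'].
Qed.

Lemma fpt_exp C (b : C -> nat) c : fpt b -> fpt (fun i => b i ^ c).
Proof.
move=> fb; elim: c => [|c IH]; first exact: fpt_const.
apply: fpt_le (fpt_mul fb IH) => i _ /=; by rewrite expnS.
Qed.

Definition restrict (C : ctx) (Q : C -> Prop) : ctx :=
  @Ctx C (fun i => dom i /\ Q i) (@inp C) (@par C) (@len C).

(** Binds a local variable: its value is paired with the previous input, while [par] and [len] stay
    fixed, so that bounds and programs over [C] remain usable. *)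
Definition extend (C : ctx) (J : C -> Type) (Q : forall i, J i -> Prop)
    (w : forall i, J i -> value) : ctx :=
  @Ctx {i : C & J i} (fun p => dom (tag p) /\ Q (tag p) (tagged p))
    (fun p => VNode (w (tag p) (tagged p)) (inp (tag p)))
    (fun p => par (tag p)) (fun p => len (tag p)).

Definition eval_le env t v n := exists2 k, k <= n & eval env t v k.

Lemma eval_leW env t v m n : m <= n -> eval_le env t v m -> eval_le env t v n.
Proof. by move=> mn [k km e]; exists k => //; apply: leq_trans mn. Qed.

Lemma eval_le_var env i v : onth env i = Some v -> eval_le env (tvar i) v 1.
Proof. by move=> e; exists 1 => //; constructor. Qed.

Lemma eval_le_node env t u a b m n :
  eval_le env t a m -> eval_le env u b n ->
  eval_le env (tnode t u) (VNode a b) (m + n).+1.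
Proof.
move=> [k km ek] [l ln el]; exists (k + l).+1; last by constructor.
by rewrite ltnS leq_add.
Qed.

Lemma eval_le_case_leaf env t u w v m n :
  eval_le env t VLeaf m -> eval_le env u v n ->
  eval_le env (tcase t u w) v (m + n).+1.
Proof.
move=> [k km ek] [l ln el]; exists (k + l).+1; last exact: EvalCaseLeaf.
by rewrite ltnS leq_add.
Qed.

Lemma eval_le_case_node env t u w a b v m n :
  eval_le env t (VNode a b) m -> eval_le [:: a, b & env] w v n ->
  eval_le env (tcase t u w) v (m + n).+1.
Proof.
move=> [k km ek] [l ln el]; exists (k + l).+1; last exact: EvalCaseNode ek el.
by rewrite ltnS leq_add.
Qed.

Lemma eval_le_app env env' t u b a v m n p :
  eval_le env t (VClosure env' b) m -> eval_le env u a n ->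
  eval_le [:: a, VClosure env' b & env'] b v p ->
  eval_le env (tapp t u) v (m + n + p).+1.
Proof.
move=> [k km ek] [l ln el] [q qp eq]; exists (k + l + q).+1; last exact: EvalApp ek el eq.
by rewrite ltnS !leq_add.
Qed.

Lemma eval_le_fix env t : eval_le env (tfix t) (VClosure env t) 1.
Proof. by exists 1 => //; constructor. Qed.

Lemma eval_le_let env t u a v m n :
  eval_le env u a m -> eval_le [:: a, VClosure env t & env] t v n ->
  eval_le env (tapp (tfix t) u) v (m + n).+2.
Proof.
move=> eu et; apply: eval_leW (eval_le_app (eval_le_fix _ _) eu et); lia.
Qed.

Lemma comp_eq C (v w : C -> value) :
  (forall i, dom i -> v i = w i) -> computable v -> computable w.
Proof.
move=> vw [t [b [fb ev]]]; exists t, b; split => // i rest di.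
by rewrite -vw //; apply: ev.
Qed.

(* The general change of context; weakening and local definitions are instances. *)
Lemma comp_subst C C' (m : C' -> C) (v : C -> value) :
  (forall i, dom i -> [/\ dom (m i), par (m i) = par i & len (m i) = len i]) ->
  computable (fun i => inp (m i)) -> computable v -> computable (fun i => v (m i)).
Proof.
move=> mP [t [b [fb et]]] [u [d [[f [c fd]] eu]]].
exists (tapp (tfix u) t), (fun i => (b i + f (par i) * (len i).+1 ^ c + 2)).
split.
  apply: fpt_add (fpt_const _ _); apply: fpt_add => //.
  by exists f, c.
move=> i rest di; have [dm pm lm] := mP i di.
have et' := et i rest di; have eu' rest' := eu (m i) rest' dm.
apply: eval_leW (eval_le_let et' (eu' _)); rewrite -pm -lm.
by have := fd _ dm; lia.
Qed.

Lemma comp_inp C : computable (@inp C).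
Proof.
exists (tvar 0), (fun=> 1); split; first exact: fpt_const.
by move=> i rest _; apply: eval_le_var.
Qed.

Lemma comp_leaf C : computable (fun _ : C => VLeaf).
Proof.
exists tleaf, (fun=> 1); split; first exact: fpt_const.
by move=> i rest _; exists 1 => //; constructor.
Qed.

Lemma comp_node C (a b : C -> value) :
  computable a -> computable b -> computable (fun i => VNode (a i) (b i)).
Proof.
move=> [t [m [fm et]]] [u [n [fn eu]]]; exists (tnode t u), (fun i => m i + n i + 1).
split; first by apply: fpt_add (fpt_const _ _); apply: fpt_add.
move=> i rest di; rewrite addn1; apply: eval_le_node; [exact: et|exact: eu].
Qed.

Lemma comp_fst C (a b : C -> value) : computable (fun i => VNode (a i) (b i)) -> computable a.
Proof.
move=> [t [m [fm et]]]; exists (tcase t tleaf (tvar 0)), (fun i => m i + 2).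
split; first by apply: fpt_add (fpt_const _ _).
move=> i rest di; apply: eval_leW (eval_le_case_node _ (et i rest di) (eval_le_var _)); last by [].
by lia.
Qed.

Lemma comp_snd C (a b : C -> value) : computable (fun i => VNode (a i) (b i)) -> computable b.
Proof.
move=> [t [m [fm et]]]; exists (tcase t tleaf (tvar 1)), (fun i => m i + 2).
split; first by apply: fpt_add (fpt_const _ _).
move=> i rest di; apply: eval_leW (eval_le_case_node _ (et i rest di) (eval_le_var _)); last by [].
by lia.
Qed.

Lemma comp_weak C J Q w (v : C -> value) :
  computable v -> computable (fun p : @extend C J Q w => v (tag p)).
Proof.
apply: comp_subst => [p [] //|]; exact: comp_snd (comp_inp (extend Q w)).
Qed.

Lemma comp_var C J Q w : computable (fun p : @extend C J Q w => w (tag p) (tagged p)).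
Proof. exact: comp_fst (comp_inp (extend Q w)). Qed.

Lemma comp_restrict C Q (v : C -> value) :
  computable v -> computable (v : @restrict C Q -> value).
Proof. apply: (@comp_subst C (restrict Q) id) => [i []|] //; exact: comp_inp. Qed.

Lemma fpt_weak C J Q w (b : C -> nat) :
  fpt b -> fpt (fun p : @extend C J Q w => b (tag p)).
Proof. by move=> [f [c fb]]; exists f, c => p [di _]; apply: fb. Qed.

Lemma fpt_restrict C Q (b : C -> nat) : fpt b -> fpt (b : @restrict C Q -> nat).
Proof. by move=> [f [c fb]]; exists f, c => i [di _]; apply: fb. Qed.

(** A branch has to be computable only where it is taken; this is what later confines calls of the
    scheme to feasible instances. *)
Lemma comp_if C (b : C -> bool) (v w : C -> value) :
  computable (fun i => enc_bool (b i)) ->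
  computable (v : restrict (fun i => b i) -> value) ->
  computable (w : restrict (fun i => ~~ b i) -> value) ->
  computable (fun i => if b i then v i else w i).
Proof.
move=> [t [m [fm et]]] [u [n [[f [c fn]] eu]]] [s [p [[f' [c' fp]] es]]].
(* [true] is encoded by a node, so its branch runs with two subtrees pushed and recovers the input
   at index 2. *)
exists (tcase t s (tapp (tfix u) (tvar 2))),
  (fun i => m i + f (par i) * (len i).+1 ^ c + f' (par i) * (len i).+1 ^ c' + 5).
split.
  apply: fpt_add (fpt_const _ _); apply: fpt_add; last by exists f', c'.
  by apply: fpt_add => //; exists f, c.
move=> i rest di; case: ifP => bi.
  have dr : @dom (restrict (fun i => b i)) i by split.
  have et' := et i rest di; rewrite bi in et'.
  have et1 : eval_le [:: VLeaf, VLeaf, inp i & rest] (tvar 2) (inp i) 1.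
    exact: eval_le_var.
  apply: eval_leW (eval_le_case_node _ et' (eval_le_let et1 (eu _ _ dr))).
  by have := fn _ dr => /=; lia.
have dr : @dom (restrict (fun i => ~~ b i)) i by split=> //; rewrite bi.
have et' := et i rest di; rewrite bi in et'.
apply: eval_leW (eval_le_case_leaf _ et' (es _ _ dr)).
by have := fp _ dr => /=; lia.
Qed.

(* The body may assume that the accumulator is an actual intermediate result. *)
Definition foldr_ctx (C : ctx) (A J : C -> Type) (s : forall i, seq (A i))
    (ea : forall i, A i -> value) (ej : forall i, J i -> value)
    (g : forall i, A i -> J i -> J i) (z : forall i, J i) : ctx :=
  @extend C (fun i => A i * J i)%type
    (fun i xj => exists s1 s2, s i = s1 ++ xj.1 :: s2 /\ xj.2 = foldr (g i) (z i) s2)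
    (fun i xj => VNode (ea i xj.1) (ej i xj.2)).

Lemma comp_foldr C (A J : C -> Type) (s : forall i, seq (A i))
    (ea : forall i, A i -> value) (ej : forall i, J i -> value)
    (g : forall i, A i -> J i -> J i) (z : forall i, J i) :
  fpt (fun i => size (s i)) ->
  computable (fun i => enc_seq [seq ea i x | x <- s i]) ->
  computable (fun i => ej i (z i)) ->
  computable (fun p : foldr_ctx s ea ej g z =>
          ej (tag p) (g (tag p) (tagged p).1 (tagged p).2)) ->
  computable (fun i => ej i (foldr (g i) (z i) (s i))).
Proof.
move=> fs [ts [bs [fbs es]]] [tz [bz [fbz ez]]] [tg [bg [[f [c fbg]] eg]]].
(* On a node the environment holds head, tail, list, recursive closure and outer input, at indices 0
   to 4. *)
pose body := tcase (tvar 0) (tapp (tfix tz) (tvar 2))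
  (tapp (tfix tg) (tnode (tnode (tvar 0) (tapp (tvar 3) (tvar 1))) (tvar 4))).
pose B (i : C) := f (par i) * (len i).+1 ^ c.
exists (tapp (tfix body) ts),
  (fun i => bs i + ((size (s i)) * (B i + 12) + (bz i + 6)) + 2).
split.
  apply: fpt_add (fpt_const _ _); apply: fpt_add => //; apply: fpt_add.
    apply: fpt_mul => //; apply: fpt_add (fpt_const _ _); by exists f, c.
  by apply: fpt_add (fpt_const _ _).
move=> i rest di.
pose self := VClosure (inp i :: rest) body.
have H s1 s2 : s i = s1 ++ s2 ->
  eval_le [:: enc_seq [seq ea i x | x <- s2], self, inp i & rest] body
    (ej i (foldr (g i) (z i) s2)) (size s2 * (B i + 12) + (bz i + 6)).
  elim: s2 s1 => [|x s2 IH] s1 def_s.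
    have e0 : eval_le [:: enc_seq [::], self, inp i & rest] (tvar 0) VLeaf 1.
      exact: eval_le_var.
    have e2 : eval_le [:: enc_seq [::], self, inp i & rest] (tvar 2) (inp i) 1.
      exact: eval_le_var.
    apply: eval_leW (eval_le_case_leaf _ e0 (eval_le_let e2 (ez i _ di))); lia.
  have {}IH := IH (s1 ++ [:: x]); rewrite -catA in IH; have {}IH := IH def_s.
  have dp : @dom (foldr_ctx s ea ej g z) (existT _ i (x, foldr (g i) (z i) s2)).
    by split=> //; exists s1, s2.
  have e0 : eval_le [:: enc_seq [seq ea i x | x <- x :: s2], self, inp i & rest]
      (tvar 0) (VNode (ea i x) (enc_seq [seq ea i x | x <- s2])) 1.
    exact: eval_le_var.
  set env := [:: _, _ & _] in e0 *.
  set env1 := [:: ea i x, enc_seq [seq ea i x | x <- s2] & env].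
  have a0 : eval_le env1 (tvar 0) (ea i x) 1 by apply: eval_le_var.
  have a1 : eval_le env1 (tvar 1) (enc_seq [seq ea i x | x <- s2]) 1 by apply: eval_le_var.
  have a3 : eval_le env1 (tvar 3) self 1 by apply: eval_le_var.
  have a4 : eval_le env1 (tvar 4) (inp i) 1 by apply: eval_le_var.
  have ebody := eval_le_node (eval_le_node a0 (eval_le_app a3 a1 IH)) a4.
  apply: eval_leW (eval_le_case_node _ e0 (eval_le_let ebody (eg _ _ dp))).
  by have /= := fbg _ dp; rewrite -/(B i) mulSn; lia.
apply: eval_leW (eval_le_let (es i rest di) (H [::] (s i) erefl)); lia.
Qed.

Lemma comp_zip C (s t : C -> seq value) :
  fpt (fun i => size (s i)) ->
  computable (fun i => enc_seq (s i)) -> computable (fun i => enc_seq (t i)) ->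
  computable (fun i => enc_seq [seq VNode p.1 p.2 | p <- zip (s i) (t i)]).
Proof.
move=> fs [ts [bs [fbs es]]] [tt [bt [fbt et]]].
(* Both lists travel as one pair; index 7 finds the recursive closure beneath three pushed pairs and
   the argument. *)
pose body := tcase (tvar 0) tleaf (tcase (tvar 0) tleaf (tcase (tvar 3) tleaf
  (tnode (tnode (tvar 2) (tvar 0)) (tapp (tvar 7) (tnode (tvar 3) (tvar 1)))))).
exists (tapp (tfix body) (tnode ts tt)),
  (fun i => bs i + bt i + (size (s i) * 30 + 30) + 3).
split.
  apply: fpt_add (fpt_const _ _); apply: fpt_add; first exact: fpt_add.
  by apply: fpt_add (fpt_const _ _); apply: fpt_mul (fpt_const _ _).
move=> i rest di; pose self := VClosure (inp i :: rest) body.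
have tleafE env : eval_le env tleaf VLeaf 1 by exists 1 => //; constructor.
have H a b : eval_le [:: VNode (enc_seq a) (enc_seq b), self, inp i & rest] body
    (enc_seq [seq VNode p.1 p.2 | p <- zip a b]) (size a * 30 + 30).
  elim: a b => [|x a IH] b.
    set env := [:: _, _ & _].
    have e0 : eval_le env (tvar 0) (VNode VLeaf (enc_seq b)) 1 by apply: eval_le_var.
    have e1 : eval_le [:: VLeaf, enc_seq b & env] (tvar 0) VLeaf 1 by apply: eval_le_var.
    rewrite (_ : zip _ _ = [::]); last by case: (b).
    apply: eval_leW (eval_le_case_node _ e0 (eval_le_case_leaf _ e1 (tleafE _))).
    by [].
  set env := [:: _, _ & _].
  have e0 : eval_le env (tvar 0) (VNode (enc_seq (x :: a)) (enc_seq b)) 1.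
    exact: eval_le_var.
  set env1 := [:: enc_seq (x :: a), enc_seq b & env].
  have e1 : eval_le env1 (tvar 0) (VNode x (enc_seq a)) 1 by apply: eval_le_var.
  set env2 := [:: x, enc_seq a & env1].
  case: b => [|y b] in env e0 env1 e1 env2 *.
    have e3 : eval_le env2 (tvar 3) VLeaf 1 by apply: eval_le_var.
    apply: eval_leW (eval_le_case_node _ e0 (eval_le_case_node _ e1
      (eval_le_case_leaf _ e3 (tleafE _)))); lia.
  have e3 : eval_le env2 (tvar 3) (VNode y (enc_seq b)) 1 by apply: eval_le_var.
  set env3 := [:: y, enc_seq b & env2].
  have v2 : eval_le env3 (tvar 2) x 1 by apply: eval_le_var.
  have v0 : eval_le env3 (tvar 0) y 1 by apply: eval_le_var.
  have v3 : eval_le env3 (tvar 3) (enc_seq a) 1 by apply: eval_le_var.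
  have v1 : eval_le env3 (tvar 1) (enc_seq b) 1 by apply: eval_le_var.
  have v7 : eval_le env3 (tvar 7) self 1 by apply: eval_le_var.
  have e4 := eval_le_node (eval_le_node v2 v0)
    (eval_le_app v7 (eval_le_node v3 v1) (IH b)).
  apply: eval_leW (eval_le_case_node _ e0 (eval_le_case_node _ e1
    (eval_le_case_node _ e3 e4))).
  by rewrite /= mulSn; lia.
apply: eval_leW (eval_le_let (eval_le_node (es i rest di) (et i rest di)) (H _ _)).
lia.
Qed.

Lemma comp_behead C (s : C -> seq value) :
  computable (fun i => enc_seq (s i)) -> computable (fun i => enc_seq (behead (s i))).
Proof.
move=> [t [b [fb et]]]; exists (tcase t tleaf (tvar 1)), (fun i => b i + 2).
split; first by apply: fpt_add (fpt_const _ _).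
move=> i rest di; have := et i rest di; case: (s i) => [|x l] /= e.
  apply: eval_leW (eval_le_case_leaf _ e (_ : eval_le _ _ _ 1)); first by lia.
  by exists 1 => //; constructor.
apply: eval_leW (eval_le_case_node _ e (eval_le_var _)); last by [].
by lia.
Qed.

Lemma comp_head C (s : C -> seq value) :
  computable (fun i => enc_seq (s i)) -> computable (fun i => head VLeaf (s i)).
Proof.
move=> [t [b [fb et]]]; exists (tcase t tleaf (tvar 0)), (fun i => b i + 2).
split; first by apply: fpt_add (fpt_const _ _).
move=> i rest di; have := et i rest di; case: (s i) => [|x l] /= e.
  apply: eval_leW (eval_le_case_leaf _ e (_ : eval_le _ _ _ 1)); first by lia.
  by exists 1 => //; constructor.
apply: eval_leW (eval_le_case_node _ e (eval_le_var _)); last by [].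
by lia.
Qed.

Lemma comp_nilp C (s : C -> seq value) :
  computable (fun i => enc_seq (s i)) -> computable (fun i => enc_bool (nilp (s i))).
Proof.
move=> [t [b [fb et]]]; exists (tcase t (tnode tleaf tleaf) tleaf), (fun i => b i + 4).
split; first by apply: fpt_add (fpt_const _ _).
have tleafE env : eval_le env tleaf VLeaf 1 by exists 1 => //; constructor.
move=> i rest di; have := et i rest di; case: (s i) => [|x l] /= e.
  apply: eval_leW (eval_le_case_leaf _ e (eval_le_node (tleafE _) (tleafE _))); lia.
by apply: eval_leW (eval_le_case_node _ e (tleafE _)); lia.
Qed.

(* [runs] uses an environment of length one; in a longer one a result may differ
   inside closures, hence the hypothesis on [v]. *)
Lemma comp_call C (t : term) (a v : C -> value) (b : C -> nat) :
  fpt b -> computable a ->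
  (forall i w, dom i -> val_sub (v i) w -> w = v i) ->
  (forall i, dom i -> exists2 k, k <= b i & runs t (a i) (v i) k) ->
  computable v.
Proof.
move=> fb [u [d [fd eu]]] fo et; exists (tapp (tfix t) u), (fun i => d i + b i + 2).
split; first by apply: fpt_add (fpt_const _ _); apply: fpt_add.
move=> i rest di; have [k kb /runs_env ev] := et i di.
have ev' rest' : eval_le (a i :: rest') t (v i) (b i).
  by have [v' e /(fo i _ di) <-] := ev rest'; exists k.
by apply: eval_leW (eval_le_let (eu i rest di) (ev' _)); lia.
Qed.

(** * Boolean connectives *)

Lemma comp_true C : computable (fun _ : C => enc_bool true).
Proof. by apply: comp_node; apply: comp_leaf. Qed.

Lemma comp_false C : computable (fun _ : C => enc_bool false).
Proof. exact: comp_leaf. Qed.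

Lemma comp_andb C (b c : C -> bool) :
  computable (fun i => enc_bool (b i)) -> computable (fun i => enc_bool (c i)) ->
  computable (fun i => enc_bool (b i && c i)).
Proof.
move=> cb cc; apply: comp_eq (comp_if cb (comp_restrict _ cc) (comp_false _)) => i _.
by case: (b i).
Qed.

Lemma comp_negb C (b : C -> bool) :
  computable (fun i => enc_bool (b i)) -> computable (fun i => enc_bool (~~ b i)).
Proof.
move=> cb; apply: comp_eq (comp_if cb (comp_false _) (comp_true _)) => i _.
by case: (b i).
Qed.

Lemma comp_orb C (b c : C -> bool) :
  computable (fun i => enc_bool (b i)) -> computable (fun i => enc_bool (c i)) ->
  computable (fun i => enc_bool (b i || c i)).
Proof.
move=> cb cc; apply: comp_eq (comp_if cb (comp_true _) (comp_restrict _ cc)) => i _.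
by case: (b i).
Qed.

Lemma comp_implyb C (b c : C -> bool) :
  computable (fun i => enc_bool (b i)) -> computable (fun i => enc_bool (c i)) ->
  computable (fun i => enc_bool (b i ==> c i)).
Proof.
move=> cb cc; apply: comp_eq (comp_orb (comp_negb cb) cc) => i _.
by case: (b i).
Qed.

(** Membership without decidable equality, since the lists may have elements of any type. *)
Definition occurs (A : Type) (s : seq A) (x : A) := exists s1 s2, s = s1 ++ x :: s2.

Lemma occurs_mem (A : eqType) (s : seq A) x : occurs s x -> x \in s.
Proof. by move=> [s1 [s2 ->]]; rewrite mem_cat mem_head orbT. Qed.

Definition occ_ctx C (A : C -> Type) (s : forall i, seq (A i))
    (ea : forall i, A i -> value) : ctx :=
  @extend C A (fun i x => occurs (s i) x) ea.

Section Lists.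
Variables (C : ctx) (A : C -> Type) (s : forall i, seq (A i)).
Variable (ea : forall i, A i -> value).
Arguments ea : clear implicits.
Hypothesis fs : fpt (fun i => size (s i)).
Hypothesis cs : computable (fun i => enc_seq [seq ea i x | x <- s i]).

Lemma comp_foldr_elt (J : C -> Type) (ej : forall i, J i -> value)
    (g : forall i, A i -> J i -> J i) z (v : forall i, A i -> value) :
  computable (fun p : occ_ctx s ea => v (tag p) (tagged p)) ->
  computable (fun p : foldr_ctx s ea ej g z => v (tag p) (tagged p).1).
Proof.
apply: (@comp_subst (occ_ctx s ea) (foldr_ctx s ea ej g z)
  (fun p => existT _ (tag p) (tagged p).1)).
  by move=> [i [x j]] /= [di [s1 [s2 [-> _]]]]; split=> //; split=> //; exists s1, s2.
have ci := comp_inp (foldr_ctx s ea ej g z).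
by apply: comp_node; [apply: comp_fst (comp_fst ci)|apply: comp_snd ci].
Qed.

Lemma comp_foldr_acc (J : C -> Type) (ej : forall i, J i -> value)
    (g : forall i, A i -> J i -> J i) z :
  computable (fun p : foldr_ctx s ea ej g z => ej (tag p) (tagged p).2).
Proof. exact: comp_snd (comp_fst (comp_inp (foldr_ctx s ea ej g z))). Qed.

Lemma comp_map (v : forall i, A i -> value) :
  computable (fun p : occ_ctx s ea => v (tag p) (tagged p)) ->
  computable (fun i => enc_seq [seq v i x | x <- s i]).
Proof.
move=> cv.
have := @comp_foldr C A (fun=> seq value) s ea (fun _ => enc_seq)
  (fun i x l => v i x :: l) (fun=> [::]) fs cs (comp_leaf C).
move=> /(_ (comp_node (@comp_foldr_elt _ _ _ _ v cv) (@comp_foldr_acc _ _ _ _))).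
by apply: comp_eq => i _; congr enc_seq; elim: (s i) => //= x l ->.
Qed.

Lemma comp_all (b : forall i, A i -> bool) :
  computable (fun p : occ_ctx s ea => enc_bool (b (tag p) (tagged p))) ->
  computable (fun i => enc_bool (all (b i) (s i))).
Proof.
move=> cb.
have := @comp_foldr C A (fun=> bool) s ea (fun _ => enc_bool)
  (fun i x l => b i x && l) (fun=> true) fs cs (comp_true C).
move=> /(_ (comp_andb (@comp_foldr_elt _ _ _ _ (fun i x => enc_bool (b i x)) cb) (@comp_foldr_acc _ _ _ _))).
by apply: comp_eq => i _; congr enc_bool; elim: (s i) => //= x l ->.
Qed.

Lemma comp_has (b : forall i, A i -> bool) :
  computable (fun p : occ_ctx s ea => enc_bool (b (tag p) (tagged p))) ->
  computable (fun i => enc_bool (has (b i) (s i))).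
Proof.
move=> cb.
have := @comp_foldr C A (fun=> bool) s ea (fun _ => enc_bool)
  (fun i x l => b i x || l) (fun=> false) fs cs (comp_false C).
move=> /(_ (comp_orb (@comp_foldr_elt _ _ _ _ (fun i x => enc_bool (b i x)) cb) (@comp_foldr_acc _ _ _ _))).
by apply: comp_eq => i _; congr enc_bool; elim: (s i) => //= x l ->.
Qed.

Lemma comp_filter (b : forall i, A i -> bool) :
  computable (fun p : occ_ctx s ea => enc_bool (b (tag p) (tagged p))) ->
  computable (fun i => enc_seq [seq ea i x | x <- s i & b i x]).
Proof.
move=> cb.
have := @comp_foldr C A (fun i => seq (A i)) s ea (fun i l => enc_seq [seq ea i x | x <- l])
  (fun i x l => if b i x then x :: l else l) (fun=> [::]) fs cs (comp_leaf C).
move=> H; apply: (comp_eq _ (H _)).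
  by move=> i _; congr (enc_seq (map _ _)); elim: (s i) => //= x l ->.
have := comp_if (@comp_foldr_elt _ _ _ _ (fun i x => enc_bool (b i x)) cb)
  (comp_restrict _ (comp_node (@comp_foldr_elt _ _ _ _ ea (comp_var _ _)) (@comp_foldr_acc _ _ _ _)))
  (comp_restrict _ (@comp_foldr_acc _ _ _ _)) => /(_ _ (fun i l => enc_seq [seq ea i x | x <- l])).
move=> {}H; apply: comp_eq (H _ _) => -[i [x l]] _ /=.
by case: ifP.
Qed.

Lemma comp_cat (t : C -> seq value) :
  computable (fun i => enc_seq (t i)) ->
  computable (fun i => enc_seq ([seq ea i x | x <- s i] ++ t i)).
Proof.
move=> ct.
have := @comp_foldr C A (fun=> seq value) s ea (fun _ => enc_seq)
  (fun i x l => ea i x :: l) t fs cs ct.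
move=> /(_ (comp_node (@comp_foldr_elt _ _ _ _ ea (comp_var _ _)) (@comp_foldr_acc _ _ _ _))).
by apply: comp_eq => i _; congr enc_seq; elim: (s i) => //= x l ->.
Qed.

Lemma comp_size : computable (fun i => enc_nat (size (s i))).
Proof.
apply: (comp_eq _ (@comp_map (fun _ _ => VLeaf) (comp_leaf _))) => i _.
by rewrite /enc_nat; congr enc_seq; elim: (s i) => //= x l ->.
Qed.

End Lists.

(** * Iteration and unary arithmetic *)

Lemma comp_iter C (n : C -> nat) (J : C -> Type) (ej : forall i, J i -> value)
    (g : forall i, J i -> J i) (z : forall i, J i) :
  fpt n -> computable (fun i => enc_nat (n i)) -> computable (fun i => ej i (z i)) ->
  computable (fun p : @extend C J (fun i j => exists2 r, r < n i & j = iter r (g i) (z i)) ej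
          => ej (tag p) (g (tag p) (tagged p))) ->
  computable (fun i => ej i (iter (n i) (g i) (z i))).
Proof.
move=> fn cn cz cg.
(* A unary number is a list of leaves, so iteration is a fold that ignores the elements. *)
pose s i := nseq (n i) VLeaf.
have Hs l i : foldr (fun _ => g i) (z i) l = iter (size l) (g i) (z i).
  by elim: l => //= x l ->.
have := @comp_foldr C (fun=> value) J s (fun _ x => x) ej (fun i _ => g i) z.
move=> H; apply: (comp_eq _ (H _ _ cz _)).
- by move=> i _; rewrite Hs size_nseq.
- by apply: fpt_le fn => i _; rewrite size_nseq.
- by apply: comp_eq cn => i _; rewrite map_id.
apply: (comp_subst (m := fun p : foldr_ctx _ _ _ _ _ =>
  existT _ (tag p) (tagged p).2 :
   @extend C J (fun i j => exists2 r, r < n i & j = iter r (g i) (z i)) ej) _ _ cg).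
  move=> [i [x j]] /= [di [s1 [s2 [ds dj]]]]; split=> //; split=> //.
  exists (size s2); last by rewrite /= dj Hs.
  by have := congr1 size ds; rewrite size_nseq size_cat /= => ->; lia.
have ci := comp_inp (foldr_ctx s (fun _ x => x) ej (fun i _ => g i) z).
by apply: comp_node; [apply: comp_snd (comp_fst ci)|apply: comp_snd ci].
Qed.

Lemma comp_drop C (n : C -> nat) (s : C -> seq value) :
  fpt n -> computable (fun i => enc_nat (n i)) -> computable (fun i => enc_seq (s i)) ->
  computable (fun i => enc_seq (drop (n i) (s i))).
Proof.
move=> fn cn cs.
have := @comp_iter C n (fun=> seq value) (fun=> enc_seq) (fun=> behead) s fn cn cs.
move=> /(_ (comp_behead (comp_var _ _))).
apply: comp_eq => i _; congr enc_seq.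
elim: (n i) (s i) => [|k IH] l; first by rewrite drop0.
by rewrite iterS IH -drop1 drop_drop add1n.
Qed.

Lemma comp_nth C (n : C -> nat) (s : C -> seq value) :
  fpt n -> computable (fun i => enc_nat (n i)) -> computable (fun i => enc_seq (s i)) ->
  computable (fun i => nth VLeaf (s i) (n i)).
Proof.
move=> fn cn cs; apply: comp_eq (comp_head (comp_drop fn cn cs)) => i _.
by rewrite -nth0 nth_drop addn0.
Qed.

Lemma comp_leq C (m n : C -> nat) :
  fpt n -> computable (fun i => enc_nat (m i)) -> computable (fun i => enc_nat (n i)) ->
  computable (fun i => enc_bool (m i <= n i)).
Proof.
move=> fn cm cn; apply: comp_eq (comp_nilp (comp_drop fn cn cm)) => i _.
by rewrite /nilp size_drop size_nseq.
Qed.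

Lemma comp_succ C (n : C -> nat) :
  computable (fun i => enc_nat (n i)) -> computable (fun i => enc_nat (n i).+1).
Proof. by move=> cn; apply: comp_node (comp_leaf _) cn. Qed.

Lemma comp_add C (m n : C -> nat) : fpt m ->
  computable (fun i => enc_nat (m i)) -> computable (fun i => enc_nat (n i)) ->
  computable (fun i => enc_nat (m i + n i)).
Proof.
move=> fm cm cn.
have := @comp_cat C (fun=> value) (fun i => nseq (m i) VLeaf) (fun _ x => x).
move=> H; apply: (comp_eq _ (H _ _ _ cn)) => [i _||].
- by rewrite map_id -nseqD.
- by apply: fpt_le fm => i _; rewrite size_nseq.
by apply: comp_eq cm => i _; rewrite map_id.
Qed.

Lemma comp_mul C (m n : C -> nat) : fpt m -> fpt n ->
  computable (fun i => enc_nat (m i)) -> computable (fun i => enc_nat (n i)) ->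
  computable (fun i => enc_nat (m i * n i)).
Proof.
move=> fm fn cm cn.
have := @comp_iter C m (fun=> nat) (fun=> enc_nat) (fun i k => n i + k) (fun=> 0).
move=> H; apply: (comp_eq _ (H fm cm (comp_leaf _) _)) => [i _|].
  by rewrite iter_addn addn0 mulnC.
set K := extend _ _.
apply: (@comp_add K (fun p => n (tag p)) (fun p => tagged p)).
- exact: fpt_weak.
- exact: comp_weak cn.
- exact: comp_var.
Qed.

(** * Tables indexed by finite types *)

Definition tab (T : finType) (v : T -> value) : value := enc_seq [seq v x | x <- enum T].

Definition enc1 (T : finType) (x : T) : value := enc_set [set x].

Lemma enc_setE (T : finType) (A : {set T}) : enc_set A = tab (fun x => enc_bool (x \in A)).
Proof. by []. Qed.

Lemma enc1E (T : finType) (x : T) : enc1 x = tab (fun y => enc_bool (y == x)).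
Proof. by rewrite /enc1 enc_setE /tab; congr enc_seq; apply: eq_map => y; rewrite inE. Qed.

Lemma eq_tab (T : finType) (v w : T -> value) : v =1 w -> tab v = tab w.
Proof. by move=> vw; rewrite /tab (eq_map vw). Qed.

(** The program gets hold of [T] through its identity matrix, the list of the characteristic vectors
    of its singletons. *)
Definition fin C (T : C -> finType) : Prop :=
  fpt (fun i => #|T i|) /\ computable (fun i => tab (@enc1 (T i))).

Definition elt_ctx C (T : C -> finType) : ctx :=
  @extend C (fun i => T i) (fun _ _ => True) (fun i x => enc1 x).

(** Only the length of the table matters: a fold over it keeps a zero vector and an identity matrix
    of the current size and borders the matrix with one row and one column. Distinctness of the
    entries of [enum] turns equality tests into this pattern. *)
Lemma fin_tab C (T : C -> finType) (v : forall i, T i -> value) :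
  fpt (fun i => #|T i|) -> computable (fun i => tab (v i)) -> fin T.
Proof.
move=> fT cv; split=> //.
pose zeros i (l : seq (T i)) := enc_seq [seq VLeaf | _ <- l].
pose ones i (l : seq (T i)) := enc_seq [seq enc_seq [seq enc_bool (y == x) | y <- l] | x <- l].
have fs : fpt (fun i => size (enum (T i))) by apply: fpt_le fT => i _; rewrite -cardE.
have H := @comp_foldr C (fun i => T i) (fun i => seq (T i)) (fun i => enum (T i)) v
  (fun i l => VNode (zeros i l) (ones i l)) (fun i => cons) (fun=> [::]) fs cv
  (comp_node (comp_leaf _) (comp_leaf _)).
apply: (comp_eq _ (comp_snd (H _))).
  move=> i _; rewrite (_ : foldr _ _ _ = enum (T i)); last by elim: (enum _) => //= x l ->.
  rewrite /ones /tab; congr enc_seq; apply: eq_map => x.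
  by rewrite enc1E /tab.
set K := foldr_ctx _ _ _ _ _.
have cacc : computable (fun p : K => VNode (zeros (tag p) (tagged p).2) (ones (tag p) (tagged p).2)).
  exact: comp_foldr_acc.
have cz := comp_fst cacc; have co := comp_snd cacc.
have fl : @fpt K (fun p => size (tagged p).2).
  apply: fpt_le (fpt_weak _ _ fs) => -[i [x l]] /= [_ [s1 [s2 [-> ->]]]].
  rewrite (_ : foldr _ _ _ = s2); last by elim: s2 => //= y l' ->.
  by rewrite size_cat /=; lia.
have cz' : computable (fun p : K => enc_seq [seq VNode VLeaf x | x <-
    [seq enc_seq [seq enc_bool (y == x) | y <- (tagged p).2] | x <- (tagged p).2]]).
  apply: (@comp_map K (fun=> value)
    (fun p : K => [seq enc_seq [seq enc_bool (y == x) | y <- (tagged p).2] | x <- (tagged p).2])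
    (fun _ x => x) _ _ (fun _ x => VNode VLeaf x)).
  - by apply: fpt_le fl => p _; rewrite size_map.
  - by apply: comp_eq co => p _; rewrite map_id.
  - by apply: comp_node; [exact: comp_leaf|exact: comp_var].
have := comp_node (comp_node (comp_leaf _) cz) (comp_node (comp_node (comp_true _) cz) cz').
apply: comp_eq => -[i [x l]] [_ /= [s1 [s2 [ds dl]]]].
have {dl} -> : l = s2 by rewrite dl; elim: s2 {ds dl} => //= y l' ->.
have : uniq (enum (T i)) by apply: enum_uniq.
rewrite ds cat_uniq => /and3P[_ _ /= /andP[xs2 _]].
rewrite /zeros /ones /= eqxx; congr (VNode _ (VNode (VNode _ _) _)).
  congr enc_seq; apply/eq_in_map => y ys2.
  by case: eqVneq => // yx; rewrite -yx ys2 in xs2.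
rewrite -map_comp; congr enc_seq; apply/eq_in_map => y ys2 /=.
by case: eqVneq => // xy; rewrite xy ys2 in xs2.
Qed.

Lemma fin_weak C J Q w (T : C -> finType) :
  fin T -> fin (fun p : @extend C J Q w => T (tag p)).
Proof.
by move=> [fT cT]; split; [exact: (@fpt_weak C J Q w _ fT)|exact: (@comp_weak C J Q w _ cT)].
Qed.

Lemma fin_restrict C Q (T : C -> finType) : fin T -> fin (T : @restrict C Q -> finType).
Proof.
by move=> [fT cT]; split; [exact: (@fpt_restrict C Q _ fT)|exact: (@comp_restrict C Q _ cT)].
Qed.

Section Tables.
Variables (C : ctx) (T : C -> finType).
Hypothesis fT : fin T.

Lemma fpt_enum : fpt (fun i => size (enum (T i))).
Proof. by have [f _] := fT; apply: fpt_le f => i _; rewrite -cardE. Qed.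

Lemma comp_elt (v : forall i, T i -> value) :
  computable (fun p : elt_ctx T => v (tag p) (tagged p)) ->
  computable (fun p : occ_ctx (fun i => enum (T i)) (fun i x => enc1 x) => v (tag p) (tagged p)).
Proof.
apply: (@comp_subst (elt_ctx T) (occ_ctx (fun i => enum (T i)) (fun i x => enc1 x))
  (fun p => existT _ (tag p) (tagged p))); first by move=> [i x] [].
exact: comp_inp.
Qed.

Lemma comp_tab (v : forall i, T i -> value) :
  computable (fun p : elt_ctx T => v (tag p) (tagged p)) -> computable (fun i => tab (v i)).
Proof.
move=> /comp_elt cv; exact: (@comp_map C _ _ _ fpt_enum fT.2 v cv).
Qed.

Lemma comp_set (A : forall i, {set T i}) :
  computable (fun p : elt_ctx T => enc_bool (tagged p \in A (tag p))) ->
  computable (fun i => enc_set (A i)).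
Proof. exact: comp_tab. Qed.

Lemma comp_forall (b : forall i, T i -> bool) :
  computable (fun p : elt_ctx T => enc_bool (b (tag p) (tagged p))) ->
  computable (fun i => enc_bool [forall x, b i x]).
Proof.
move=> /(@comp_elt (fun i x => enc_bool (b i x))) cb.
apply: (comp_eq _ (comp_all fpt_enum fT.2 cb)) => i _; congr enc_bool.
apply/allP/forallP => [H x|H x _]; last exact: H.
by apply: H; rewrite mem_enum.
Qed.

Lemma comp_exists (b : forall i, T i -> bool) :
  computable (fun p : elt_ctx T => enc_bool (b (tag p) (tagged p))) ->
  computable (fun i => enc_bool [exists x, b i x]).
Proof.
move=> /(@comp_elt (fun i x => enc_bool (b i x))) cb.
apply: (comp_eq _ (comp_has fpt_enum fT.2 cb)) => i _; congr enc_bool.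
apply/hasP/existsP => [[x _ bx]|[x bx]]; exists x => //.
by rewrite mem_enum.
Qed.

(** Zipping the characteristic vector of [x i] with the table marks the entry to select. *)
Lemma comp_lookup (v : forall i, T i -> value) (x : forall i, T i) :
  computable (fun i => tab (v i)) -> computable (fun i => enc1 (x i)) ->
  computable (fun i => v i (x i)).
Proof.
move=> cv cx.
have fs : fpt (fun i => size [seq enc_bool (y == x i) | y <- enum (T i)]).
  by apply: fpt_le fpt_enum => i _; rewrite size_map.
have cx' : computable (fun i => enc_seq [seq enc_bool (y == x i) | y <- enum (T i)]).
  by apply: comp_eq cx => i _; rewrite enc1E.
have cz : computable (fun i => enc_seq [seq VNode (enc_bool (y == x i)) (v i y) | y <- enum (T i)]).
  by apply: comp_eq (comp_zip fs cx' cv) => i _; rewrite zip_map -map_comp.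
have H := @comp_foldr C (fun i => T i) (fun=> value) (fun i => enum (T i))
  (fun i y => VNode (enc_bool (y == x i)) (v i y)) (fun _ a => a)
  (fun i y a => if y == x i then v i y else a) (fun=> VLeaf) fpt_enum cz (comp_leaf _).
apply: (comp_eq _ (H _)).
  move=> i _; have : x i \in enum (T i) by rewrite mem_enum.
  elim: (enum (T i)) => //= y l IH; rewrite inE eq_sym.
  by case: eqVneq => [-> //|_]; apply: IH.
set K := foldr_ctx _ _ _ _ _.
have ce : computable (fun p : K => VNode (enc_bool ((tagged p).1 == x (tag p))) (v (tag p) (tagged p).1)).
  exact: comp_fst (comp_fst (comp_inp K)).
have ca : computable (fun p : K => (tagged p).2).
  exact: comp_snd (comp_fst (comp_inp K)).
exact: comp_if (comp_fst ce) (comp_restrict _ (comp_snd ce)) (comp_restrict _ ca).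
Qed.

Lemma comp_mem (A : forall i, {set T i}) (x : forall i, T i) :
  computable (fun i => enc1 (x i)) -> computable (fun i => enc_set (A i)) ->
  computable (fun i => enc_bool (x i \in A i)).
Proof.
move=> cx cA.
exact: (@comp_lookup (fun i y => enc_bool (y \in A i)) x cA cx).
Qed.

Lemma comp_eqb (x y : forall i, T i) :
  computable (fun i => enc1 (x i)) -> computable (fun i => enc1 (y i)) ->
  computable (fun i => enc_bool (x i == y i)).
Proof.
move=> cx cy; apply: comp_eq (comp_mem (A := fun i => [set y i]) cx cy) => i _.
by rewrite inE.
Qed.

End Tables.

Lemma comp_enum C (T : C -> finType) (A : forall i, {set T i}) : fin T ->
  computable (fun i => enc_set (A i)) ->
  computable (fun i => enc_seq [seq enc1 x | x <- enum (A i)]).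
Proof.
move=> fT cA.
have := @comp_filter C (fun i => T i) (fun i => enum (T i)) (fun i x => enc1 x)
  (fpt_enum fT) fT.2 (fun i x => x \in A i).
move=> H; apply: (comp_eq _ (H _)).
  by move=> i _; rewrite {2}/enum_mem -enumT.
apply: (@comp_elt _ _ (fun i x => enc_bool (x \in A i))).
apply: (@comp_mem (elt_ctx T) (fun p => T (tag p)) _ (fun p => A (tag p)) (fun p => tagged p)).
- exact: fin_weak fT.
- exact: comp_var.
- exact: comp_weak cA.
Qed.

(** * Partial solutions and exchange *)

Definition restr (T : finType) (r : rel T) (A : {set T}) : rel T :=
  fun u v => [&& u \in A, v \in A & r u v].

Lemma connect_elim (T : finType) (r : rel T) (P : T -> Prop) x y :
  P x -> (forall u v, connect r x u -> P u -> r u v -> P v) ->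
  connect r x y -> P y.
Proof.
move=> Px step /connectP[p rp ->].
elim/last_ind: p rp => [//|p z IH]; rewrite rcons_path last_rcons => /andP[rp rz].
by apply: step rz; [apply/connectP; exists p|apply: IH].
Qed.

Lemma connect_first (T : finType) (r : rel T) x y :
  connect r x y -> x != y -> exists2 z, r x z & connect r z y.
Proof.
case/connectP=> [[|z p] /=]; first by move=> _ ->; rewrite eqxx.
by case/andP=> rxz pz -> _; exists z => //; apply/connectP; exists p.
Qed.

Lemma restr_sym (T : finType) (r : rel T) (A : {set T}) :
  symmetric r -> symmetric (restr r A).
Proof. by move=> sr u v; rewrite /restr sr andbCA. Qed.

Lemma restr_csym (T : finType) (r : rel T) (A : {set T}) x y :
  symmetric r -> connect (restr r A) x y -> connect (restr r A) y x.
Proof. by move=> sr; rewrite (sym_connect_sym (restr_sym A sr)). Qed.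

Lemma connect_restrS (T : finType) (r r' : rel T) (A B : {set T}) x y :
  A \subset B -> {in A &, subrel r r'} ->
  connect (restr r A) x y -> connect (restr r' B) x y.
Proof.
move=> AB rr'; apply: connect_sub => u v /and3P[uA vA ruv]; apply: connect1.
by rewrite /restr !(subsetP AB) //= rr'.
Qed.

Definition connb (T : finType) (r : rel T) (A : {set T}) : bool :=
  [forall x, forall y, (x \in A) && (y \in A) ==> connect (restr r A) x y].

Lemma connP (T : finType) (r : rel T) (A : {set T}) :
  reflect (connected_in r A) (connb r A).
Proof.
apply: (iffP forallP) => [H x y xA yA|H x]; last first.
  by apply/forallP => y; apply/implyP => /andP[]; apply: H.
by have /forallP/(_ y)/implyP := H x; rewrite xA yA; apply.
Qed.

Definition coversb (T : finType) (r : rel T) (A P : {set T}) : bool :=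
  [forall x, forall y, [&& x \in A, y \in A & r x y] ==> (x \in P) || (y \in P)].

Lemma coversP (T : finType) (r : rel T) (A P : {set T}) :
  reflect {in A &, forall x y, r x y -> (x \in P) || (y \in P)} (coversb r A P).
Proof.
apply: (iffP forallP) => [H x y xA yA rxy|H x]; last first.
  by apply/forallP => y; apply/implyP => /and3P[]; apply: H.
by have /forallP/(_ y)/implyP := H x; rewrite xA yA rxy; apply.
Qed.

Definition dominatesb (T : finType) (r : rel T) (A P : {set T}) : bool :=
  [forall x, (x \in A) && (x \notin P) ==> [exists y, (y \in P) && r x y]].

Lemma dominatesP (T : finType) (r : rel T) (A P : {set T}) :
  reflect {in A, forall x, x \notin P -> exists2 y, y \in P & r x y} (dominatesb r A P).
Proof.
apply: (iffP forallP) => [H x xA xP|H x]; last first.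
  apply/implyP => /andP[xA /(H _ xA)[y yP rxy]].
  by apply/existsP; exists y; rewrite yP.
have := H x; rewrite xA xP => /existsP[y /andP[]]; by exists y.
Qed.

(* [cv] selects vertex covers ([true]) or dominating sets ([false]). *)
Definition solvesb (cv : bool) (T : finType) (r : rel T) (A P : {set T}) : bool :=
  (if cv then coversb r A P else dominatesb r A P) && connb r P.

Definition problem (cv : bool) : vertex_subset_problem :=
  if cv then ConnectedVertexCover else ConnectedDominatingSet.

Lemma problemP cv (G : sgraph) (S : {set G}) :
  reflect (problem cv S) (solvesb cv (@adj G) setT S).
Proof.
apply: (iffP andP); case: cv => -[H /connP cS]; split=> //.
- by move=> x y; apply: (coversP _ _ _ H).
- by move=> x; apply: (dominatesP _ _ _ H).
- by apply/coversP => x y _ _; apply: H.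
- by apply/dominatesP => x _; apply: H.
Qed.

Section Exchange.
Variables (cv : bool) (G : sgraph).
Implicit Types (A X S P : {set G}) (E : {set G * G}).

Definition vdiag E : {set G} := [set x | (x, x) \in E].

(** Diagonal pairs add no loops; they only mark, through [vdiag], the vertices forced into a
    solution. *)
Definition adjE E : rel G :=
  fun x y => adj x y || (x != y) && (((x, y) \in E) || ((y, x) \in E)).

Lemma adjE_sym E : symmetric (adjE E).
Proof. by move=> x y; rewrite /adjE adj_sym eq_sym orbC [in RHS]orbC [X in _ && X]orbC. Qed.

Lemma adjE_irr E : irreflexive (adjE E).
Proof. by move=> x; rewrite /adjE adj_irrefl eqxx. Qed.

Definition partial_solution E A P : bool :=
  [&& vdiag E \subset P, P \subset A & solvesb cv (adjE E) A P].

Definition separated A X : Prop :=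
  forall u v, adj u v -> u \in A -> u \notin X -> v \in A.

(* What the rest of the graph contributes to a solution [S]: the connections
   between boundary vertices that avoid the interior of [A]. *)
Definition trace A X S : {set G * G} :=
  [set p | [&& p.1 \in X, p.2 \in S :&: X
    & connect (restr (@adj G) (p.1 |: (S :\: (A :\: X)))) p.1 p.2]].

Variables (A X S : {set G}).
Hypothesis (XA : X \subset A) (sepA : separated A X).
Hypothesis (solS : problem cv S) (SA : S :&: A != set0).

Let O := S :\: (A :\: X).
Let E := trace A X S.

Lemma conn_sol : connected_in (@adj G) S.
Proof. by move: solS; case: (cv) => -[]. Qed.

Lemma mem_outside x : (x \in O) = (x \in S) && ((x \in A) ==> (x \in X)).
Proof. by rewrite !inE; case: (x \in X); case: (x \in A); case: (x \in S). Qed.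

(** Follow a path inside [S] from [s] to a vertex of [S :&: A]. By separation it can enter [A] only
    at a vertex of [X], and up to that point it stays outside the interior. *)
Lemma outside_boundary s :
  s \in O -> exists2 y, y \in S :&: X & connect (restr (@adj G) O) s y.
Proof.
move=> sO; have sS : s \in S by move: sO; rewrite mem_outside => /andP[].
have /set0Pn[p] := SA; rewrite inE => /andP[pS pA].
pose Q w := (w \notin A /\ connect (restr (@adj G) O) s w) \/
    (exists2 y, y \in S :&: X & connect (restr (@adj G) O) s y).
suff [[]|//] : Q p by rewrite pA.
apply: (@connect_elim _ (restr (@adj G) S) Q s p _ _ (conn_sol sS pS)).
  have [sA|sA] := boolP (s \in A); last by left.
  right; exists s => //; rewrite inE sS /=.
  by move: sO; rewrite mem_outside sS sA.
move=> u v _ [[uA cu]|bu] /and3P[uS vS uv]; last by right.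
have uO : u \in O by rewrite mem_outside uS (negPf uA).
have vO : v \in O.
  rewrite mem_outside vS; apply/implyP => vA; apply: contraNT uA.
  by apply: sepA vA; rewrite adj_sym.
have cv' : connect (restr (@adj G) O) s v.
  by apply: connect_trans cu (connect1 _); rewrite /restr uO vO.
have [vA|vA] := boolP (v \in A); last by left.
by right; exists v => //; move: vO; rewrite mem_outside vA inE /= => /andP[-> ->].
Qed.

Lemma trace_diag x : (x \in vdiag E) = (x \in S :&: X).
Proof.
rewrite !inE /= connect0 andbT; by case: (x \in X); rewrite ?andbT ?andbF.
Qed.

Lemma trace_sub : E \subset setX X X.
Proof. by apply/subsetP => -[x y]; rewrite !inE /= => /and3P[-> /andP[_ ->]]. Qed.

Lemma trace_boundary x y : x \in O -> x \in X -> y \in S :&: X ->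
  connect (restr (@adj G) O) x y -> (x \in S) -> (x, y) \in E.
Proof.
move=> xO xX yY cxy xS; rewrite inE /= xX yY /=.
by apply: connect_restrS cxy => //; apply: subsetUr.
Qed.

(** An excursion of a path outside [A] leaves and re-enters through [X], so a pair of [E] short-cuts
    it. A vertex [x] of [A] dominated only from outside lies in [X], and its dominator reaches some
    [y] in [S :&: X]; then [(x, y)] is in [E]. This is why the first component of a trace pair may
    lie outside [S]. *)
Lemma partial_of_solution : partial_solution E A (S :&: A).
Proof.
apply/and3P; split; rewrite ?subsetIr //.
  apply/subsetP => x; rewrite trace_diag !inE => /andP[-> xX].
  exact: (subsetP XA).
have E_S x y : (x, y) \in E -> (y \in S) && (y \in A).
  by rewrite !inE /= => /and3P[_ /andP[-> /(subsetP XA) ->]].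
rewrite /solvesb; apply/andP; split.
  have := solS; case: (cv) => -[covS _].
    apply/coversP => x y xA yA; rewrite !inE xA yA !andbT => /orP[/covS //|].
    by case/andP=> _ /orP[] /E_S/andP[-> _]; rewrite ?orbT.
  apply/dominatesP => x xA; rewrite inE xA andbT => xS.
  have [s sS xs] := covS x xS.
  have [sA|sA] := boolP (s \in A); first by exists s; rewrite ?inE ?sS // /adjE xs.
  have xX : x \in X by apply: contraNT sA; apply: sepA xs xA.
  have sO : s \in O by rewrite mem_outside sS (negPf sA).
  have [y yY csy] := outside_boundary sO.
  have xyE : (x, y) \in E.
    rewrite inE /= xX yY /=; apply: (@connect_trans _ _ s).
      by apply: connect1; rewrite /restr !in_setU1 eqxx sO orbT xs.
    by apply: connect_restrS csy => //; apply: subsetUr.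
  have [yS yA] := andP (E_S _ _ xyE).
  exists y; first by rewrite inE yS.
  rewrite /adjE xyE /= (_ : x != y) ?orbT //.
  by apply: contraNneq xS => ->.
apply/connP => x y; rewrite !inE => /andP[xS xA] /andP[yS yA].
pose c w := connect (restr (adjE E) (S :&: A)) x w.
(* Outside [A] the invariant remembers the boundary vertex [z] at which the path last left [A]. *)
pose Q w := if w \in A then is_true (c w)
  else exists2 z, z \in S :&: X & c z /\ connect (restr (@adj G) O) z w.
suff : Q y by rewrite /Q yA.
apply: (@connect_elim _ (restr (@adj G) S) Q x y _ _ (conn_sol xS yS)).
  by rewrite /Q xA /c connect0.
rewrite /Q.
move=> u v _ cu /and3P[uS vS uv].
move: cu; case: (boolP (u \in A)) => uA cu; case: (boolP (v \in A)) => vA.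
- apply: connect_trans cu (connect1 _).
  by rewrite /restr !inE uS uA vS vA /adjE uv.
- have uX : u \in X by apply: contraNT vA; apply: sepA uv uA.
  exists u; first by rewrite inE uS.
  split=> //; apply: connect1; rewrite /restr !mem_outside uS vS uX (negPf vA) uv.
  by rewrite implybT.
- have vX : v \in X.
    by apply: contraNT uA; apply: sepA vA; rewrite adj_sym.
  case: cu => z zY [cz czu]; have := zY; rewrite inE => /andP[zS zX].
  have vO : v \in O by rewrite mem_outside vS vX implybT.
  have uO : u \in O by rewrite mem_outside uS (negPf uA).
  have zO : z \in O by rewrite mem_outside zS zX implybT.
  have zvE : (z, v) \in E.
    apply: trace_boundary => //; first by rewrite inE vS.
    by apply: connect_trans czu (connect1 _); rewrite /restr uO vO.
  have [<- //|zv] := eqVneq z v.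
  apply: connect_trans cz (connect1 _).
  by rewrite /restr !inE zS (subsetP XA _ zX) vS vA /adjE zvE zv orbT.
- case: cu => z zY [cz czu]; exists z => //; split=> //.
  apply: connect_trans czu (connect1 _).
  by rewrite /restr !mem_outside uS vS (negPf uA) (negPf vA).
Qed.

(** The forced diagonal keeps [O] inside the new set, so the outside paths recorded in [E] survive
    and realize the added edges. If [x] outside [P] is dominated only along a pair [(x, u)] of [E],
    the first step of the recorded path from [x] leads to a vertex of [O] adjacent to [x] in [G]; a
    pair [(u, x)] would put [x] into [P]. *)
Lemma exchange P : partial_solution E A P ->
  S :&: X \subset P /\ problem cv ((S :\: A) :|: P).
Proof.
case/and3P => diagP PA /andP[coverP /connP connP'].
have SXP : S :&: X \subset P.
  by apply: subset_trans diagP; apply/subsetP => x; rewrite trace_diag.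
split=> //; set S1 := _ :|: P.
have E_S x y : (x, y) \in E -> y \in P.
  by rewrite inE /= => /and3P[_ yY _]; apply: (subsetP SXP).
have OS1 : O \subset S1.
  apply/subsetP => x; rewrite mem_outside !inE => /andP[xS].
  have [xA /= xX|//] := boolP (x \in A); last by rewrite xS.
  by rewrite (subsetP SXP) // inE xS.
have outO x y : adj x y -> x \notin A -> y \in S -> y \in O.
  move=> xy xA yS; rewrite mem_outside yS; apply/implyP => yA.
  by apply: contraNT xA; apply: sepA yA; rewrite adj_sym.
have PS1 : P \subset S1 by apply: subsetUr.
have cS1 : connected_in (@adj G) S1.
  have cE x y : (x, y) \in E -> x \in P -> connect (restr (@adj G) S1) x y.
    rewrite inE /= => /and3P[_ _ cxy] xP; apply: connect_restrS cxy => //.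
    by rewrite subUset OS1 sub1set (subsetP PS1).
  have cP : {in P &, forall x y, connect (restr (@adj G) S1) x y}.
    move=> x y xP yP; have := connP' x y xP yP; apply: connect_sub => u v.
    case/and3P => uP vP /orP[uv|/andP[_ /orP[/cE ->|/cE vu]]] //.
      by apply: connect1; rewrite /restr !(subsetP PS1).
    by apply: restr_csym; [apply: adj_sym|apply: vu].
  have toP x : x \in S1 -> exists2 y, y \in P & connect (restr (@adj G) S1) x y.
    have [xP|xP] := boolP (x \in P); first by exists x.
    move=> xS1; have /outside_boundary[y yY cxy] : x \in O.
      move: xS1; rewrite !inE (negPf xP) orbF => /andP[/negPf xA ->].
      by rewrite xA andbF.
    exists y; first exact: (subsetP SXP).
    exact: connect_restrS cxy.
  move=> x y /toP[x' x'P cx] /toP[y' y'P cy].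
  apply: connect_trans cx (connect_trans (cP _ _ x'P y'P) _).
  by apply: restr_csym cy; apply: adj_sym.
have := solS; case: (cv) coverP => coverP -[covS _]; split=> //.
  move=> x y xy.
  have [xA|xA] := boolP (x \in A); last first.
    have /orP[xS|yS] := covS _ _ xy; first by rewrite !inE xS xA.
    by rewrite (subsetP OS1 y) ?orbT // (outO _ _ xy).
  have [yA|yA] := boolP (y \in A); last first.
    have /orP[xS|yS] := covS _ _ xy; last by rewrite !inE yS yA !orbT.
    by rewrite (subsetP OS1 x) // (outO y) // adj_sym.
  have : adjE E x y by rewrite /adjE xy.
  move/(coversP _ _ _ coverP _ _ xA yA).
  by case/orP=> /(subsetP PS1) ->; rewrite ?orbT.
move=> x xS1; have [xA|xA] := boolP (x \in A); last first.
  have xS : x \notin S by apply: contra xS1 => xS; rewrite !inE xS xA.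
  have [s sS xs] := covS x xS; exists s => //.
  by apply: (subsetP OS1); apply: outO xs _ sS.
have xP : x \notin P by apply: contra xS1; apply: (subsetP PS1).
have [u uP /orP[xu|/andP[xu uE]]] := dominatesP _ _ _ coverP x xA xP.
  by exists u => //; apply: (subsetP PS1).
case/orP: uE => [xuE|/E_S]; last by rewrite (negPf xP).
move: xuE; rewrite inE /= => /and3P[_ _ /connect_first/(_ xu)[z /and3P[_]]].
rewrite in_setU1; case: eqVneq => [->|_ /=]; first by rewrite adj_irrefl.
by move=> zO xz _; exists z => //; apply: (subsetP OS1).
Qed.

End Exchange.

(** * Partial solutions as solutions of a gadget graph *)

Lemma induced_problem cv (G : sgraph) (B : {set G}) (Q : {set induced B}) :
  problem cv Q <-> solvesb cv (@adj G) B (val @: Q).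
Proof.
have mem_val (z : induced B) : (val z \in val @: Q) = (z \in Q).
  by rewrite mem_imset //; apply: val_inj.
have conE : connb (@adj (induced B)) Q = connb (@adj G) (val @: Q).
  apply/connP/connP => H x y.
    case/imsetP=> x' xQ -> /imsetP[y' yQ ->].
    pose R (w : induced B) := connect (restr (@adj G) (val @: Q)) (val x') (val w) : Prop.
    apply: (@connect_elim _ (restr (@adj (induced B)) Q) R x' y' _ _ (H _ _ xQ yQ)).
      exact: connect0.
    move=> u v _ cu /and3P[uQ vQ uv]; apply: connect_trans cu (connect1 _).
    by rewrite /restr !mem_val uQ vQ.
  move=> xQ yQ.
  pose R (w : G) := exists2 w' : induced B, w = val w' &
    connect (restr (@adj (induced B)) Q) x w' : Prop.
  have vxQ : val x \in val @: Q by rewrite mem_val.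
  have vyQ : val y \in val @: Q by rewrite mem_val.
  have [||y' /val_inj -> //] := @connect_elim _ (restr (@adj G) (val @: Q)) R _ _ _ _ (H _ _ vxQ vyQ).
    by exists x.
  move=> u v _ [u' -> cu] /and3P[uQ /imsetP[v' vQ ->] uv]; exists v' => //.
  apply: connect_trans cu (connect1 _); rewrite mem_val in uQ.
  by rewrite /restr uQ vQ.
apply: (iff_trans (rwP (problemP cv Q))); rewrite /solvesb conE.
suff -> : (if cv then coversb (@adj (induced B)) setT Q else dominatesb (@adj (induced B)) setT Q) =
  (if cv then coversb (@adj G) B (val @: Q) else dominatesb (@adj G) B (val @: Q)) by [].
case: (cv).
  apply/coversP/coversP => H x y.
    move=> xB yB xy; pose x' : induced B := Sub x xB; pose y' : induced B := Sub y yB.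
    have := H x' y' (in_setT _) (in_setT _); rewrite -!mem_val !SubK; exact.
  by move=> _ _ xy; rewrite -!mem_val; apply: H => //; apply: valP.
apply/dominatesP/dominatesP => H x.
  move=> xB; pose x' : induced B := Sub x xB => xQ.
  have [|y yQ xy] := H x' (in_setT _); first by rewrite -mem_val SubK.
  by exists (val y); rewrite ?mem_val.
move=> _ xQ; have [||y /imsetP[y' yQ ->] xy] := H (val x).
- exact: valP.
- by rewrite mem_val.
by exists y'.
Qed.

Section Gadget.
Variables (cv : bool) (G : sgraph) (E : {set G * G}).
Implicit Types (A X S P : {set G}).

Definition pendant_of (p : G + G) : G := match p with inl x => x | inr x => x end.

(* Two pendant vertices per element of the diagonal force it into a connected
   solution: a solution avoiding it would contain or miss both of them. *)
Definition pendant_adj : rel (G + (G + G))%type := fun z w =>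
  match z, w with
  | inl x, inl y => adjE E x y
  | inl x, inr p | inr p, inl x => (x \in vdiag E) && (pendant_of p == x)
  | _, _ => false
  end.

Fact pendant_sym : symmetric pendant_adj.
Proof. by move=> [x|p] [y|q] //=; apply: adjE_sym. Qed.

Fact pendant_irrefl : irreflexive pendant_adj.
Proof. by move=> [x|p] //=; apply: adjE_irr. Qed.

Definition pendant_graph : sgraph := SGraph pendant_sym pendant_irrefl.

(** The remaining pendant copies are isolated. Kept, they would have to belong to every dominating
    set, and their number would not be bounded by the boundary. *)
Definition gadget_vertices A : {set pendant_graph} :=
  [set z | match z with inl x => x \in A | inr p => pendant_of p \in vdiag E end].

Definition gadget A : sgraph := induced (gadget_vertices A).

Definition gadget_embed A P : {set gadget A} :=
  [set z | if val z is inl x then x \in P else false].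

Definition gadget_project A (Q : {set gadget A}) : {set G} :=
  [set x | [exists z in Q, val z == inl x]].

Lemma mem_project A (Q : {set gadget A}) x :
  (x \in gadget_project Q) = (inl x \in val @: Q).
Proof.
rewrite inE; apply/existsP/imsetP => [[z /andP[zQ /eqP]]|[z zQ ->]].
  by exists z.
by exists z; rewrite zQ eqxx.
Qed.

Lemma card_project A (Q : {set gadget A}) : #|gadget_project Q| <= #|Q|.
Proof.
rewrite -(card_imset _ (@inl_inj G (G + G))) -(card_imset Q val_inj).
by apply/subset_leq_card/subsetP => _ /imsetP[x xQ ->]; rewrite -mem_project.
Qed.

Lemma embedE A P : P \subset A -> val @: gadget_embed A P = [set inl x | x in P].
Proof.
move=> PA; apply/setP => z; apply/imsetP/imsetP => [[z' ]|[x xP ->]].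
  by rewrite inE; case: (val z') => // x xP ->; exists x.
have xA : inl x \in gadget_vertices A by rewrite inE (subsetP PA).
by exists (Sub (inl x) xA); rewrite ?inE.
Qed.

Lemma card_embed A P : P \subset A -> #|gadget_embed A P| = #|P|.
Proof.
by move=> PA; rewrite -(card_imset _ val_inj) embedE // card_imset //; apply: inl_inj.
Qed.

Lemma project_sub A (Q : {set gadget A}) : gadget_project Q \subset A.
Proof.
apply/subsetP => x; rewrite mem_project => /imsetP[[z zA] /= _ xz].
by move: zA; rewrite -xz inE.
Qed.

Lemma partial_embed A P : partial_solution cv E A P -> problem cv (gadget_embed A P).
Proof.
case/and3P => dP PA; rewrite induced_problem embedE // => /andP[cov /connP con].
have mem_inl x : ((inl x : pendant_graph) \in [set (inl x : pendant_graph) | x in P]) = (x \in P).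
  by rewrite mem_imset //; apply: inl_inj.
apply/andP; split; last first.
  apply/connP => _ _ /imsetP[x xP ->] /imsetP[y yP ->].
  pose R (w : G) := connect (restr (@adj pendant_graph) [set inl x | x in P]) (inl x) (inl w) : Prop.
  apply: (@connect_elim _ (restr (adjE E) P) R x y _ _ (con _ _ xP yP)); first exact: connect0.
  move=> u v _ cu /and3P[uP vP uv]; apply: connect_trans cu (connect1 _).
  by rewrite /restr !mem_inl uP vP.
case: (cv) cov => cov.
  apply/coversP => -[x|p] [y|q]; rewrite !inE /= => xA yA //.
  - by rewrite !mem_inl; apply: (coversP _ _ _ cov).
  - by case/andP=> xd _; rewrite mem_inl (subsetP dP).
  - by case/andP=> xd _; rewrite mem_inl (subsetP dP) ?orbT.
apply/dominatesP => -[x|p]; rewrite inE.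
  rewrite mem_inl => xA xP; have [y yP xy] := dominatesP _ _ _ cov x xA xP.
  by exists (inl y); rewrite ?mem_inl.
move=> pd _; exists (inl (pendant_of p)); first by rewrite mem_inl (subsetP dP).
by rewrite /adj /= pd eqxx.
Qed.

Lemma project_partial A (Q : {set gadget A}) : vdiag E \subset A ->
  problem cv Q -> partial_solution cv E A (gadget_project Q).
Proof.
move=> dA /induced_problem; set Q' := val @: Q => /andP[cov /connP con].
have mem_inl x : (x \in gadget_project Q) = (inl x \in Q') by rewrite mem_project.
have dQ : vdiag E \subset gadget_project Q.
  apply/subsetP => y yd; rewrite mem_inl; have yA := subsetP dA _ yd.
  apply: contraT => yQ.
  pose p b : pendant_graph := inr (if b then inl y else inr y).
  have pE b : pendant_of (if b then inl y else inr y) = y by case: b.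
  have pV b : p b \in gadget_vertices A by rewrite inE /p pE.
  have adj_p b z : z \in Q' -> ~~ pendant_adj (p b) z.
    case: z => // x xQ; rewrite /= pE.
    by apply: contraNN yQ => /andP[_ /eqP ->].
  (* If [y] is missing, both of its pendants are in the solution, as [y] is their only neighbour.
     Each is then isolated there, which contradicts connectivity. *)
  have pQ b : p b \in Q'.
    case: (cv) cov => cov.
      have yV : (inl y : pendant_graph) \in gadget_vertices A by rewrite inE.
      have := coversP _ _ _ cov _ _ yV (pV b); rewrite (negPf yQ) /= => -> //.
      by rewrite yd pE eqxx.
    apply: contraT => pQ; have [z zQ pz] := dominatesP _ _ _ cov _ (pV b) pQ.
    by case/negP: (adj_p b z zQ).
  have [//|z /and3P[_ zQ pz] _] := connect_first (con _ _ (pQ true) (pQ false)).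
  by case/negP: (adj_p true z zQ).
apply/and3P; split; rewrite ?project_sub //; apply/andP; split; last first.
  apply/connP => x y; rewrite !mem_inl => xQ yQ.
  (* Contracting each pendant to the vertex it hangs from turns paths of [Q'] into walks of the
     projection that may pause. *)
  pose f (z : pendant_graph) := match z with inl x => x | inr p => pendant_of p end.
  pose R (w : pendant_graph) := connect (restr (adjE E) (gadget_project Q)) x (f w) : Prop.
  apply: (@connect_elim _ (restr (@adj pendant_graph) Q') R (inl x) (inl y) _ _ (con _ _ xQ yQ)).
    exact: connect0.
  move=> [u|p] [v|q] _; rewrite /R /= => cu /and3P[uQ vQ] //=.
  - move=> uv; apply: connect_trans cu (connect1 _).
    by rewrite /restr !mem_inl uQ vQ.
  - by case/andP=> _ /eqP ->.
  - by case/andP=> _ /eqP <-.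
case: (cv) cov => cov.
  apply/coversP => x y xA yA xy; rewrite !mem_inl.
  by apply: (coversP _ _ _ cov); rewrite ?inE.
apply/dominatesP => x xA xQ.
have [||[y|p] yQ] := dominatesP _ _ _ cov (inl x).
- by rewrite inE.
- by rewrite -mem_inl.
- by move=> xy; exists y; rewrite ?mem_inl.
by case/andP=> xd _; rewrite (subsetP dQ) in xQ.
Qed.

(* Testing this set decides whether the gadget has a solution; otherwise the scheme
   may return anything, even a closure, which no term can inspect. *)
Definition canonical A : {set G} :=
  if cv then [set x in A | (x \in vdiag E) || [exists y, (y \in A) && adjE E x y]] else A.

(** Every vertex of the canonical set outside [P] has a neighbour in [P]: the other end of an edge
    that [P] covers, or a dominator. Adding all of them to [P] thus preserves connectivity. *)
Lemma canonical_partial A P :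
  partial_solution cv E A P -> partial_solution cv E A (canonical A).
Proof.
case/and3P => dP PA /andP[cov /connP con].
have CA : canonical A \subset A.
  by rewrite /canonical; case: (cv) => //; apply/subsetP => x; rewrite inE => /andP[].
have stepC u v : restr (adjE E) P u v -> restr (adjE E) (canonical A) u v.
  case/and3P=> uP vP uv; rewrite /restr uv andbT /canonical; case: (cv).
    rewrite !inE !(subsetP PA) //=; apply/andP; split; apply/orP; right; apply/existsP.
      by exists v; rewrite (subsetP PA) ?uv.
    by exists u; rewrite (subsetP PA) // adjE_sym.
  by rewrite !(subsetP PA).
have toP x : x \in canonical A ->
    exists2 y, y \in P & connect (restr (adjE E) (canonical A)) x y.
  have [xP|xP] := boolP (x \in P); first by exists x.
  move=> xC; have xA := subsetP CA _ xC.
  suff [y yP [yC xy]] : exists2 y, y \in P & y \in canonical A /\ adjE E x y.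
    by exists y => //; apply: connect1; rewrite /restr xC yC.
  move: (xC) cov; rewrite /canonical; case: (cv) => xC' cov.
    move: xC'; rewrite inE xA; case: (boolP (x \in vdiag E)) => [/(subsetP dP)|_ /=].
      by rewrite (negPf xP).
    case/existsP=> y /andP[yA xy].
    have := coversP _ _ _ cov _ _ xA yA xy; rewrite (negPf xP) /= => yP.
    exists y => //; split=> //; rewrite inE yA /=; apply/orP; right.
    by apply/existsP; exists x; rewrite xA adjE_sym.
  have [y yP xy] := dominatesP _ _ _ cov x xA xP.
  by exists y => //; rewrite (subsetP PA).
apply/and3P; split=> //.
  apply/subsetP => x xd; have xA := subsetP PA _ (subsetP dP _ xd).
  by rewrite /canonical; case: (cv); rewrite ?inE // xA; move: xd; rewrite inE => ->.
apply/andP; split; last first.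
  apply/connP => x y /toP[x' x'P cx] /toP[y' y'P cy].
  apply: connect_trans cx (connect_trans _ (restr_csym _ cy)); last exact: adjE_sym.
  by apply: connect_sub (con _ _ x'P y'P) => u v /stepC; apply: connect1.
rewrite /canonical; case: (cv).
  apply/coversP => x y xA yA xy; rewrite inE xA /=; apply/orP; left.
  by apply/orP; right; apply/existsP; exists y; rewrite yA.
by apply/dominatesP => x ->.
Qed.

Definition gadget_modulator A X : {set gadget A} :=
  [set z | if val z is inl x then x \in X else true].

(** The factor counts a boundary vertex and its two pendants, since the diagonal of [E] lies in
    [X]. *)
Lemma card_modulator A X : E \subset setX X X -> #|gadget_modulator A X| <= 3 * #|X|.
Proof.
move=> EX; rewrite -(card_imset _ val_inj).
pose W : {set pendant_graph} := [set inl x | x in X] :|: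
  ([set inr (inl x) | x in X] :|: [set inr (inr x) | x in X]).
have dX x : x \in vdiag E -> x \in X.
  by rewrite inE => /(subsetP EX); rewrite inE => /andP[].
apply: leq_trans (_ : #|W| <= _).
  apply/subset_leq_card/subsetP => _ /imsetP[z zM ->].
  have := valP z; move: zM; rewrite !inE; case: (val z) => [x|[x|x]] /=.
  - by move=> xX _; rewrite imset_f.
  - by move=> _ /dX xX; rewrite (_ : inr (inl x) \in [set inr (inl x) | x in X]) ?orbT // imset_f.
  - by move=> _ /dX xX; rewrite (_ : inr (inr x) \in [set inr (inr x) | x in X]) ?orbT // imset_f.
apply: leq_trans (leq_card_setU _ _).1 _; rewrite !mulSn mul0n addn0.
apply: leq_add; first exact: leq_imset_card.
apply: leq_trans (leq_card_setU _ _).1 _.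
by apply: leq_add; apply: leq_imset_card.
Qed.

(** All added edges have both ends in [X] or are incident to a pendant, so deleting the modulator
    leaves a copy of the unmodified [G[A :\: X]]. *)
Lemma modulator_valid (H : sgraph -> Prop) A X : graph_family H ->
  E \subset setX X X -> X \subset A ->
  H (induced (A :\: X)) -> is_modulator H (gadget_modulator A X).
Proof.
move=> famH EX XA; apply: famH.
have inV (x : induced (A :\: X)) : inl (val x) \in gadget_vertices A.
  by rewrite inE; have := valP x; rewrite inE => /andP[].
have inM (x : induced (A :\: X)) :
    (Sub (inl (val x)) (inV x) : gadget A) \in ~: gadget_modulator A X.
  by rewrite !inE SubK; have := valP x; rewrite inE => /andP[].
pose f (x : induced (A :\: X)) : induced (~: gadget_modulator A X) :=
  Sub (Sub (inl (val x)) (inV x) : gadget A) (inM x).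
exists f.
  apply: inj_card_bij.
    by move=> x y /(congr1 (fun z => val (val z))) /= [] /val_inj.
  rewrite -(cardsT (induced (A :\: X))) -cardsT; apply: leq_trans (leq_imset_card f _).
  apply/subset_leq_card/subsetP => -[[[x|p] zV] zM] _.
    have xA : x \in A by move: (zV); rewrite inE.
    have xAX : x \in A :\: X by move: (zM); rewrite !inE /= xA andbT.
    by apply/imsetP; exists (Sub x xAX) => //; do 2 apply: val_inj.
  by exfalso; move: zM; rewrite !inE.
move=> x y; rewrite /= /induced_adj /= /adjE; have /setDP[_ xX] := valP x.
have /setDP[_ yX] := valP y.
have noE u v : v \notin X -> (u, v) \in E = false.
  by move=> vX; apply: contraNF vX => /(subsetP EX); rewrite inE => /andP[].
by rewrite !noE // andbF orbF.
Qed.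

End Gadget.

(** * Rooted trees *)

Section Trees.
Variables (G : sgraph) (D : decomposition G).
Hypothesis forestD : rooted_forest D.
Implicit Types s t r c : node D.

Lemma up_first t s u : up t s -> connect (@up _ D) t u -> t != u -> connect (@up _ D) s u.
Proof.
move=> /eqP ts ctu /(connect_first ctu)[s' /eqP]; rewrite ts => -[<-]; exact.
Qed.

Lemma ancestor_linear a b t : ancestor a t -> ancestor b t -> ancestor a b \/ ancestor b a.
Proof.
move=> at_ bt.
apply: (@connect_elim _ (@up _ D) (fun u => ancestor u b \/ ancestor b u) t a _ _ at_).
  by right.
move=> u v _ [ub|bu] uv; first by left; apply: connect_trans ub (connect1 uv).
have [<-|ub] := eqVneq u b; first by left; apply: connect1.
by right; apply: up_first uv bu ub.
Qed.

Lemma root_ancestor r t : root_node r -> ancestor t r -> t = r.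
Proof.
move=> /eqP rN /connect_first; case: eqVneq => // rt /(_ isT)[z /eqP].
by rewrite rN.
Qed.

(** A cycle through [t] would contain everything above [t], in particular a root, which has no
    parent. *)
Lemma up_neq s t : up t s -> ~~ ancestor t s.
Proof.
move=> ts; apply/negP => st.
have cyc u : ancestor u t -> ancestor t u.
  apply: (@connect_elim _ (@up _ D) (fun u => ancestor t u) t u); first exact: connect0.
  move=> v w _ tv vw; have [vt|vt] := eqVneq v t; last exact: up_first vw tv vt.
  by move: ts vw; rewrite vt /up => /eqP -> /eqP[<-].
have [r rr rt] := forestD t; have tr := root_ancestor rr (cyc _ rt).
by move: ts; rewrite tr /up; move: rr; rewrite /root_node => /eqP ->.
Qed.

Lemma ancestor_child t s : ancestor t s -> s != t -> exists2 c, up c t & ancestor c s.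
Proof.
move=> ts st; suff [E|//] : t = s \/ exists2 c, up c t & ancestor c s.
  by rewrite E eqxx in st.
apply: (@connect_elim _ (@up _ D) (fun u => u = s \/ exists2 c, up c u & ancestor c s) s t _ _ ts).
  by left.
by move=> u v su _ uv; right; exists u.
Qed.

Lemma sibling_disjoint c c' t s :
  up c t -> up c' t -> c != c' -> ancestor c s -> ~~ ancestor c' s.
Proof.
move=> ct c't cc' cs; apply/negP => c's.
have H a b : up a t -> up b t -> a != b -> ~~ ancestor a b.
  move=> at_ bt ab; apply: contra (up_neq at_) => cba.
  by apply: up_first bt cba _; rewrite eq_sym.
have [] := ancestor_linear cs c's; first by apply/negP/H.
by apply/negP/H; rewrite // eq_sym.
Qed.

(** Induction measure for the dynamic program: [n] rounds settle a node of height less than [n]. *)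
Fixpoint height_lt (n : nat) t : Prop :=
  if n is m.+1 then forall c, parent c = Some t -> height_lt m c else False.

(** A child has strictly more ancestors than its parent, and no node has more than [#|node D|] of
    them. *)
Lemma height_lt_card t : height_lt #|node D| t.
Proof.
have ar (N a c n : nat) : N - a < n.+1 -> a < c -> c <= N -> N - c < n by lia.
have ar0 (N a : nat) : 0 < a -> a <= N -> N - a < N by lia.
have H n : forall t, #|node D| - #|[set s | ancestor s t]| < n -> height_lt n t.
  elim: n => //= n IH {}t lt_n c /eqP ct; apply: IH.
  have : #|[set s | ancestor s t]| < #|[set s | ancestor s c]|.
    apply: proper_card; apply/properP; split.
      apply/subsetP => s; rewrite !inE => st.
      by apply: (@connect_trans _ (@up _ D) t) st; apply: connect1.
    by exists c; rewrite inE; [apply: connect0|apply: up_neq].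
  have le_c : #|[set s | ancestor s c]| <= #|node D| by apply: max_card.
  move=> lt_c; apply: (ar _ _ _ _ lt_n lt_c le_c).
apply: H; have : 0 < #|[set s | ancestor s t]|.
  by apply/card_gt0P; exists t; rewrite inE; apply: connect0.
by move/ar0; apply; apply: max_card.
Qed.

Definition subtree_vertices t : {set G} :=
  [set v | [exists s, ancestor t s && (v \in bag s)]].

Lemma subtree_verticesP v t :
  reflect (exists2 s, ancestor t s & v \in bag s) (v \in subtree_vertices t).
Proof.
by rewrite inE; apply: (iffP existsP) => [[s /andP[]]|[s ts vs]]; exists s => //; apply/andP.
Qed.

(** The edge from [c] to its parent is the only one that leaves the part of the tree below [c], so
    the connected set of nodes whose bags contain [v] has to use it. *)
Lemma crossing_bags v c s s' : connected_in (@tree_adj _ D) [set t | v \in bag t] ->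
  v \in bag s -> ancestor c s -> v \in bag s' -> ~~ ancestor c s' ->
  v \in bag c /\ exists2 t, up c t & v \in bag t.
Proof.
move=> conv vs cs vs' ncs'.
set goal := _ /\ _.
suff [cs'|//] : ancestor c s' \/ goal by rewrite cs' in ncs'.
have vsI : s \in [set t | v \in bag t] by rewrite inE.
have vsI' : s' \in [set t | v \in bag t] by rewrite inE.
apply: (@connect_elim _ (restr (@tree_adj _ D) [set t | v \in bag t])
  (fun w => ancestor c w \/ goal) s s' _ _ (conv _ _ vsI vsI')).
  by left.
move=> u w _ [cu|] ; last by right.
rewrite /restr !inE => /and3P[vu vw /orP[uw|wu]].
  have [uc|uc] := eqVneq u c; last by left; apply: up_first uw cu uc.
  by right; rewrite uc in vu uw; split=> //; exists w.
by left; apply: connect_trans (connect1 wu) cu.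
Qed.

End Trees.

(** * Families of partial solutions *)

(** Written as a fold so that a program can follow the same recursion. *)
Definition subsets (T : finType) (X : {set T}) : seq {set T} :=
  foldr (fun x L => L ++ [seq x |: B | B <- L]) [:: set0] (enum X).

Lemma mem_subsets (T : finType) (X B : {set T}) : B \subset X -> B \in subsets X.
Proof.
have -> : B \subset X = (B \subset [set x in enum X]).
  by apply: eq_subset_r => x; rewrite inE mem_enum.
rewrite /subsets; elim: (enum X) B => [|x s IH] B /= sB.
  by rewrite inE -subset0; apply: subset_trans sB _; apply/subsetP => y; rewrite !inE.
have sBx : B :\ x \subset [set y in s].
  apply/subsetP => y; rewrite !inE => /andP[yx /(subsetP sB)].
  by rewrite !inE (negPf yx).
rewrite mem_cat; have [xB|xB] := boolP (x \in B).
  by apply/orP; right; apply/mapP; exists (B :\ x); rewrite ?IH // setD1K.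
by rewrite IH //; apply: subset_trans sBx; rewrite subsetD1 subxx.
Qed.

Lemma subsets_sub (T : finType) (X B : {set T}) : B \in subsets X -> B \subset X.
Proof.
have H : forall s, {subset s <= X} ->
    B \in foldr (fun x L => L ++ [seq x |: B | B <- L]) [:: set0] s -> B \subset X.
  move=> s; elim: s B => [|x s IH] {}B sX /=; first by rewrite inE => /eqP ->; apply: sub0set.
  have sX' : {subset s <= X} by move=> y ys; apply: sX; rewrite inE ys orbT.
  rewrite mem_cat => /orP[/(IH _ sX') //|/mapP[B' /(IH _ sX') B'X ->]].
  by rewrite subUset B'X sub1set sX // mem_head.
by apply: H => x; rewrite mem_enum.
Qed.

Lemma size_subsets_foldr (T : finType) (s : seq T) :
  size (foldr (fun x L => L ++ [seq x |: B | B <- L]) [:: set0] s) = 2 ^ size s.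
Proof. by elim: s => //= x s IH; rewrite size_cat size_map IH expnS; lia. Qed.

Lemma size_subsets (T : finType) (X : {set T}) : size (subsets X) = 2 ^ #|X|.
Proof. by rewrite /subsets size_subsets_foldr -cardE. Qed.

(** The default [set0] is returned when no member qualifies, and it can also win without being a
    member if it satisfies [p]. This is harmless, as only [p] and the size of the result are
    used. *)
Definition smallest (T : finType) (p : pred {set T}) (F : seq {set T}) : {set T} :=
  foldr (fun P Q => if p P && (~~ p Q || (#|P| <= #|Q|)) then P else Q) set0 F.

Lemma smallestP (T : finType) (p : pred {set T}) F P :
  P \in F -> p P -> p (smallest p F) /\ #|smallest p F| <= #|P|.
Proof.
move=> PF pP; elim: F PF => //= Q F IH; rewrite inE => /orP[/eqP <-|/IH[pF leF]].
  by rewrite pP /=; case: (boolP (p (smallest p F))) => //= pF; case: leqP => // /ltnW.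
rewrite pF /=; case: (boolP (p Q)) => //= pQ; case: leqP => // le1.
by split=> //; apply: leq_trans le1 leF.
Qed.

Definition edge_sets (G : sgraph) (X : {set G}) : seq {set G * G} := subsets (setX X X).

Section Families.
Variables (cv : bool) (G : sgraph) (L : {set G}) (b : nat).
Variable solve : forall Gamma : sgraph, {set Gamma} -> nat -> {set Gamma}.
Implicit Types (A X S P Q : {set G}) (F : seq {set G}).

(** The excess, scaled by [b], is charged to the vertices of [S] in [A :&: L]. Keeping [S :&: X]
    inside [P] makes successive replacements on overlapping parts compatible. *)
Definition approximates A X F : Prop := forall S, problem cv S ->
  exists P, [/\ P \in F, P \subset A, S :&: X \subset P,
    problem cv ((S :\: A) :|: P) &
    b * #|(S :\: A) :|: P| <= b * #|S| + #|S :&: A :&: L|].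

(** The extra [set0] serves solutions that miss [A]: the exchange argument needs a vertex of the
    solution in [A]. *)
Definition reduce X A F : seq {set G} :=
  set0 :: [seq smallest (partial_solution cv E A) F | E <- edge_sets X].

Lemma size_reduce X A F : size (reduce X A F) = (2 ^ (#|X| * #|X|)).+1.
Proof. by rewrite /= size_map size_subsets cardsX. Qed.

Lemma partial_sub (E : {set G * G}) A P : partial_solution cv E A P -> P \subset A.
Proof. by case/and3P. Qed.

Lemma setDUI A S P : P \subset A -> ((S :\: A) :|: P) :&: A = P.
Proof.
move=> PA; apply/setP => x; rewrite !inE; case: (boolP (x \in A)) => //= [_|xA].
  by rewrite andbT.
by rewrite andbF (contraNF (subsetP PA x)).
Qed.

Lemma setDUD A S P : P \subset A -> ((S :\: A) :|: P) :\: A = S :\: A.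
Proof.
move=> PA; apply/setP => x; rewrite !inE; case: (boolP (x \in A)) => //= xA.
by rewrite (contraNF (subsetP PA x)) // orbF.
Qed.

Lemma card_setDU A S P : P \subset A -> #|(S :\: A) :|: P| = #|S :\: A| + #|P|.
Proof.
move=> PA; rewrite cardsU (_ : _ :&: P = set0) ?cards0 ?subn0 //.
apply/setP => x; rewrite !inE; case: (boolP (x \in P)) => [/(subsetP PA) ->|_] //.
by rewrite andbF.
Qed.

Lemma approximates_reduce X A F : X \subset A -> separated A X ->
  approximates A X F -> approximates A X (reduce X A F).
Proof.
move=> XA sepA apF S solS; have [P [PF PA SXP solP leP]] := apF S solS.
set S1 := _ :|: P in solP leP.
have S1A : S1 :&: A = P by apply: setDUI.
have [P0|P0] := eqVneq P set0.
  by exists P; split=> //; rewrite P0 mem_head.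
have neA : S1 :&: A != set0 by rewrite S1A.
(* The trace is that of the already exchanged solution [S1], so that [P] itself competes in the
   minimization. *)
pose E := trace A X S1.
have parP : partial_solution cv E A P by rewrite -S1A; apply: partial_of_solution.
have [parQ leQ] := smallestP PF parP; set Q := smallest _ F in parQ leQ.
have [S1Q solQ] := exchange sepA solP neA parQ.
have QA := partial_sub parQ.
have S1D : S1 :\: A = S :\: A by apply: setDUD.
exists Q; split=> //.
- rewrite inE; apply/orP; right; apply/mapP; exists E => //.
  exact/mem_subsets/trace_sub.
- apply: subset_trans S1Q; apply/subsetP => x xSX; rewrite inE.
  have := subsetP SXP _ xSX; move: xSX; rewrite !inE => /andP[xS ->] ->.
  by rewrite orbT.
- by rewrite -S1D.
apply: leq_trans leP; rewrite leq_mul2l !card_setDU // leq_add2l leQ.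
by rewrite orbT.
Qed.

(** The replacements are made one after the other. What the first one put into the overlap lies in
    [X2] and is kept by the second. The overlap avoids [L], so [S] has not changed on [A2 :&: L] and
    no vertex is charged twice. *)
Lemma approximates_join A1 A2 X X2 F1 F2 :
  A1 :&: A2 \subset X :&: X2 -> [disjoint A1 :&: A2 & L] ->
  approximates A1 X F1 -> approximates A2 X2 F2 ->
  approximates (A1 :|: A2) X [seq P :|: Q | P <- F1, Q <- F2].
Proof.
move=> A12 dL ap1 ap2 S solS.
have [P [PF PA SXP solP leP]] := ap1 S solS; set S1 := _ :|: P in solP leP.
have [Q [QF QA SXQ solQ leQ]] := ap2 S1 solP; set S2 := _ :|: Q in solQ leQ.
have S2E : (S :\: (A1 :|: A2)) :|: (P :|: Q) = S2.
  apply/setP => x; rewrite !inE negb_or.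
  case: (boolP (x \in Q)) => xQ; rewrite ?orbT //= !orbF.
  have [xA2|//] := boolP (x \in A2); rewrite ?andbF //=.
  case: (boolP (x \in P)) => //= xP; exfalso; case/negP: xQ.
  apply: (subsetP SXQ); rewrite !inE xP orbT /=.
  have : x \in A1 :&: A2 by rewrite inE (subsetP PA).
  by move/(subsetP A12); rewrite inE => /andP[].
  by rewrite andbT.
exists (P :|: Q); split.
- by apply/allpairsP; exists (P, Q).
- exact: setUSS.
- by apply: subset_trans SXP _; apply: subsetUl.
- by rewrite S2E.
rewrite S2E; apply: leq_trans leQ _.
have <- : #|S :&: A1 :&: L| + #|S1 :&: A2 :&: L| = #|S :&: (A1 :|: A2) :&: L|.
  have -> : S1 :&: A2 :&: L = S :&: A2 :&: L.
    apply/setP => x; rewrite !inE.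
    case: (boolP (x \in A2)) => xA2; rewrite ?andbF //= !andbT.
    case: (boolP (x \in L)) => xL; rewrite ?andbF //= !andbT.
    have xA1 : x \notin A1.
      by apply: contraL xL => xA1; rewrite (disjointFr dL) // inE xA1.
    by rewrite xA1 (contraNF (subsetP PA x)) // orbF.
  rewrite -cardsUI [X in _ + X](_ : _ = 0) ?addn0.
    by congr #|pred_of_set _|; apply/setP => x; rewrite !inE; case: (x \in S); case: (x \in L);
      rewrite ?andbF ?andbT.
  apply/eqP; rewrite cards_eq0 -subset0; apply/subsetP => x; rewrite !inE.
  case/andP=> /andP[/andP[_ xA1] xL] /andP[/andP[_ xA2] _].
  by have := disjointFr dL (_ : x \in A1 :&: A2); rewrite inE xA1 xA2 xL => /(_ isT).
by rewrite addnA leq_add2r.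
Qed.

(** Every subset of [X] is such a diagonal. Enumerating edge sets, with repetitions, gives the same
    size bound as for the other families. *)
Definition base_family X : seq {set G} := [seq vdiag E | E <- edge_sets X].

Lemma approximates_base X : approximates X X (base_family X).
Proof.
move=> S solS; have SE : (S :\: X) :|: (S :&: X) = S by rewrite setUC setID.
exists (S :&: X); rewrite SE; split=> //; rewrite ?subsetIr ?leq_addr //.
apply/mapP; exists (setX (S :&: X) (S :&: X)).
  by apply/mem_subsets/subsetP => -[x y]; rewrite !inE /= => /andP[/andP[_ ->] /andP[_ ->]].
by apply/setP => x; rewrite !inE; case: (_ && _).
Qed.

Definition leaf_solution X A (E : {set G * G}) : {set G} :=
  if partial_solution cv E A (canonical cv E A)
  then gadget_project (solve (gadget_modulator E A X) (b * #|X|.+1))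
  else set0.

Definition leaf_family X A : seq {set G} :=
  set0 :: [seq leaf_solution X A E | E <- edge_sets X].

Hypothesis b_gt0 : 0 < b.

(** The trace of [S] makes the gadget feasible, with a solution of size [#|S :&: A|]. The
    approximate solution found there is projected and exchanged back into [S]. *)
Lemma approximates_leaf X A : X \subset A -> separated A X -> A :\: X \subset L ->
  (forall (E : {set G * G}) (S : {set gadget E A}), E \subset setX X X -> problem cv S ->
     let Q := solve (gadget_modulator E A X) (b * #|X|.+1) in
     problem cv Q /\ b * #|X|.+1 * #|Q| <= (b * #|X|.+1).+1 * #|S|) ->
  approximates A X (leaf_family X A).
Proof.
move=> XA sepA AL solveP S solS.
have [SA0|SA] := eqVneq (S :&: A) set0.
  have SE : (S :\: A) :|: set0 = S by rewrite setU0 -[RHS](setID _ A) SA0 set0U.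
  exists set0; rewrite SE mem_head sub0set leq_addr; split=> //.
  by rewrite -SA0; apply: setIS.
pose E := trace A X S; have EX : E \subset setX X X by apply: trace_sub.
have parS := partial_of_solution XA sepA solS SA.
have dA : vdiag E \subset A by case/and3P: parS => dP PA _; apply: subset_trans dP PA.
have [solQ] := solveP E _ EX (partial_embed parS).
set Q := solve _ _ in solQ *; rewrite card_embed ?subsetIr // => leQ.
have parQ := project_partial dA solQ.
have [SXQ solSQ] := exchange sepA solS SA parQ.
have QA := partial_sub parQ.
exists (gadget_project Q); split=> //.
  rewrite inE; apply/orP; right; apply/mapP; exists E; first exact: mem_subsets.
  by rewrite /leaf_solution (canonical_partial parS).
rewrite card_setDU //.
have -> : #|S| = #|S :\: A| + #|S :&: A| by rewrite addnC cardsID.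
have leS : #|S :&: A| <= #|X| + #|S :&: A :&: L|.
  rewrite -(cardsID L) addnC leq_add2r; apply/subset_leq_card/subsetP => x.
  rewrite !inE => /andP[xL /andP[_ xA]]; apply: contraNT xL => xX.
  by apply: (subsetP AL); rewrite inE xX.
have leQ' : b * #|X|.+1 * #|gadget_project Q| <= (b * #|X|.+1).+1 * #|S :&: A|.
  by apply: leq_trans leQ; rewrite leq_mul2l card_project orbT.
rewrite !mulnDr -addnA leq_add2l.
move: #|gadget_project Q| #|S :&: A| #|X| #|_ :&: L| leQ' leS => p m x l le1 le2.
(* If [p <= m] there is nothing to charge. Otherwise [l < b * (p - m)] would give [b * x.+1 * (p -
   m) >= x.+1 * l.+1 > x + l >= m], against the guarantee of the scheme. *)
have [pm|mp] := leqP p m; first by apply: leq_trans (leq_addr _ _); rewrite leq_mul2l pm orbT.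
rewrite -(subnKC (ltnW mp)) mulnDr leq_add2l leqNgt; apply/negP => lt_l.
move: le1; rewrite -{1}(subnKC (ltnW mp)) mulSn mulnDr addnC leq_add2r leqNgt => /negP; apply.
apply: leq_ltn_trans le2 _; rewrite mulnAC.
apply: leq_trans (leq_mul lt_l (leqnn x.+1)); rewrite mulSn mulnS; nia.
Qed.

End Families.

(** * Dynamic programming over a tree decomposition *)

Section Dynamic.
Variables (cv : bool) (G : sgraph) (D : decomposition G) (b : nat).
Variable solve : forall Gamma : sgraph, {set Gamma} -> nat -> {set Gamma}.
Implicit Types (t c s : node D) (a : {set G} * seq {set G}).

Definition boundary t : {set G} := bag t :\: base D.

(** Reducing after every single child keeps the families bounded in terms of [X] alone, whatever the
    number of children. *)
Definition merge_states (X : {set G}) a1 a2 : {set G} * seq {set G} :=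
  (a1.1 :|: a2.1,
   reduce cv X (a1.1 :|: a2.1) [seq P :|: Q | P <- a1.2, Q <- a2.2]).

Definition step (F : node D -> {set G} * seq {set G}) t : {set G} * seq {set G} :=
  if leaf_node t then (bag t, leaf_family cv b solve (boundary t) (bag t))
  else foldr (fun c a => if parent c == Some t then merge_states (boundary t) a (F c) else a)
    (bag t, base_family (boundary t)) (enum (node D)).

(** The whole table is recomputed in rounds, so no traversal order has to be derived from the parent
    pointers. *)
Definition dp : node D -> {set G} * seq {set G} :=
  iter #|node D| step (fun=> (set0, [::])).

(** Testing the candidates of all nodes avoids locating the root. A good candidate occurs at the
    root, and another feasible one can win only by being no larger. *)
Definition answer : {set G} :=
  smallest (solvesb cv (@adj G) setT) (flatten [seq (dp t).2 | t <- enum (node D)]).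

Hypothesis b_gt0 : 0 < b.
Variable H : sgraph -> Prop.
Hypothesis treeD : is_tree_decomposition H D.
Hypothesis solveP : forall t (E : {set G * G}) (S : {set gadget E (bag t)}),
  leaf_node t -> E \subset setX (boundary t) (boundary t) -> problem cv S ->
  let Q := solve (gadget_modulator E (bag t) (boundary t)) (b * #|boundary t|.+1) in
  problem cv Q /\ b * #|boundary t|.+1 * #|Q| <= (b * #|boundary t|.+1).+1 * #|S|.

Let forestD : rooted_forest D. Proof. by case: treeD => -[]. Qed.

Let edgeD (u v : G) : adj u v -> exists t, (u \in bag t) && (v \in bag t).
Proof. by case: treeD => _ _ edge _ _; apply: edge. Qed.

Let baseD v : v \in base D -> exists2 t, leaf_node t & forall s, (v \in bag s) = (s == t).
Proof. by case: treeD => _ _ _ base _; apply: base. Qed.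

Lemma base_node v s t : v \in base D -> v \in bag s -> v \in bag t -> s = t.
Proof. by case/baseD=> l _ H'; rewrite !H' => /eqP -> /eqP ->. Qed.

Lemma crossing v c s s' : v \in bag s -> ancestor c s -> v \in bag s' ->
  ~~ ancestor c s' -> v \in bag c /\ exists2 t, up c t & v \in bag t.
Proof.
by apply: crossing_bags; case: treeD => _ conv _ _ _; case: (conv v).
Qed.

Lemma leaf_no_child t c : leaf_node t -> ~~ up c t.
Proof. by move/forallP/(_ c). Qed.

Lemma subtree_leaf t : leaf_node t -> subtree_vertices t = bag t.
Proof.
move=> leaft; apply/setP => v; apply/subtree_verticesP/idP => [[s ts vs]|vt].
  have [<- //|st] := eqVneq s t.
  have [c ct _] := ancestor_child ts st.
  by have := leaf_no_child c leaft; rewrite ct.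
exists t => //; exact: connect0.
Qed.

Lemma boundary_internal t : ~~ leaf_node t -> boundary t = bag t.
Proof.
move=> nleaf; apply/setP => v; rewrite inE andbC.
case: (boolP (v \in bag t)) => //= vt; apply: contra nleaf.
by case/baseD=> l leafl vl; have := vt; rewrite vl => /eqP ->.
Qed.

Definition node_correct t a : Prop :=
  a.1 = subtree_vertices t /\ approximates cv (base D) b a.1 (boundary t) a.2.

Lemma step_leaf F t : leaf_node t -> node_correct t (step F t).
Proof.
move=> leaft; rewrite /step leaft; split; first by rewrite subtree_leaf.
have bd : bag t :\: boundary t \subset base D.
  by apply/subsetP => v; rewrite !inE; case: (v \in base D) => //=; case: (_ \in _).
rewrite /=; apply: approximates_leaf => //.
- exact: subsetDl.
- move=> u v uv ut uX; have [s /andP[us vs]] := edgeD uv.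
  have uL : u \in base D by apply: (subsetP bd); rewrite inE uX.
  by rewrite -(base_node uL us ut).
- by move=> E S; apply: solveP.
Qed.

(** Children are absorbed one at a time. A vertex common to the part gathered so far and to the
    subtree of a new child occurs on both sides of the edge from that child to [t], hence in both
    bags. It is therefore not in the base, whose vertices occur in a single bag. *)
Lemma step_internal F t : ~~ leaf_node t ->
  (forall c, parent c = Some t -> node_correct c (F c)) ->
  node_correct t (step F t).
Proof.
move=> nleaf childP; rewrite /step (negPf nleaf).
have bt := boundary_internal nleaf.
set g := fun c a => _; set a0 := (_, _).
pose below (s : seq (node D)) (v : G) := exists2 c, c \in s & up c t /\ v \in subtree_vertices c.
have leave v c s : up c t -> v \in subtree_vertices c -> v \in bag s ->
    ~~ ancestor c s -> v \in bag c /\ v \in bag t.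
  move=> ct /subtree_verticesP[s' cs' vs'] vs ncs.
  have [vc [t' ct' vt']] := crossing vs' cs' vs ncs; split=> //.
  by move: ct ct'; rewrite /up => /eqP -> /eqP[->].
have H' (s : seq (node D)) : uniq s -> let a := foldr g a0 s in
    (forall v, v \in a.1 <-> v \in bag t \/ below s v) /\
    approximates cv (base D) b a.1 (boundary t) a.2.
  elim: s => [_|c s IH /= /andP[cs us]].
    split; last by rewrite /a0 /= -bt; apply: approximates_base.
    by move=> v; split=> [vt|[//|[]]]; [left|].
  have /= [a1P apa] := IH us; set a := foldr g a0 s in a1P apa *.
  rewrite /g; case: eqP => [pc|nct]; last first.
    split=> // v; rewrite a1P; split=> -[vt|[c' c's [c't vc']]]; first by left.
    + by right; exists c' => //; rewrite inE c's orbT.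
    + by left.
    right; exists c' => //; move: c's; rewrite inE => /orP[/eqP cc'|//].
    by case: nct; apply/eqP; rewrite -cc'.
  have [F1 apF] := childP c pc; have ct : up c t by apply/eqP.
  have both v : v \in a.1 -> v \in subtree_vertices c -> v \in bag c /\ v \in bag t.
    move=> /a1P[vt|[c' c's [c't /subtree_verticesP[s' cs' vs']]]] vc.
      exact: leave _ _ _ ct vc vt (up_neq forestD ct).
    apply: (leave _ _ _ ct vc vs'); apply: (sibling_disjoint forestD c't ct _ cs').
    by apply: contraNneq cs => <-.
  have notL v : v \in bag c -> v \in bag t -> v \notin base D.
    move=> vc vt; apply/negP => vL; have ctE := base_node vL vc vt.
    by have := up_neq forestD ct; rewrite ctE /ancestor connect0.
  have mP v : v \in (merge_states (boundary t) a (F c)).1 <-> v \in bag t \/ below (c :: s) v.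
    rewrite /merge_states /= inE F1; split.
      case/orP=> [/a1P[vt|[c' c's c'P]]|vc]; first by left.
        by right; exists c'; rewrite // inE c's orbT.
      by right; exists c; rewrite ?mem_head.
    case=> [vt|[c' c's [c't vc']]]; first by apply/orP; left; apply/a1P; left.
    move: c's; rewrite inE => /orP[/eqP <-|c's]; first by rewrite vc' orbT.
    by apply/orP; left; apply/a1P; right; exists c'.
  split=> //; rewrite [X in approximates _ _ _ _ _ X]/=; apply: approximates_reduce.
  - by rewrite bt; apply/subsetP => v vt; apply/mP; left.
  - move=> u v uv uA; rewrite bt => ut; have [s' /andP[us' vs']] := edgeD uv.
    have [ut'|[c' c's [c't uc']]] := (mP u).1 uA; first by rewrite ut' in ut.
    apply/mP; right; exists c' => //; split=> //; apply/subtree_verticesP; exists s' => //.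
    by apply: contraNT ut => ncs; have [] := leave _ _ _ c't uc' us' ncs.
  apply: approximates_join apa apF.
    apply/subsetP => v; rewrite inE F1 => /andP[va vc]; have [vc' vt] := both v va vc.
    by rewrite inE /boundary !inE vc' vt !andbT notL.
  rewrite -setI_eq0 -subset0; apply/subsetP => v; rewrite !inE F1 -andbA => /and3P[va vc].
  by have [vc' vt] := both v va vc; rewrite (negPf (notL v vc' vt)).
have [aP apa] := H' _ (enum_uniq (node D)); split=> //.
apply/setP => v; apply/idP/subtree_verticesP => [/aP[vt|[c _ [ct /subtree_verticesP[s cs vs]]]]|].
- by exists t => //; apply: connect0.
- by exists s => //; apply: (@connect_trans _ (@up _ D) c) => //; apply: connect1.
case=> s ts vs; apply/aP; have [<-|st] := eqVneq s t; first by left.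
have [c ct cs] := ancestor_child ts st; right; exists c; rewrite ?mem_enum //.
by split=> //; apply/subtree_verticesP; exists s.
Qed.

Lemma dp_correct t : node_correct t (dp t).
Proof.
have H' n : forall t', height_lt n t' -> node_correct t' (iter n step (fun=> (set0, [::])) t').
  elim: n => //= n IH t' ht'; have [leaft|nleaf] := boolP (leaf_node t').
    exact: step_leaf.
  by apply: step_internal => // c /ht'; apply: IH.
by apply: H'; apply: height_lt_card.
Qed.

(** At the root [A] is the whole vertex set, so a replacement of [S :&: A] is a full solution, and
    the base vertices of [S] pay for the excess. *)
Lemma answerP S : problem cv S ->
  problem cv answer /\ b * #|answer| <= b * #|S| + #|S :&: base D|.
Proof.
move=> solS; have [[_ [r [rr uniq_r]]] bagD _ _ _] := treeD.
have [dp1 ap] := dp_correct r.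
have r1 : (dp r).1 = setT.
  apply/setP => v; rewrite dp1 [RHS]inE; apply/subtree_verticesP.
  have [[t vt] _] := bagD v; exists t => //.
  by have [r' rr' r't] := forestD t; rewrite (uniq_r r' rr').
rewrite r1 in ap; have [P [PF _ _ solP leP]] := ap S solS.
rewrite setDT set0U setIT in solP leP.
have PF' : P \in flatten [seq (dp t).2 | t <- enum (node D)].
  by apply/flatten_mapP; exists r; rewrite ?mem_enum.
have [/problemP solA leA] := smallestP PF' (introT (problemP cv P) solP).
by split=> //; apply: leq_trans leP; rewrite leq_mul2l leA orbT.
Qed.

(** Stated for every round, including those in which the table is not yet correct, because the
    program passes through all of them. *)
Lemma size_families n t :
  size (iter n step (fun=> (set0, [::])) t).2 <= (2 ^ (#|boundary t| * #|boundary t|)).+1.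
Proof.
case: n => //= n; set F := iter n _ _; rewrite /step; case: ifP => _.
  by rewrite /= size_map size_subsets cardsX.
elim: (enum _) => [|c s IH] /=.
  by rewrite /base_family size_map size_subsets cardsX.
by case: ifP => _; [rewrite /merge_states size_reduce|apply: IH].
Qed.

End Dynamic.

(** * Computing relations, reachability and feasibility *)

Ltac atom := first
  [ eassumption
  | exact: comp_var
  | match goal with H : computable _ |- computable _ => exact: (comp_weak _ _ H) end
  | match goal with H : fin _ |- fin _ => exact: (fin_weak _ _ H) end
  | exact: (comp_weak _ _ (comp_var _ _))
  | match goal with H : computable _ |- computable _ =>
      exact: (comp_weak _ _ (comp_weak _ _ H)) end
  | match goal with H : fin _ |- fin _ => exact: (fin_weak _ _ (fin_weak _ _ H)) end ].

Definition enc_rel (T : finType) (r : rel T) : value :=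
  tab (fun x => enc_set [set y | r x y]).

Lemma comp_setb C (T : C -> finType) (p : forall i, pred (T i)) : fin T ->
  computable (fun q : elt_ctx T => enc_bool (p (tag q) (tagged q))) ->
  computable (fun i => enc_set [set x | p i x]).
Proof.
move=> fT cp; apply: (comp_set fT); apply: comp_eq cp => q _; by rewrite inE.
Qed.

Definition elt2_ctx C (T U : C -> finType) : ctx :=
  @elt_ctx (elt_ctx T) (fun p => U (tag p)).

Section Relations.
Variables (C : ctx) (T : C -> finType).
Hypothesis fT : fin T.

Lemma comp_rel (r : forall i, rel (T i)) (x y : forall i, T i) :
  computable (fun i => enc_rel (r i)) ->
  computable (fun i => enc1 (x i)) -> computable (fun i => enc1 (y i)) ->
  computable (fun i => enc_bool (r i (x i) (y i))).
Proof.
move=> cr cx cy.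
have cs := comp_lookup fT cr cx.
by apply: comp_eq (comp_mem fT cy cs) => i _; rewrite inE.
Qed.

Lemma comp_mkrel (r : forall i, rel (T i)) :
  computable (fun q : elt2_ctx T T =>
    enc_bool (r (tag (tag q)) (tagged (tag q)) (tagged q))) ->
  computable (fun i => enc_rel (r i)).
Proof.
move=> cr; apply: (comp_tab fT (v := fun i x => enc_set [set y | r i x y])).
exact: (comp_setb (fin_weak _ _ fT) cr).
Qed.

Lemma comp_forall2 (b : forall i, rel (T i)) :
  computable (fun q : elt2_ctx T T =>
    enc_bool (b (tag (tag q)) (tagged (tag q)) (tagged q))) ->
  computable (fun i => enc_bool [forall x, forall y, b i x y]).
Proof.
move=> cb; apply: (comp_forall fT (b := fun i x => [forall y, b i x y])).
exact: (comp_forall (fin_weak _ _ fT) (b := fun p y => b (tag p) (tagged p) y)).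
Qed.

End Relations.

(** A monotone operator on the subsets of [T] reaches its least fixpoint within [#|T|] rounds from
    the empty set; here this is the set of vertices reachable from [x]. *)
Lemma connect_iter (T : finType) (r : rel T) x :
  iter #|T| (fun R : {set T} => [set y | (y == x) || [exists u, (u \in R) && r u y]]) set0 =
  [set y | connect r x y].
Proof.
set F := fun R : {set T} => _.
have monoF : {homo F : R R' / R \subset R'}.
  move=> R R' RR'; apply/subsetP => y; rewrite !inE => /orP[-> //|/existsP[u /andP[uR uy]]].
  by apply/orP; right; apply/existsP; exists u; rewrite (subsetP RR').
apply/setP => y; rewrite [RHS]inE; apply/idP/idP.
  elim: #|T| y => [|n IH] y; first by rewrite inE.
  rewrite /= inE => /orP[/eqP -> //|/existsP[u /andP[/IH xu uy]]].
  exact: connect_trans xu (connect1 uy).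
rewrite -/(fixset F) => xy.
have fixE : F (fixset F) = fixset F by apply: fixsetK.
apply: (@connect_elim _ r (fun y => y \in fixset F) x y) xy; rewrite -fixE.
  by rewrite inE eqxx.
move=> u v _ uF uv; rewrite inE; apply/orP; right; apply/existsP.
by exists u; rewrite -fixE uF.
Qed.

Lemma comp_connect C (T : C -> finType) (r : forall i, rel (T i)) (x : forall i, T i) :
  fin T -> computable (fun i => enc_rel (r i)) -> computable (fun i => enc1 (x i)) ->
  computable (fun i => enc_set [set y | connect (r i) (x i) y]).
Proof.
move=> fT cr cx.
have [f0 c0] := fT.
have cn : computable (fun i => enc_nat #|T i|).
  by apply: comp_eq (comp_size (fpt_enum fT) c0) => i _; rewrite -cardE.
have H := @comp_iter C (fun i => #|T i|) (fun i => {set T i}) (fun i A => enc_set A)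
  (fun i (R : {set T i}) => [set y | (y == x i) || [exists u, (u \in R) && r i u y]]) (fun=> set0) f0 cn.
apply: (comp_eq _ (H _ _)).
- by move=> i _; rewrite connect_iter.
- apply: (comp_set fT); apply: comp_eq (comp_false _) => p _; by rewrite inE.
set K := extend _ _.
have fK : fin (fun p : K => T (tag p)) by atom.
have crK : computable (fun p : K => enc_rel (r (tag p))) by atom.
have cxK : computable (fun p : K => enc1 (x (tag p))) by atom.
have cR : computable (fun p : K => enc_set (tagged p)) by atom.
pose R (p : K) : {set T (tag p)} := tagged p.
pose F (p : K) (y : T (tag p)) := (y == x (tag p)) || [exists u, (u \in R p) && r (tag p) u y].
apply: (comp_setb fK (p := F)).
apply: comp_orb; first by apply: (comp_eqb (fin_weak _ _ fK)); atom.
apply: (comp_exists (fin_weak _ _ fK) (b := fun p u => (u \in R (tag p)) && r (tag (tag p)) u (tagged p))).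
apply: comp_andb; first by apply: (comp_mem (fin_weak _ _ (fin_weak _ _ fK))); atom.
apply: (comp_rel (fin_weak _ _ (fin_weak _ _ fK)) (r := fun q => r (tag (tag (tag q))))); atom.
Qed.

Lemma comp_restr C (T : C -> finType) (r : forall i, rel (T i)) (A : forall i, {set T i}) :
  fin T -> computable (fun i => enc_rel (r i)) -> computable (fun i => enc_set (A i)) ->
  computable (fun i => enc_rel (restr (r i) (A i))).
Proof.
move=> fT cr cA; apply: (comp_mkrel fT); apply: comp_andb.
  by apply: (comp_mem (fin_weak _ _ (fin_weak _ _ fT))); atom.
apply: comp_andb.
  by apply: (comp_mem (fin_weak _ _ (fin_weak _ _ fT))); atom.
by apply: (comp_rel (fin_weak _ _ (fin_weak _ _ fT)) (r := fun q => r (tag (tag q)))); atom.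
Qed.

Section Solves.
Variables (C : ctx) (T : C -> finType).
Variables (r : forall i, rel (T i)) (A P : forall i, {set T i}).
Arguments r : clear implicits.
Hypotheses (fT : fin T) (cr : computable (fun i => enc_rel (r i))).
Hypotheses (cA : computable (fun i => enc_set (A i))).
Hypotheses (cP : computable (fun i => enc_set (P i))).

Lemma comp_connb : computable (fun i => enc_bool (connb (r i) (P i))).
Proof.
apply: (comp_forall2 fT (b := fun i x y => (x \in P i) && (y \in P i) ==>
  connect (restr (r i) (P i)) x y)).
have crP := comp_restr fT cr cP.
apply: comp_implyb; first apply: comp_andb.
- by apply: (comp_mem (fin_weak _ _ (fin_weak _ _ fT))); atom.
- by apply: (comp_mem (fin_weak _ _ (fin_weak _ _ fT))); atom.
have cc : computable (fun q : elt2_ctx T T => enc_set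
    [set y | connect (restr (r (tag (tag q))) (P (tag (tag q)))) (tagged (tag q)) y]).
  by apply: (comp_connect (fin_weak _ _ (fin_weak _ _ fT))); atom.
have f2 : fin (fun q : elt2_ctx T T => T (tag (tag q))) by atom.
have cv : computable (fun q : elt2_ctx T T => enc1 (tagged q)) by atom.
by apply: comp_eq (comp_mem f2 cv cc) => q _; rewrite inE.
Qed.

Lemma comp_coversb : computable (fun i => enc_bool (coversb (r i) (A i) (P i))).
Proof.
apply: (comp_forall2 fT (b := fun i x y => [&& x \in A i, y \in A i & r i x y] ==>
  (x \in P i) || (y \in P i))).
apply: comp_implyb; [apply: comp_andb; [|apply: comp_andb]|apply: comp_orb].
- by apply: (comp_mem (fin_weak _ _ (fin_weak _ _ fT))); atom.
- by apply: (comp_mem (fin_weak _ _ (fin_weak _ _ fT))); atom.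
- by apply: (comp_rel (fin_weak _ _ (fin_weak _ _ fT)) (r := fun q => r (tag (tag q)))); atom.
- by apply: (comp_mem (fin_weak _ _ (fin_weak _ _ fT))); atom.
- by apply: (comp_mem (fin_weak _ _ (fin_weak _ _ fT))); atom.
Qed.

Lemma comp_dominatesb : computable (fun i => enc_bool (dominatesb (r i) (A i) (P i))).
Proof.
apply: (comp_forall fT (b := fun i x => (x \in A i) && (x \notin P i) ==>
  [exists y, (y \in P i) && r i x y])).
apply: comp_implyb; [apply: comp_andb; [|apply: comp_negb]|].
- by apply: (comp_mem (fin_weak _ _ fT)); atom.
- by apply: (comp_mem (fin_weak _ _ fT)); atom.
apply: (comp_exists (fin_weak _ _ fT) (b := fun p y => (y \in P (tag p)) && r (tag p) (tagged p) y)).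
apply: comp_andb.
- by apply: (comp_mem (fin_weak _ _ (fin_weak _ _ fT))); atom.
- by apply: (comp_rel (fin_weak _ _ (fin_weak _ _ fT)) (r := fun q => r (tag (tag q)))); atom.
Qed.

Lemma comp_solvesb cv : computable (fun i => enc_bool (solvesb cv (r i) (A i) (P i))).
Proof.
apply: comp_andb comp_connb; case: cv; [exact: comp_coversb|exact: comp_dominatesb].
Qed.

End Solves.

(** * Tables over sums, products, subtypes and options *)

Lemma tab_sum (T U : finType) (v : T + U -> value) :
  tab v = enc_seq ([seq v (inl x) | x <- enum T] ++ [seq v (inr y) | y <- enum U]).
Proof. by rewrite /tab enumT unlock /= /sum_enum map_cat -!map_comp -!enumT. Qed.

Lemma tab_option (T : finType) (v : option T -> value) :
  tab v = VNode (v None) (tab (fun x => v (Some x))).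
Proof. by rewrite /tab enumT unlock /= /option_enum /= -map_comp -enumT. Qed.

Lemma tab_prod (T U : finType) (v : T * U -> value) :
  tab v = enc_seq (flatten [seq [seq v (x, y) | y <- enum U] | x <- enum T]).
Proof.
rewrite /tab enumT unlock /= /prod_enum; congr enc_seq; rewrite map_allpairs.
by rewrite /allpairs_dep.
Qed.

Lemma enum_sub (T : finType) (A : {set T}) :
  [seq val z | z <- enum {: {x : T | x \in A}}] = enum A.
Proof.
have -> : enum {: {x : T | x \in A}} =
    pmap (insub : T -> option {x : T | x \in A}) (Finite.enum T).
  by rewrite enumT [in LHS]unlock.
rewrite pmap_filter; last exact: insubK.
by apply: eq_filter => x; rewrite isSome_insub.
Qed.

Section MoreTables.
Variables (C : ctx) (T U : C -> finType).

Lemma comp_tab_sum (v : forall i, (T i + U i)%type -> value) :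
  fpt (fun i => #|T i|) ->
  computable (fun i => tab (fun x => v i (inl x))) ->
  computable (fun i => tab (fun y => v i (inr y))) ->
  computable (fun i => tab (v i)).
Proof.
move=> fT cT cU.
have fs : fpt (fun i => size (enum (T i))) by apply: fpt_le fT => i _; rewrite -cardE.
by apply: comp_eq (comp_cat fs cT cU) => i _; rewrite tab_sum.
Qed.

Lemma comp_tab_option (v : forall i, option (T i) -> value) :
  computable (fun i => v i None) -> computable (fun i => tab (fun x => v i (Some x))) ->
  computable (fun i => tab (v i)).
Proof. by move=> c0 c1; apply: comp_eq (comp_node c0 c1) => i _; rewrite tab_option. Qed.

Lemma comp_tab_prod (v : forall i, T i * U i -> value) : fin T -> fin U ->
  computable (fun q : @elt_ctx (elt_ctx T) (fun p => U (tag p)) =>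
     v (tag (tag q)) (tagged (tag q), tagged q)) ->
  computable (fun i => tab (v i)).
Proof.
move=> fT fU cv.
pose w (p : elt_ctx T) : seq value := [seq v (tag p) (tagged p, y) | y <- enum (U (tag p))].
have cw : computable (fun p : elt_ctx T => enc_seq (w p)).
  exact: (comp_tab (fin_weak _ _ fU) (v := fun p y => v (tag p) (tagged p, y)) cv).
have H := @comp_foldr C (fun i => T i) (fun=> seq value) (fun i => enum (T i))
  (fun i x => enc1 x) (fun=> enc_seq)
  (fun i x l => [seq v i (x, y) | y <- enum (U i)] ++ l) (fun=> [::])
  (fpt_enum fT) fT.2 (comp_leaf _).
apply: (comp_eq _ (H _)).
  move=> i _; rewrite tab_prod; congr enc_seq.
  by elim: (enum (T i)) => //= x l ->.
set K := foldr_ctx _ _ _ _ _.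
have cw' : computable (fun p : K => enc_seq [seq v (tag p) ((tagged p).1, y) | y <- enum (U (tag p))]).
  have := @comp_foldr_elt C (fun i => T i) (fun i => enum (T i)) (fun i x => enc1 x)
    (fun=> seq value) (fun=> enc_seq)
    (fun i x l => [seq v i (x, y) | y <- enum (U i)] ++ l) (fun=> [::])
    (fun i x => enc_seq [seq v i (x, y) | y <- enum (U i)]).
  by apply; apply: (comp_elt (v := fun i x => enc_seq [seq v i (x, y) | y <- enum (U i)])).
apply: (comp_cat (s := fun p : K => enum (U (tag p)))
  (ea := fun p y => v (tag p) ((tagged p).1, y))) => //.
  exact: (fpt_weak _ _ (fpt_enum fU)).
exact: comp_foldr_acc.
Qed.

Lemma comp_tab_sub (A : forall i, {set T i}) (v : forall i, T i -> value) :
  fpt (fun i => #|T i|) ->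
  computable (fun i => enc_set (A i)) -> computable (fun i => tab (v i)) ->
  computable (fun i => tab (fun z : {x : T i | x \in A i} => v i (val z))).
Proof.
move=> fT cA cv.
have fs : fpt (fun i => size (enum (T i))) by apply: fpt_le fT => i _; rewrite -cardE.
have fsA : fpt (fun i => size [seq enc_bool (x \in A i) | x <- enum (T i)]).
  by apply: fpt_le fs => i _; rewrite size_map.
have cz : computable (fun i => enc_seq
    [seq VNode (enc_bool (x \in A i)) (v i x) | x <- enum (T i)]).
  by apply: comp_eq (comp_zip fsA cA cv) => i _; rewrite zip_map -map_comp.
have H := @comp_filter C (fun i => T i) (fun i => enum (T i))
  (fun i x => VNode (enc_bool (x \in A i)) (v i x)) fs cz (fun i x => x \in A i).
set K := occ_ctx _ _ in H.
have cK : computable (fun p : K =>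
    VNode (enc_bool (tagged p \in A (tag p))) (v (tag p) (tagged p))) by exact: comp_var.
have H' := H (comp_fst cK).
have fs' : fpt (fun i => size [seq x <- enum (T i) | x \in A i]).
  by apply: fpt_le fs => i _; rewrite size_filter count_size.
have := comp_map fs' H' (v := fun i => v i).
set K' := occ_ctx _ _.
have cK' : computable (fun p : K' =>
    VNode (enc_bool (tagged p \in A (tag p))) (v (tag p) (tagged p))) by exact: comp_var.
move=> /(_ (comp_snd cK')); apply: comp_eq => i _; congr enc_seq.
rewrite (map_comp (v i) val) enum_sub; congr map.
by rewrite [RHS]/enum_mem -enumT.
Qed.

Lemma fin_prod : fin T -> fin U -> fin (fun i => (T i * U i)%type : finType).
Proof.
move=> fT fU; have [f1 _] := fT; have [f2 _] := fU.
have fTU : fpt (fun i => #|{: T i * U i}|).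
  by apply: fpt_le (fpt_mul f1 f2) => i _; rewrite card_prod.
apply: (fin_tab (v := fun i (p : T i * U i) => VLeaf) fTU).
apply: (comp_tab_prod (v := fun i (p : T i * U i) => VLeaf) fT fU); exact: comp_leaf.
Qed.

Lemma comp_pair (x : forall i, T i) (y : forall i, U i) : fin T -> fin U ->
  computable (fun i => enc1 (x i)) -> computable (fun i => enc1 (y i)) ->
  computable (fun i => enc1 (x i, y i)).
Proof.
move=> fT fU cx cy.
have c : computable (fun i => tab (fun p : T i * U i => enc_bool (p == (x i, y i)))).
  apply: (comp_tab_prod (v := fun i p => enc_bool (p == (x i, y i))) fT fU).
  have c1 : computable (fun q : elt2_ctx T U => enc_bool (tagged (tag q) == x (tag (tag q)))).
    by apply: (comp_eqb (fin_weak _ _ (fin_weak _ _ fT))); atom.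
  have c2 : computable (fun q : elt2_ctx T U => enc_bool (tagged q == y (tag (tag q)))).
    by apply: (comp_eqb (fin_weak _ _ (fin_weak _ _ fU))); atom.
  by apply: comp_eq (comp_andb c1 c2) => q _; rewrite xpair_eqE.
by apply: comp_eq c => i _; rewrite enc1E.
Qed.

Lemma comp_proj1 (p : forall i, T i * U i) : fin T -> fin U ->
  computable (fun i => enc1 (p i)) -> computable (fun i => enc1 (p i).1).
Proof.
move=> fT fU cp; apply: (comp_lookup (fin_prod fT fU) (v := fun i q => enc1 q.1) _ cp).
by apply: (comp_tab_prod (v := fun i q => enc1 q.1) fT fU); atom.
Qed.

Lemma comp_proj2 (p : forall i, T i * U i) : fin T -> fin U ->
  computable (fun i => enc1 (p i)) -> computable (fun i => enc1 (p i).2).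
Proof.
move=> fT fU cp; apply: (comp_lookup (fin_prod fT fU) (v := fun i q => enc1 q.2) _ cp).
by apply: (comp_tab_prod (v := fun i q => enc1 q.2) fT fU); atom.
Qed.

End MoreTables.

(** * Computing with sets *)

Section Sets.
Variables (C : ctx) (T : C -> finType).
Hypothesis fT : fin T.
Implicit Types A B : forall i, {set T i}.

Lemma comp_set0 : computable (fun i => enc_set (set0 : {set T i})).
Proof. by apply: (comp_set fT); apply: comp_eq (comp_false _) => p _; rewrite inE. Qed.

Lemma comp_setT : computable (fun i => enc_set [set: T i]).
Proof. by apply: (comp_set fT); apply: comp_eq (comp_true _) => p _; rewrite inE. Qed.

Lemma comp_setU A B : computable (fun i => enc_set (A i)) ->
  computable (fun i => enc_set (B i)) -> computable (fun i => enc_set (A i :|: B i)).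
Proof.
move=> cA cB; apply: (comp_setb fT (p := fun i x => (x \in A i) || (x \in B i))).
by apply: comp_orb; apply: (comp_mem (fin_weak _ _ fT)); atom.
Qed.

Lemma comp_setD A B : computable (fun i => enc_set (A i)) ->
  computable (fun i => enc_set (B i)) -> computable (fun i => enc_set (A i :\: B i)).
Proof.
move=> cA cB; apply: (comp_setb fT (p := fun i x => (x \notin B i) && (x \in A i))).
by apply: comp_andb; [apply: comp_negb|]; apply: (comp_mem (fin_weak _ _ fT)); atom.
Qed.

Lemma comp_setC A : computable (fun i => enc_set (A i)) ->
  computable (fun i => enc_set (~: A i)).
Proof.
move=> cA; apply: (comp_setb fT (p := fun i x => (x \notin A i))).
by apply: comp_negb; apply: (comp_mem (fin_weak _ _ fT)); atom.
Qed.

Lemma comp_subset A B : computable (fun i => enc_set (A i)) ->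
  computable (fun i => enc_set (B i)) -> computable (fun i => enc_bool (A i \subset B i)).
Proof.
move=> cA cB.
have c : computable (fun i => enc_bool [forall x, (x \in A i) ==> (x \in B i)]).
  apply: (comp_forall fT (b := fun i x => (x \in A i) ==> (x \in B i))).
  by apply: comp_implyb; apply: (comp_mem (fin_weak _ _ fT)); atom.
apply: comp_eq c => i _; congr enc_bool.
by apply/forall_inP/subsetP.
Qed.

Lemma fpt_card A : fpt (fun i => #|A i|).
Proof. by have [f _] := fT; apply: fpt_le f => i _; apply: max_card. Qed.

Lemma comp_card A : computable (fun i => enc_set (A i)) ->
  computable (fun i => enc_nat #|A i|).
Proof.
move=> cA; have fA : fpt (fun i => size (enum (A i))).
  by apply: fpt_le (fpt_card A) => i _; rewrite -cardE.
by apply: comp_eq (comp_size fA (comp_enum fT cA)) => i _; rewrite -cardE.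
Qed.

End Sets.

(** Stronger than [fpt]: such a bound survives exponentiation and may be fed to the arbitrary
    function in the running time of a scheme. *)
Definition param_bounded C (b : C -> nat) : Prop :=
  exists f : nat * rat -> nat, forall i, dom i -> b i <= f (par i).

Lemma param_bounded_fpt C (b : C -> nat) : param_bounded b -> fpt b.
Proof. by move=> [f fb]; exact: (fpt_le fb (@fpt_par C f)). Qed.

Lemma param_bounded_homo C (b : C -> nat) (h : nat -> nat) :
  {homo h : m n / m <= n} -> param_bounded b -> param_bounded (fun i => h (b i)).
Proof. by move=> hh [f fb]; exists (fun p => h (f p)) => i di; apply: hh (fb _ di). Qed.

Lemma param_bounded_weak C J Q w (b : C -> nat) :
  param_bounded b -> param_bounded (fun p : @extend C J Q w => b (tag p)).
Proof. by move=> [f fb]; exists f => p [di _]; apply: fb. Qed.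

Lemma param_bounded_restrict C Q (b : C -> nat) :
  param_bounded b -> param_bounded (b : @restrict C Q -> nat).
Proof. by move=> [f fb]; exists f => i [di _]; apply: fb. Qed.

Lemma param_bounded_mul C (b b' : C -> nat) :
  param_bounded b -> param_bounded b' -> param_bounded (fun i => b i * b' i).
Proof.
by move=> [f fb] [g gb]; exists (fun p => f p * g p) => i di; apply: leq_mul; auto.
Qed.

Lemma param_bounded_pow2 C (X : C -> nat) :
  param_bounded X -> param_bounded (fun i => 2 ^ (X i * X i)).
Proof.
apply: (param_bounded_homo (h := fun x => 2 ^ (x * x))) => m n mn.
by rewrite leq_exp2l // leq_mul.
Qed.

Definition enc_family (T : finType) (F : seq {set T}) : value :=
  enc_seq [seq enc_set P | P <- F].

Definition set_ctx C (T : C -> finType) : ctx :=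
  @extend C (fun i => {set T i}) (fun _ _ => True) (fun i P => enc_set P).

Section SetFamilies.
Variables (C : ctx) (T : C -> finType).
Hypothesis fT : fin T.

Lemma comp_subsets (X : forall i, {set T i}) :
  fpt (fun i => 2 ^ #|X i|) -> computable (fun i => enc_set (X i)) ->
  computable (fun i => enc_family (subsets (X i))).
Proof.
move=> fX cX.
have fs : fpt (fun i => size (enum (X i))).
  by apply: fpt_le fX => i _; rewrite -cardE ltnW // ltn_expl.
have H := @comp_foldr C (fun i => T i) (fun i => seq {set T i}) (fun i => enum (X i))
  (fun i x => enc1 x) (fun i L => enc_family L)
  (fun i x L => L ++ [seq x |: B | B <- L]) (fun i => [:: set0]) fs (comp_enum fT cX).
apply: H; first exact: comp_node (comp_set0 fT) (comp_leaf _).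
set K := foldr_ctx _ _ _ _ _.
have fK : fin (fun p : K => T (tag p)) by exact: fin_weak fT.
have cL : computable (fun p : K => enc_family (tagged p).2) by exact: comp_foldr_acc.
have cx : computable (fun p : K => enc1 (tagged p).1).
  exact: comp_fst (comp_fst (comp_inp K)).
have fL : fpt (fun p : K => size (tagged p).2).
  apply: fpt_le (fpt_weak _ _ fX) => -[i [x L]] [_ /= [s1 [s2 [ds ->]]]].
  rewrite size_subsets_foldr leq_exp2l // cardE ds size_cat /=; lia.
have cM : computable (fun p : K => enc_seq [seq enc_set ((tagged p).1 |: B) | B <- (tagged p).2]).
  apply: (comp_map fL cL (v := fun p B => enc_set ((tagged p).1 |: B))).
  apply: (comp_setU (fin_weak _ _ fK) (A := fun q => [set (tagged (tag q)).1])).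
    exact: comp_weak cx.
  exact: comp_var.
apply: comp_eq (comp_cat fL cL cM) => p _.
by rewrite /enc_family map_cat -map_comp.
Qed.

Lemma comp_smallest (p : forall i, pred {set T i}) (F : forall i, seq {set T i}) :
  fpt (fun i => size (F i)) -> computable (fun i => enc_family (F i)) ->
  computable (fun q : set_ctx T => enc_bool (p (tag q) (tagged q))) ->
  computable (fun i => enc_set (smallest (p i) (F i))).
Proof.
move=> fF cF cp.
have H := @comp_foldr C (fun i => {set T i}) (fun i => {set T i}) F (fun i P => enc_set P)
  (fun i P => enc_set P)
  (fun i P Q => if p i P && (~~ p i Q || (#|P| <= #|Q|)) then P else Q) (fun=> set0) fF cF
  (comp_set0 fT).
apply: H; set K := foldr_ctx _ _ _ _ _.
have fK : fin (fun p : K => T (tag p)) by exact: fin_weak fT.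
have cQ : computable (fun q : K => enc_set (tagged q).2) by exact: comp_foldr_acc.
have cP : computable (fun q : K => enc_set (tagged q).1).
  exact: comp_fst (comp_fst (comp_inp K)).
have ci : computable (fun q : K => inp (tag q)) by exact: comp_snd (comp_inp K).
have cpP : computable (fun q : K => enc_bool (p (tag q) (tagged q).1)).
  apply: (comp_subst (m := fun q : K => existT _ (tag q) (tagged q).1 : set_ctx T) _ _ cp).
    by move=> q [].
  exact: comp_node cP ci.
have cpQ : computable (fun q : K => enc_bool (p (tag q) (tagged q).2)).
  apply: (comp_subst (m := fun q : K => existT _ (tag q) (tagged q).2 : set_ctx T) _ _ cp).
    by move=> q [].
  exact: comp_node cQ ci.
have cle : computable (fun q : K => enc_bool (#|(tagged q).1| <= #|(tagged q).2|)).
  apply: comp_leq; first exact: (fpt_card fK (fun q => (tagged q).2)).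
    exact: (comp_card fK (A := fun q => (tagged q).1) cP).
  exact: (comp_card fK (A := fun q => (tagged q).2) cQ).
have := comp_if (comp_andb cpP (comp_orb (comp_negb cpQ) cle))
  (comp_restrict _ cP) (comp_restrict _ cQ).
by apply: comp_eq => q _; case: ifP.
Qed.

End SetFamilies.

(** * Deciding partial solutions *)

Section PartialSolutions.
Variables (C : ctx) (G : C -> sgraph).
Hypothesis fG : fin (fun i => vert (G i)).
Hypothesis cG : computable (fun i => enc_graph (G i)).
Variable E : forall i, {set G i * G i}.
Arguments E : clear implicits.
Hypothesis cE : computable (fun i => enc_set (E i)).

Lemma comp_in_pair C' (m : C' -> C) (x y : forall i, G (m i)) :
  fin (fun i => vert (G (m i))) -> computable (fun i => enc_set (E (m i))) ->
  computable (fun i => enc1 (x i)) -> computable (fun i => enc1 (y i)) ->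
  computable (fun i => enc_bool ((x i, y i) \in E (m i))).
Proof.
move=> fm cm cx cy; apply: (comp_mem (fin_prod fm fm)) cm.
exact: comp_pair.
Qed.

Lemma comp_adjE : computable (fun i => enc_rel (adjE (E i))).
Proof.
apply: (comp_mkrel fG (r := fun i => adjE (E i))).
pose f2 := fin_weak _ _ (fin_weak _ _ fG) : fin (fun q : elt2_ctx G G => vert (G (tag (tag q)))).
have cE2 : computable (fun q : elt2_ctx G G => enc_set (E (tag (tag q)))) by atom.
have cx : computable (fun q : elt2_ctx G G => enc1 (tagged (tag q))) by atom.
have cy : computable (fun q : elt2_ctx G G => enc1 (tagged q)) by atom.
apply: comp_orb.
  apply: (comp_rel f2 (r := fun q => @adj (G (tag (tag q))))) => //.
  exact: (comp_weak _ _ (comp_weak _ _ cG)).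
apply: comp_andb; first by apply: comp_negb; apply: (comp_eqb f2).
pose m (q : elt2_ctx G G) : C := tag (tag q).
apply: comp_orb.
  exact: (comp_in_pair (m := m) (x := fun q => tagged (tag q)) (y := fun q => tagged q)).
exact: (comp_in_pair (m := m) (x := fun q => tagged q) (y := fun q => tagged (tag q))).
Qed.

Lemma comp_vdiag : computable (fun i => enc_set (vdiag (E i))).
Proof.
apply: (comp_setb fG (p := fun i x => (x, x) \in E i)).
pose m (q : elt_ctx G) : C := tag q.
by apply: (comp_in_pair (m := m) (x := fun q => tagged q) (y := fun q => tagged q)); atom.
Qed.

Lemma comp_partial cv (A P : forall i, {set G i}) :
  computable (fun i => enc_set (A i)) -> computable (fun i => enc_set (P i)) ->
  computable (fun i => enc_bool (partial_solution cv (E i) (A i) (P i))).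
Proof.
move=> cA cP; apply: comp_andb; first exact: (comp_subset fG comp_vdiag cP).
apply: comp_andb; first exact: (comp_subset fG cP cA).
exact: (comp_solvesb fG comp_adjE cA cP).
Qed.

Lemma comp_canonical cv (A : forall i, {set G i}) :
  computable (fun i => enc_set (A i)) ->
  computable (fun i => enc_set (canonical cv (E i) (A i))).
Proof.
move=> cA; rewrite /canonical; case: cv => //.
apply: (comp_setb fG (p := fun i x => (x \in A i) &&
  ((x \in vdiag (E i)) || [exists y, (y \in A i) && adjE (E i) x y]))).
have cd := comp_vdiag; have cr := comp_adjE.
apply: comp_andb; first by apply: (comp_mem (fin_weak _ _ fG)); atom.
apply: comp_orb; first by apply: (comp_mem (fin_weak _ _ fG)); atom.
apply: (comp_exists (fin_weak _ _ fG) (b := fun p y => (y \in A (tag p)) &&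
  adjE (E (tag p)) (tagged p) y)).
apply: comp_andb; first by apply: (comp_mem (fin_weak _ _ (fin_weak _ _ fG))); atom.
by apply: (comp_rel (fin_weak _ _ (fin_weak _ _ fG)) (r := fun q => adjE (E (tag (tag q))))); atom.
Qed.

End PartialSolutions.

(** * Computing the gadget graph *)

Section ComputeGadget.
Variables (C : ctx) (G : C -> sgraph).
Hypothesis fG : fin (fun i => vert (G i)).
Variable E : forall i, {set G i * G i}.
Variable A : forall i, {set G i}.
Arguments E : clear implicits.
Arguments A : clear implicits.
Hypothesis cE : computable (fun i => enc_set (E i)).
Hypothesis cA : computable (fun i => enc_set (A i)).

Let V i : finType := (G i + (G i + G i))%type.

Lemma fpt_gadget : fpt (fun i => #|V i|).
Proof.
have [f _] := fG; apply: fpt_le (fpt_add f (fpt_add f f)) => i _.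
by rewrite !card_sum.
Qed.

Lemma comp_gadget_vertices :
  computable (fun i => enc_set (gadget_vertices (E i) (A i))).
Proof.
have cd := comp_vdiag fG cE; have [f _] := fG.
apply: (comp_tab_sum (v := fun i z => enc_bool (z \in gadget_vertices (E i) (A i))) f).
  by apply: comp_eq cA => i _; apply: eq_tab => x; rewrite inE.
apply: (comp_tab_sum (v := fun i z => enc_bool (inr z \in gadget_vertices (E i) (A i))) f).
  by apply: comp_eq cd => i _; apply: eq_tab => x; rewrite [in RHS]inE.
by apply: comp_eq cd => i _; apply: eq_tab => x; rewrite [in RHS]inE.
Qed.

Lemma comp_gadget_tab (v : forall i, (G i + (G i + G i))%type -> value) :
  computable (fun i => tab (fun x => v i (inl x))) ->
  computable (fun i => tab (fun x => v i (inr (inl x)))) ->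
  computable (fun i => tab (fun x => v i (inr (inr x)))) ->
  computable (fun i => tab (fun z : gadget (E i) (A i) => v i (val z))).
Proof.
move=> c1 c2 c3; have [f _] := fG.
apply: (comp_tab_sub (T := V) fpt_gadget comp_gadget_vertices).
apply: (comp_tab_sum f) c1 _.
exact: (comp_tab_sum (v := fun i x => v i (inr x)) f c2 c3).
Qed.

Lemma fin_gadget : fin (fun i => vert (gadget (E i) (A i))).
Proof.
have cl : computable (fun i => tab (fun x : G i => VLeaf)).
  exact: (comp_tab fG (v := fun i x => VLeaf) (comp_leaf _)).
apply: (fin_tab _ (comp_gadget_tab (v := fun i _ => VLeaf) cl cl cl)).
apply: fpt_le fpt_gadget => i _.
by rewrite -(card_imset predT val_inj); apply: max_card.
Qed.

Lemma comp_gadget_modulator (X : forall i, {set G i}) :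
  computable (fun i => enc_set (X i)) ->
  computable (fun i => enc_set (gadget_modulator (E i) (A i) (X i))).
Proof.
move=> cX.
have ct : computable (fun i => tab (fun x : G i => enc_bool true)).
  exact: (comp_tab fG (v := fun i x => enc_bool true) (comp_true _)).
apply: (comp_eq _ (comp_gadget_tab
  (v := fun i z => enc_bool (if z is inl x then x \in X i else true)) cX ct ct)).
by move=> i _; apply: eq_tab => z; rewrite inE.
Qed.

End ComputeGadget.

Section ComputeGadget2.
Variables (C : ctx) (G : C -> sgraph).
Hypothesis fG : fin (fun i => vert (G i)).
Hypothesis cG : computable (fun i => enc_graph (G i)).
Variable E : forall i, {set G i * G i}.
Variable A : forall i, {set G i}.
Arguments E : clear implicits.
Arguments A : clear implicits.
Hypothesis cE : computable (fun i => enc_set (E i)).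
Hypothesis cA : computable (fun i => enc_set (A i)).

Lemma comp_const_tab C' (T : C' -> finType) : fin T ->
  computable (fun i => tab (fun x : T i => enc_bool false)).
Proof. by move=> fT; apply: (comp_tab fT (v := fun i x => enc_bool false)); apply: comp_false. Qed.

Lemma comp_gadget_graph : computable (fun i => enc_graph (gadget (E i) (A i))).
Proof.
have cr := comp_adjE fG cG cE; have cd := comp_vdiag fG cE.
have f1 : fin (fun q : elt_ctx G => vert (G (tag q))) by atom.
have cE1 : computable (fun q : elt_ctx G => enc_set (E (tag q))) by atom.
have cA1 : computable (fun q : elt_ctx G => enc_set (A (tag q))) by atom.
have c0 := comp_const_tab f1.
have cx : computable (fun q : elt_ctx G => enc1 (tagged q)) by atom.
have f2 : fin (fun q : elt2_ctx G G => vert (G (tag (tag q)))) by atom.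
have cx2 : computable (fun q : elt2_ctx G G => enc1 (tagged (tag q))) by atom.
have cy2 : computable (fun q : elt2_ctx G G => enc1 (tagged q)) by atom.
have cd2 : computable (fun q : elt2_ctx G G => enc_set (vdiag (E (tag (tag q))))) by atom.
(* Rows are indexed by all vertices of [pendant_graph], so that rows and columns are restricted to
   the gadget by the same table construction. *)
pose row i (z : (G i + (G i + G i))%type) :=
  tab (fun w : gadget (E i) (A i) => enc_bool (pendant_adj (E i) z (val w))).
have rowE i : enc_graph (gadget (E i) (A i)) = tab (fun z : gadget (E i) (A i) => row i (val z)).
  by apply: eq_tab => z; apply: eq_tab => w; rewrite inE.
apply: (comp_eq (v := fun i => tab (fun z : gadget (E i) (A i) => row i (val z)))).
  by move=> i _; rewrite rowE.
(* The row of a pendant depends only on the vertex it hangs from, so both copies share one table. *)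
have pend_row : computable (fun q : elt_ctx G => tab (fun w : gadget (E (tag q)) (A (tag q)) =>
    enc_bool (if val w is inl y then (y \in vdiag (E (tag q))) && (tagged q == y) else false))).
  apply: (comp_gadget_tab f1 cE1 cA1 (v := fun q w => enc_bool
    (if w is inl y then (y \in vdiag (E (tag q))) && (tagged q == y) else false))) => //.
  apply: (comp_tab f1 (v := fun q y => enc_bool ((y \in vdiag (E (tag q))) && (tagged q == y)))).
  apply: comp_andb; first exact: (comp_mem f2).
  exact: (comp_eqb f2).
apply: (comp_gadget_tab fG cE cA).
- apply: (comp_tab fG (v := fun i x => row i (inl x))).
  have inner : computable (fun q : elt_ctx G => tab (fun y => enc_bool
      ((tagged q \in vdiag (E (tag q))) && (y == tagged q)))).
    apply: (comp_tab f1 (v := fun q y => enc_bool ((tagged q \in vdiag (E (tag q))) && (y == tagged q)))).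
    apply: comp_andb; first exact: (comp_mem f2).
    exact: (comp_eqb f2).
  apply: (comp_gadget_tab f1 cE1 cA1 (v := fun q w =>
    enc_bool (pendant_adj (E (tag q)) (inl (tagged q)) w))) => //.
  apply: (comp_tab f1 (v := fun q y => enc_bool (adjE (E (tag q)) (tagged q) y))).
  exact: (comp_rel f2 (r := fun q => adjE (E (tag (tag q)))) (comp_weak _ _ (comp_weak _ _ cr))).
- apply: (comp_tab fG (v := fun i x => row i (inr (inl x)))).
  by apply: comp_eq pend_row => q _; apply: eq_tab => w; case: (val w).
- apply: (comp_tab fG (v := fun i x => row i (inr (inr x)))).
  by apply: comp_eq pend_row => q _; apply: eq_tab => w; case: (val w).
Qed.

Lemma comp_gadget_project (Q : forall i, {set gadget (E i) (A i)}) :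
  computable (fun i => enc_set (Q i)) ->
  computable (fun i => enc_set (gadget_project (Q i))).
Proof.
move=> cQ; have fgad := fin_gadget fG cE cA.
apply: (comp_setb fG (p := fun i x => [exists z in Q i, val z == inl x])).
have f1 : fin (fun q : elt_ctx G => vert (G (tag q))) by atom.
have cE1 : computable (fun q : elt_ctx G => enc_set (E (tag q))) by atom.
have cA1 : computable (fun q : elt_ctx G => enc_set (A (tag q))) by atom.
have c0 := comp_const_tab f1.
have f2 : fin (fun q : elt2_ctx G G => vert (G (tag (tag q)))) by atom.
have isx : computable (fun q : elt_ctx G => tab (fun z : gadget (E (tag q)) (A (tag q)) =>
    enc_bool (val z == inl (tagged q)))).
  apply: (comp_gadget_tab f1 cE1 cA1 (v := fun q z => enc_bool (z == inl (tagged q)))) => //.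
  by apply: (comp_tab f1 (v := fun q y => enc_bool (y == tagged q))); apply: (comp_eqb f2); atom.
have fg1 : fin (fun q : elt_ctx G => vert (gadget (E (tag q)) (A (tag q)))) by atom.
apply: (comp_exists fg1 (b := fun q z => (z \in Q (tag q)) && (val z == inl (tagged q)))).
apply: comp_andb; first by apply: (comp_mem (fin_weak _ _ fg1)); atom.
apply: (comp_lookup (fin_weak _ _ fg1) (v := fun p z => enc_bool (val z == inl (tagged (tag p))))).
  exact: (comp_weak _ _ isx).
exact: comp_var.
Qed.

End ComputeGadget2.

(** * Computing the dynamic program *)

(** Quantified over all contexts, so that [solve] can be called under local variables. Feasibility
    is required because elsewhere the value of [solve] need not be an output of the scheme. *)
Definition solver_computable (H : sgraph -> Prop) (cv : bool)
    (solve : forall Gamma : sgraph, {set Gamma} -> nat -> {set Gamma}) : Prop :=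
  forall C (Gamma : C -> sgraph) (W : forall i, {set Gamma i}) (n : C -> nat),
  computable (fun i => enc_graph (Gamma i)) ->
  computable (fun i => enc_set (W i)) -> computable (fun i => enc_nat (n i)) ->
  param_bounded (fun i => #|W i|) -> param_bounded n -> fpt (fun i => #|Gamma i|) ->
  (forall i, dom i -> [/\ 0 < n i, is_modulator H (W i) & exists S : {set Gamma i}, problem cv S]) ->
  computable (fun i => enc_set (solve (Gamma i) (W i) (n i))).

Lemma fin_graph C (G : C -> sgraph) :
  fpt (fun i => #|G i|) -> computable (fun i => enc_graph (G i)) -> fin (fun i => vert (G i)).
Proof. by move=> fG cG; apply: (fin_tab (v := fun i x => enc_set [set y | adj x y]) fG). Qed.

Section ComputeFamilies.
Variables (C : ctx) (G : C -> sgraph).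
Hypothesis fG : fin (fun i => vert (G i)).
Hypothesis cG : computable (fun i => enc_graph (G i)).
Variable X : forall i, {set G i}.
Arguments X : clear implicits.
Hypothesis cX : computable (fun i => enc_set (X i)).
Hypothesis pX : param_bounded (fun i => #|X i|).

Lemma fpt_edge_sets : fpt (fun i => size (edge_sets (X i))).
Proof.
apply: fpt_le (param_bounded_fpt (param_bounded_pow2 pX)) => i _.
by rewrite size_subsets cardsX.
Qed.

Lemma comp_edge_sets : computable (fun i => enc_family (edge_sets (X i))).
Proof.
have f2 := fin_prod fG fG; apply: (comp_subsets f2).
  by apply: fpt_le fpt_edge_sets => i _; rewrite size_subsets.
apply: (comp_setb f2 (p := fun i p => (p.1 \in X i) && (p.2 \in X i))).
have f1 : fin (fun q : elt_ctx (fun i => (G i * G i)%type : finType) => vert (G (tag q))) by atom.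
have cp : computable (fun q : elt_ctx (fun i => (G i * G i)%type : finType) => enc1 (tagged q)) by atom.
apply: comp_andb; apply: (comp_mem f1); try atom.
  exact: (comp_proj1 f1 f1 cp).
exact: (comp_proj2 f1 f1 cp).
Qed.

Definition edges_ctx : ctx :=
  occ_ctx (fun i => edge_sets (X i)) (fun i E => enc_set E).

Lemma comp_edge_map (v : forall i, {set G i * G i} -> {set G i}) :
  computable (fun q : edges_ctx => enc_set (v (tag q) (tagged q))) ->
  computable (fun i => enc_family [seq v i E | E <- edge_sets (X i)]).
Proof.
move=> cv; have := comp_map fpt_edge_sets comp_edge_sets (v := fun i E => enc_set (v i E)) cv.
by apply: comp_eq => i _; rewrite /enc_family -map_comp.
Qed.

Lemma comp_base_family : computable (fun i => enc_family (base_family (X i))).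
Proof.
apply: (comp_edge_map (v := fun i E => vdiag E)).
have f1 : fin (fun q : edges_ctx => vert (G (tag q))) by atom.
have cE : computable (fun q : edges_ctx => enc_set (tagged q)) by atom.
exact: (comp_vdiag f1 cE).
Qed.

Lemma comp_reduce cv (A : forall i, {set G i}) (F : forall i, seq {set G i}) :
  computable (fun i => enc_set (A i)) -> fpt (fun i => size (F i)) ->
  computable (fun i => enc_family (F i)) ->
  computable (fun i => enc_family (reduce cv (X i) (A i) (F i))).
Proof.
move=> cA fF cF; apply: comp_node; first exact: (comp_set0 fG).
apply: (comp_edge_map (v := fun i E => smallest (partial_solution cv E (A i)) (F i))).
have f1 : fin (fun q : edges_ctx => vert (G (tag q))) by atom.
apply: (comp_smallest f1 (F := fun q => F (tag q))
  (p := fun q => partial_solution cv (tagged q) (A (tag q)))).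
- exact: (fpt_weak _ _ fF).
- exact: (comp_weak _ _ cF).
set K := set_ctx _.
have f2 : fin (fun q : K => vert (G (tag (tag q)))) by atom.
have cE : computable (fun q : edges_ctx => enc_set (tagged q)) by atom.
have cG2 : computable (fun q : K => enc_graph (G (tag (tag q)))).
  exact: (comp_weak _ _ (comp_weak _ _ cG)).
have cE2 : computable (fun q : K => enc_set (tagged (tag q))) by exact: (comp_weak _ _ cE).
have cA2 : computable (fun q : K => enc_set (A (tag (tag q)))).
  exact: (comp_weak _ _ (comp_weak _ _ cA)).
have cP : computable (fun q : K => enc_set (tagged q)) by exact: comp_var.
exact: (comp_partial f2 cG2 cE2 cv cA2 cP).
Qed.

Lemma comp_leaf_family H cv solve (b : C -> nat) (A : forall i, {set G i}) :
  graph_family H -> solver_computable H cv solve ->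
  computable (fun i => enc_set (A i)) -> computable (fun i => enc_nat (b i)) ->
  param_bounded b ->
  (forall i, dom i -> [/\ 0 < b i, X i \subset A i & H (induced (A i :\: X i))]) ->
  computable (fun i => enc_family (leaf_family cv (b i) solve (X i) (A i))).
Proof.
move=> famH solveC cA cb pb validP; apply: comp_node; first exact: (comp_set0 fG).
apply: (comp_edge_map (v := fun i E => leaf_solution cv (b i) solve (X i) (A i) E)).
have f1 : fin (fun q : edges_ctx => vert (G (tag q))) by atom.
have cG1 : computable (fun q : edges_ctx => enc_graph (G (tag q))) by exact: (comp_weak _ _ cG).
have cX1 : computable (fun q : edges_ctx => enc_set (X (tag q))) by exact: (comp_weak _ _ cX).
have cA1 : computable (fun q : edges_ctx => enc_set (A (tag q))) by exact: (comp_weak _ _ cA).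
have cb1 : computable (fun q : edges_ctx => enc_nat (b (tag q))) by exact: (comp_weak _ _ cb).
have cE1 : computable (fun q : edges_ctx => enc_set (tagged q)) by atom.
have cguard := comp_partial f1 cG1 cE1 cv cA1 (comp_canonical f1 cG1 cE1 cv cA1).
pose guard (q : edges_ctx) :=
  partial_solution cv (tagged q) (A (tag q)) (canonical cv (tagged q) (A (tag q))).
(* Where the guard holds, the embedded canonical set witnesses that the gadget is feasible, and only
   there is the scheme called. *)
pose K := restrict guard.
have f2 : fin (fun q : K => vert (G (tag q))) by exact: (fin_restrict _ f1).
have cG2 : computable (fun q : K => enc_graph (G (tag q))) by exact: (comp_restrict _ cG1).
have cX2 : computable (fun q : K => enc_set (X (tag q))) by exact: (comp_restrict _ cX1).
have cA2 : computable (fun q : K => enc_set (A (tag q))) by exact: (comp_restrict _ cA1).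
have cE2 : computable (fun q : K => enc_set (tagged q)) by exact: (comp_restrict _ cE1).
have cb2 : computable (fun q : K => enc_nat (b (tag q))) by exact: (comp_restrict _ cb1).
have pX2 : param_bounded (fun q : K => #|X (tag q)|).
  have p1 : param_bounded (fun q : edges_ctx => #|X (tag q)|) by exact: (param_bounded_weak _ _ pX).
  exact: (@param_bounded_restrict edges_ctx guard _ p1).
have pb2 : param_bounded (fun q : K => b (tag q)).
  have p1 : param_bounded (fun q : edges_ctx => b (tag q)) by exact: (param_bounded_weak _ _ pb).
  exact: (@param_bounded_restrict edges_ctx guard _ p1).
have pX3 : param_bounded (fun q : K => #|X (tag q)|.+1).
  by apply: (param_bounded_homo (h := S)) pX2 => m n.
have cbX : computable (fun q : K => enc_nat (b (tag q) * #|X (tag q)|.+1)).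
  apply: comp_mul; [exact: param_bounded_fpt|exact: param_bounded_fpt|by []|].
  exact: comp_succ (comp_card f2 cX2).
have EX (q : K) : dom q -> tagged q \subset setX (X (tag q)) (X (tag q)).
  by move=> [[_ /occurs_mem qE] _]; apply: subsets_sub.
have csolve : computable (fun q : K => enc_set
    (solve _ (gadget_modulator (tagged q) (A (tag q)) (X (tag q))) (b (tag q) * #|X (tag q)|.+1))).
  apply: solveC.
  - exact: comp_gadget_graph.
  - exact: comp_gadget_modulator.
  - by [].
  - have p3 : param_bounded (fun q : K => 3 * #|X (tag q)|).
      by apply: (param_bounded_homo (h := muln 3)) pX2 => m n mn; rewrite leq_mul2l.
    have [f fb] := p3; exists f => q dq; apply: leq_trans (fb q dq).
    by apply: card_modulator; apply: EX.
  - exact: param_bounded_mul.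
  - have [f _] := fin_gadget f2 cE2 cA2; exact: f.
  move=> q dq; have [[di _] gq] := dq; have [b0 XA HX] := validP _ di; split.
  - by rewrite muln_gt0 b0.
  - by apply: modulator_valid => //; apply: EX.
  by exists (gadget_embed (tagged q) (A (tag q)) (canonical cv (tagged q) (A (tag q))));
    apply: partial_embed.
have := @comp_if edges_ctx guard _ _ cguard (comp_gadget_project f2 cE2 cA2 csolve) (comp_restrict _ (comp_set0 f1)).
by apply: comp_eq => q _; rewrite /leaf_solution -/(guard q); case: ifP.
Qed.

End ComputeFamilies.

Lemma comp_catF C (T : C -> Type) (s t : forall i, seq (T i)) (e : forall i, T i -> value) :
  fpt (fun i => size (s i)) ->
  computable (fun i => enc_seq [seq e i x | x <- s i]) ->
  computable (fun i => enc_seq [seq e i x | x <- t i]) ->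
  computable (fun i => enc_seq [seq e i x | x <- s i ++ t i]).
Proof.
by move=> fs cs ct; apply: comp_eq (comp_cat fs cs ct) => i _; rewrite map_cat.
Qed.

Lemma comp_unions C (T : C -> finType) (F1 F2 : forall i, seq {set T i}) :
  fin T -> fpt (fun i => size (F1 i)) -> fpt (fun i => size (F2 i)) ->
  computable (fun i => enc_family (F1 i)) -> computable (fun i => enc_family (F2 i)) ->
  computable (fun i => enc_family [seq P :|: Q | P <- F1 i, Q <- F2 i]).
Proof.
move=> fT f1 f2 c1 c2.
have H := @comp_foldr C (fun i => {set T i}) (fun i => seq {set T i}) F1
  (fun i P => enc_set P) (fun i L => enc_family L)
  (fun i P L => [seq P :|: Q | Q <- F2 i] ++ L) (fun=> [::]) f1 c1 (comp_leaf _).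
apply: (comp_eq _ (H _)).
  by move=> i _; congr enc_family; elim: (F1 i) => //= P L ->.
set K := foldr_ctx _ _ _ _ _.
have fK : fin (fun p : K => T (tag p)) by exact: fin_weak fT.
have cL : computable (fun p : K => enc_family (tagged p).2) by exact: comp_foldr_acc.
have cP : computable (fun p : K => enc_set (tagged p).1).
  exact: comp_fst (comp_fst (comp_inp K)).
have f2K : fpt (fun p : K => size (F2 (tag p))) by exact: (fpt_weak _ _ f2).
have c2K : computable (fun p : K => enc_family (F2 (tag p))) by exact: (comp_weak _ _ c2).
have f2K' : fpt (fun p : K => size [seq (tagged p).1 :|: Q | Q <- F2 (tag p)]).
  by apply: fpt_le f2K => p _; rewrite size_map.
apply: (comp_catF f2K' _ cL).
have cM : computable (fun p : K => enc_seq [seq enc_set ((tagged p).1 :|: Q) | Q <- F2 (tag p)]).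
  apply: (comp_map f2K c2K (v := fun p Q => enc_set ((tagged p).1 :|: Q))).
  apply: (comp_setU (fin_weak _ _ fK) (A := fun q => (tagged (tag q)).1)).
    exact: comp_weak cP.
  exact: comp_var.
by apply: comp_eq cM => p _; rewrite -map_comp.
Qed.

Definition enc_state (T : finType) (a : {set T} * seq {set T}) : value :=
  VNode (enc_set a.1) (enc_family a.2).

Lemma comp_merge C (G : C -> sgraph) cv (X : forall i, {set G i})
    (a1 a2 : forall i, ({set G i} * seq {set G i})%type) :
  fin (fun i => vert (G i)) -> computable (fun i => enc_graph (G i)) ->
  param_bounded (fun i => #|X i|) -> computable (fun i => enc_set (X i)) ->
  fpt (fun i => size (a1 i).2) -> fpt (fun i => size (a2 i).2) ->
  computable (fun i => enc_state (a1 i)) -> computable (fun i => enc_state (a2 i)) ->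
  computable (fun i => enc_state (merge_states cv (X i) (a1 i) (a2 i))).
Proof.
move=> fG cG pX cX f1 f2 c1 c2.
have cA : computable (fun i => enc_set ((a1 i).1 :|: (a2 i).1)).
  exact: (comp_setU fG (comp_fst c1) (comp_fst c2)).
apply: (comp_node cA).
have cU := comp_unions fG f1 f2 (comp_snd c1) (comp_snd c2).
apply: (comp_reduce fG cG cX pX cv cA _ cU).
by apply: fpt_le (fpt_mul f1 f2) => i _; rewrite size_allpairs.
Qed.

(** Bundled so that one lemma carries all the data under a binder; [w] bounds the boundaries
    uniformly over the nodes. *)
Record dp_data (H : sgraph -> Prop) C (G : C -> sgraph)
    (D : forall i, decomposition (G i)) (b w : C -> nat) : Prop := DpData {
  dp_graph_fin : fin (fun i => vert (G i));
  dp_graph : computable (fun i => enc_graph (G i));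
  dp_node_fin : fin (fun i => node (D i));
  dp_up : computable (fun i => enc_rel (@up _ (D i)));
  dp_bag : computable (fun i => tab (fun t : node (D i) => enc_set (bag t)));
  dp_base : computable (fun i => enc_set (base (D i)));
  dp_denominator : computable (fun i => enc_nat (b i));
  dp_denominator_bounded : param_bounded b;
  dp_width_bounded : param_bounded w;
  dp_denominator_gt0 : forall i, dom i -> 0 < b i;
  dp_tree : forall i, dom i -> is_tree_decomposition H (D i);
  dp_boundary : forall i, dom i -> forall t : node (D i), #|boundary t| <= w i }.

Lemma dp_data_weak H C (G : C -> sgraph) (D : forall i, decomposition (G i)) b w J Q e :
  dp_data H D b w ->
  @dp_data H (@extend C J Q e) (fun p => G (tag p)) (fun p => D (tag p))
    (fun p => b (tag p)) (fun p => w (tag p)).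
Proof.
case=> fG cG fN cup cbag cbase cb pb pw b0 tD bd; split.
- exact: (fin_weak _ _ fG).
- exact: (comp_weak _ _ cG).
- exact: (fin_weak _ _ fN).
- exact: (comp_weak _ _ cup).
- exact: (comp_weak _ _ cbag).
- exact: (comp_weak _ _ cbase).
- exact: (comp_weak _ _ cb).
- exact: (param_bounded_weak _ _ pb).
- exact: (param_bounded_weak _ _ pw).
- by move=> p [/b0].
- by move=> p [/tD].
- by move=> p [/bd].
Qed.

Section ComputeStep.
Variables (H : sgraph -> Prop) (cv : bool).
Variable solve : forall Gamma : sgraph, {set Gamma} -> nat -> {set Gamma}.
Hypotheses (famH : graph_family H) (solveC : solver_computable H cv solve).
Variables (C : ctx) (G : C -> sgraph) (D : forall i, decomposition (G i)).
Variables (b w : C -> nat).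
Arguments D : clear implicits.
Hypothesis data : dp_data H D b w.

Let fG := dp_graph_fin data.
Let cG := dp_graph data.
Let fN := dp_node_fin data.
Let cup := dp_up data.
Let cbag := dp_bag data.
Let cbase := dp_base data.
Let cb := dp_denominator data.
Let pb := dp_denominator_bounded data.
Let pw := dp_width_bounded data.
Let b_gt0 := dp_denominator_gt0 data.
Let treeD := dp_tree data.
Let bound := dp_boundary data.

Let N i : finType := node (D i).
Let M i := (2 ^ (w i * w i)).+1.

Lemma fpt_M : fpt M.
Proof.
have [f fb] := param_bounded_pow2 pw.
by apply: fpt_le (@fpt_par C (fun p => (f p).+1)) => i di; apply: fb.
Qed.

Lemma bound_M i (t : node (D i)) : dom i -> (2 ^ (#|boundary t| * #|boundary t|)).+1 <= M i.
Proof. by move=> di; rewrite ltnS leq_exp2l // leq_mul // bound. Qed.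

Let NC := elt_ctx N.

Lemma comp_bag : computable (fun q : NC => enc_set (bag (tagged q))).
Proof.
apply: (comp_lookup (fin_weak _ _ fN) (v := fun q t => enc_set (bag t)) (x := fun q => tagged q)).
  exact: (comp_weak _ _ cbag).
exact: comp_var.
Qed.

Lemma comp_boundary : computable (fun q : NC => enc_set (boundary (tagged q))).
Proof. apply: (comp_setD (fin_weak _ _ fG)) comp_bag _; exact: (comp_weak _ _ cbase). Qed.

Lemma comp_leaf_node : computable (fun q : NC => enc_bool (leaf_node (tagged q))).
Proof.
apply: (comp_forall (fin_weak _ _ fN) (b := fun q s => parent s != Some (tagged q))).
apply: comp_negb.
apply: (comp_rel (fin_weak _ _ (fin_weak _ _ fN)) (r := fun q => @up _ (D (tag (tag q))))
  (x := fun q => tagged q) (y := fun q => tagged (tag q))).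
- exact: (comp_weak _ _ (comp_weak _ _ cup)).
- exact: comp_var.
exact: (comp_weak _ _ (comp_var _ _)).
Qed.

Lemma param_boundary : param_bounded (fun q : NC => #|boundary (tagged q)|).
Proof. by have [f fb] := pw; exists f => -[i t] [di _]; apply: leq_trans (bound di t) (fb _ di). Qed.

Lemma comp_step (F : forall i, N i -> {set G i} * seq {set G i}) :
  computable (fun i => tab (fun t => enc_state (F i t))) ->
  (forall i, dom i -> forall t, size (F i t).2 <= M i) ->
  computable (fun i => tab (fun t => enc_state (step cv (b i) solve (F i) t))).
Proof.
move=> cF sF; apply: (comp_tab fN (v := fun i t => enc_state (step cv (b i) solve (F i) t))).
have fG1 : fin (fun q : NC => vert (G (tag q))) by exact: (fin_weak _ _ fG).
have cG1 : computable (fun q : NC => enc_graph (G (tag q))) by exact: (comp_weak _ _ cG).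
pose isleaf (q : NC) := leaf_node (tagged q).
pose X (q : NC) : {set G (tag q)} := boundary (tagged q).
pose z (q : NC) : {set G (tag q)} * seq {set G (tag q)} := (bag (tagged q), base_family (X q)).
pose g (q : NC) (c : N (tag q)) (a : {set G (tag q)} * seq {set G (tag q)}) :=
  if up c (tagged q) then merge_states cv (X q) a (F _ c) else a.
have cleaf : computable (fun q : @restrict NC (fun q => isleaf q) =>
    enc_state (bag (tagged q), leaf_family cv (b (tag q)) solve (X q) (bag (tagged q)))).
  have cb1 : computable (fun q : NC => enc_nat (b (tag q))) by exact: (comp_weak _ _ cb).
  have pb1 : param_bounded (fun q : NC => b (tag q)) by exact: (param_bounded_weak _ _ pb).
  apply: comp_node; first exact: (comp_restrict _ comp_bag).
  apply: (comp_leaf_family (X := X : forall q : @restrict NC (fun q => isleaf q), {set G (tag q)})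
    (fin_restrict _ fG1) (comp_restrict _ cG1)
    (comp_restrict _ comp_boundary) _ famH solveC (comp_restrict _ comp_bag) (comp_restrict _ cb1)).
  - exact: (@param_bounded_restrict NC _ _ param_boundary).
  - exact: (@param_bounded_restrict NC _ _ pb1).
  move=> [i t] [[di _] leaft]; split; [exact: b_gt0|exact: subsetDl|].
  have [_ _ _ _ HD] := treeD di; have := HD t leaft.
  congr (H (induced _)); apply/setP => v; rewrite !inE /= negb_and negbK.
  by case: (v \in bag t); rewrite ?andbT ?orbF ?andbF.
have cz : computable (fun q : NC => enc_state (z q)).
  exact: comp_node comp_bag (comp_base_family fG1 comp_boundary param_boundary).
have fN1 : fin (fun q : NC => N (tag q)) by exact: (fin_weak _ _ fN).
have cfold : computable (fun q : NC => enc_state (foldr (g q) (z q) (enum (N (tag q))))).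
  apply: (comp_foldr (s := fun q : NC => enum (N (tag q))) (ea := fun q c => enc1 c)
    (ej := fun q a => enc_state a) (fpt_enum fN1) fN1.2 cz).
  set K := foldr_ctx _ _ _ _ _.
  have fG2 : fin (fun p : K => vert (G (tag (tag p)))) by exact: (fin_weak _ _ fG1).
  have cG2 : computable (fun p : K => enc_graph (G (tag (tag p)))) by exact: (comp_weak _ _ cG1).
  have fN2 : fin (fun p : K => N (tag (tag p))) by exact: (fin_weak _ _ fN1).
  have cc : computable (fun p : K => enc1 (tagged p).1).
    exact: comp_fst (comp_fst (comp_inp K)).
  have ca : computable (fun p : K => enc_state (tagged p).2) by exact: comp_foldr_acc.
  have ct : computable (fun p : K => enc1 (tagged (tag p))).
    exact: (comp_weak _ _ (comp_var _ _)).
  have cF2 : computable (fun p : K => enc_state (F (tag (tag p)) (tagged p).1)).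
    apply: (comp_lookup fN2 (v := fun p t => enc_state (F (tag (tag p)) t)) _ cc).
    exact: (comp_weak _ _ (comp_weak _ _ cF)).
  have cX2 : computable (fun p : K => enc_set (X (tag p))) by exact: (comp_weak _ _ comp_boundary).
  have pX2 : param_bounded (fun p : K => #|X (tag p)|).
    exact: (param_bounded_weak _ _ param_boundary).
  have fM2 : fpt (fun p : K => M (tag (tag p))) by exact: (fpt_weak _ _ (fpt_weak _ _ fpt_M)).
  have fa : fpt (fun p : K => size (tagged p).2.2).
    apply: fpt_le fM2 => -[[i t] [c a]] [[di _] /= [s1 [s2 [_ ->]]]].
    elim: s2 => [|c' s2 IH] /=.
      rewrite /base_family size_map size_subsets cardsX.
      by apply: leq_trans (bound_M t di).
    rewrite /g; case: ifP => // _; rewrite size_reduce; exact: (bound_M t di).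
  have fF : fpt (fun p : K => size (F (tag (tag p)) (tagged p).1).2).
    by apply: fpt_le fM2 => -[[i t] [c a]] [[di _] _] /=; apply: sF.
  have cm := comp_merge cv fG2 cG2 pX2 cX2 fa fF ca cF2.
  have cu : computable (fun p : K => enc_bool (up (tagged p).1 (tagged (tag p)))).
    apply: (comp_rel fN2 (r := fun p => @up _ (D (tag (tag p)))) _ cc ct).
    exact: (comp_weak _ _ (comp_weak _ _ cup)).
  have := comp_if cu (comp_restrict _ cm) (comp_restrict _ ca).
  by apply: comp_eq => p _; rewrite /g; case: ifP.
have := @comp_if NC isleaf _ _ comp_leaf_node cleaf (comp_restrict _ cfold).
by apply: comp_eq => -[i t] _; rewrite /step /isleaf /=; case: ifP.
Qed.

End ComputeStep.

Section ComputeDP.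
Variables (H : sgraph -> Prop) (cv : bool).
Variable solve : forall Gamma : sgraph, {set Gamma} -> nat -> {set Gamma}.
Hypotheses (famH : graph_family H) (solveC : solver_computable H cv solve).
Variables (C : ctx) (G : C -> sgraph) (D : forall i, decomposition (G i)).
Variables (b w : C -> nat).
Arguments D : clear implicits.
Hypothesis data : dp_data H D b w.

Let N i : finType := node (D i).

Lemma comp_dp : computable (fun i => tab (fun t => enc_state (dp (D := D i) cv (b i) solve t))).
Proof.
have fN := dp_node_fin data; have [f _] := fN.
have cn : computable (fun i => enc_nat #|N i|).
  by apply: comp_eq (comp_size (fpt_enum fN) fN.2) => i _; rewrite -cardE.
have Hit := @comp_iter C (fun i => #|N i|) (fun i => N i -> {set G i} * seq {set G i})%type
  (fun i F => tab (fun t => enc_state (F t)))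
  (fun i => step cv (b i) solve) (fun i => fun=> (set0, [::])) f cn.
apply: Hit.
  apply: (comp_tab fN (v := fun i t => enc_state (set0, [::]))).
  exact: comp_node (comp_set0 (fin_weak _ _ (dp_graph_fin data))) (comp_leaf _).
set K := extend _ _.
have dK : @dp_data H K (fun p => G (tag p)) (fun p => D (tag p)) (fun p => b (tag p))
    (fun p => w (tag p)) by exact: dp_data_weak data.
pose F (p : K) : N (tag p) -> ({set G (tag p)} * seq {set G (tag p)})%type := tagged p.
apply: (comp_step famH solveC dK (F := F)).
  exact: comp_var.
(* The context remembers that [F'] is an actual iterate; this bounds the sizes of its families. *)
rewrite /F => -[i F'] [di /= [r _ ->]] t; apply: leq_trans (size_families _ _ _ _ _) _.
exact: (bound_M data t di).
Qed.

Lemma comp_answer :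
  computable (fun i => enc_set (answer cv (D i) (b i) solve)).
Proof.
have fN := dp_node_fin data; have fG := dp_graph_fin data; have cdp := comp_dp.
have size_dp i (t : N i) : dom i -> size (dp (D := D i) cv (b i) solve t).2 <= (2 ^ (w i * w i)).+1.
  move=> di; apply: leq_trans (size_families _ _ _ _ _) _; exact: (bound_M data t di).
have size_flat i (s : seq (N i)) : dom i ->
    size (flatten [seq (dp (D := D i) cv (b i) solve t).2 | t <- s]) <= size s * (2 ^ (w i * w i)).+1.
  by move=> di; elim: s => //= t s IH; rewrite size_cat mulSn leq_add // size_dp.
have cflat : computable (fun i => enc_family
    (flatten [seq (dp (D := D i) cv (b i) solve t).2 | t <- enum (N i)])).
  have Hf := @comp_foldr C (fun i => N i) (fun i => seq {set G i}) (fun i => enum (N i))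
    (fun i t => enc_state (dp (D := D i) cv (b i) solve t)) (fun i L => enc_family L)
    (fun i t L => (dp (D := D i) cv (b i) solve t).2 ++ L) (fun=> [::])
    (fpt_enum fN) cdp (comp_leaf _).
  apply: (comp_eq _ (Hf _)).
    by move=> i _; congr enc_family; elim: (enum _) => //= t L ->.
  set K := foldr_ctx _ _ _ _ _.
  have ca : computable (fun p : K => enc_family (tagged p).2) by exact: comp_foldr_acc.
  have cs : computable (fun p : K => enc_state (dp (D := D (tag p)) cv (b (tag p)) solve (tagged p).1)).
    exact: comp_fst (comp_fst (comp_inp K)).
  apply: (comp_catF _ (comp_snd cs) ca).
  apply: fpt_le (fpt_weak _ _ (fpt_M data)) => -[i [t L]] [di _]; exact: size_dp.
apply: (comp_smallest fG _ cflat (p := fun i => solvesb cv (@adj (G i)) setT)).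
  apply: fpt_le (fpt_mul (fpt_enum fN) (fpt_M data)) => i di; exact: size_flat.
set K := set_ctx _.
have fG1 : fin (fun q : K => vert (G (tag q))) by exact: (fin_weak _ _ fG).
have cG1 : computable (fun q : K => enc_rel (@adj (G (tag q)))).
  exact: (comp_weak _ _ (dp_graph data)).
exact: (comp_solvesb fG1 cG1 (comp_setT fG1) (comp_var _ _)).
Qed.

End ComputeDP.

Import Order.TTheory GRing.Theory Num.Theory.

(** * From modulators to tree decompositions *)

Lemma optimal_exists (Pi : vertex_subset_problem) (G : sgraph) (S : {set G}) :
  Pi G S -> exists S' : {set G}, optimal Pi S'.
Proof.
move: {2}#|S| (leqnn #|S|) => n; elim: n S => [|n IH] S leS PS.
  by exists S; split=> // S' _; apply: leq_trans leS _.
have [[S' [PS' ltS]]|noS] := classic (exists S', Pi G S' /\ #|S'| < #|S|).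
  by apply: IH PS'; rewrite -ltnS; apply: leq_trans ltS leS.
exists S; split=> // S' PS'; rewrite leqNgt; apply/negP => ltS; apply: noS.
by exists S'.
Qed.

Definition unit_frac (n : nat) : rat := (n%:R^-1)%R.

Lemma unit_frac_gt0 n : 0 < n -> (0 < unit_frac n)%R.
Proof. by move=> n0; rewrite invr_gt0 ltr0n. Qed.

(** The fraction is in lowest terms, so a program can write this accuracy down from [n] in unary
    without any arithmetic. *)
Lemma enc_unit_frac n : 0 < n -> enc_rat (unit_frac n) = VNode (enc_nat 1) (enc_nat n).
Proof.
move=> n0; have n0' : (Posz n != 0)%R by rewrite eqz_nat -lt0n.
have cop : coprime `|1%R : int|%N `|Posz n|%N by rewrite coprime1n.
have fE : unit_frac n = ((1 : int)%:~R / (Posz n)%:~R)%R by rewrite mul1r.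
rewrite /enc_rat fE coprimeq_num // coprimeq_den // (negPf n0') gtr0_sg ?ltz_nat //.
Qed.

Lemma le_unit_frac (n p q : nat) : 0 < n ->
  (p%:R <= (1 + unit_frac n) * q%:R)%R -> n * p <= n.+1 * q.
Proof.
move=> n0 le_pq; have n0' : (0 < n%:R :> rat)%R by rewrite ltr0n.
have := le_pq; rewrite -(ler_pM2l n0') mulrA mulrDr mulr1 /unit_frac divff ?gt_eqF //.
by rewrite natr1 -!natrM ler_nat.
Qed.

(** A positive rational is at least one over its denominator; hence the denominator of [eps] serves
    as [b]. *)
Lemma le_one_plus (eps : rat) (p q : nat) : (0 < eps)%R ->
  `|denq eps|%N * p <= `|denq eps|%N.+1 * q -> (p%:R <= (1 + eps) * q%:R)%R.
Proof.
move=> eps0 le_pq; set d := `|denq eps|%N in le_pq.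
have d0 : (0 < d%:R :> rat)%R by rewrite ltr0n absz_gt0 denq_neq0.
have dE : (d%:R = (denq eps)%:~R :> rat)%R.
  by rewrite -[in RHS](gtz0_abs (denq_gt0 eps)).
rewrite -(ler_pM2l d0) mulrA mulrDr mulr1 dE [X in (_ + X)%R]mulrC -numqE -dE.
apply: (@le_trans _ _ ((d.+1)%:R * q%:R)%R); first by rewrite -!natrM ler_nat.
rewrite ler_wpM2r ?ler0n // -natr1 lerD2l -[1%R]/(1%:~R)%R ler_int -gtz0_ge1.
by rewrite numq_gt0.
Qed.

Section Solver.
Variables (H : sgraph -> Prop) (cv : bool) (t : term) (f : nat -> rat -> nat) (c : nat).
Hypothesis schemeP : forall (G : sgraph) (W : {set G}) (eps : rat),
  is_modulator H W -> (0 < eps)%R ->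
  exists (out : value) (time : nat),
    [/\ runs t (VNode (enc_rat eps) (VNode (enc_graph G) (enc_set W))) out time,
        time <= f #|W| eps * (#|G| + 0).+1 ^ c &
        forall Sopt : {set G}, optimal (problem cv) Sopt ->
          exists S : {set G}, [/\ out = enc_set S, problem cv S &
            (#|S|%:R <= (1 + eps) * #|Sopt|%:R)%R]].

Definition scheme_output (G : sgraph) (W : {set G}) (n : nat) (S : {set G}) : Prop :=
  [/\ exists2 k, k <= f #|W| (unit_frac n) * (#|G| + 0).+1 ^ c &
        runs t (VNode (enc_rat (unit_frac n)) (VNode (enc_graph G) (enc_set W))) (enc_set S) k,
      problem cv S &
      forall S' : {set G}, problem cv S' -> n * #|S| <= n.+1 * #|S'|].

(** The scheme only asserts that an output exists. Choice fixes one that comes with its run, so the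
    same set serves for correctness and for running time. *)
Definition scheme_solve (G : sgraph) (W : {set G}) (n : nat) : {set G} :=
  epsilon (inhabits set0) (scheme_output W n).

Lemma scheme_solveP (G : sgraph) (W : {set G}) (n : nat) :
  0 < n -> is_modulator H W -> (exists S : {set G}, problem cv S) ->
  scheme_output W n (scheme_solve W n).
Proof.
move=> n0 HW [S0 solS0]; apply: epsilon_spec.
have [So optS] := optimal_exists solS0.
have [out [k [run le_k outP]]] := schemeP HW (unit_frac_gt0 n0).
have [S [outE solS leS]] := outP So optS; exists S; split=> //.
  by exists k; rewrite -?outE.
move=> S' solS'; apply: leq_trans (le_unit_frac n0 leS) _.
by rewrite leq_mul2l; apply/orP; right; apply: optS.2.
Qed.

Lemma scheme_solver_computable : solver_computable H cv scheme_solve.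
Proof.
move=> C Gamma W n cG cW cn [fW pW] [fn pn] fG valid.
pose b (i : C) := f #|W i| (unit_frac (n i)) * (#|Gamma i| + 0).+1 ^ c.
have fb : fpt b.
  apply: fpt_mul; last first.
    apply: fpt_exp; apply: fpt_le (fpt_add fG (@fpt_const C 1)) => i _.
    by rewrite addn0 addn1.
  (* The function [f] need not be monotone; the sum over all arguments up to the bounds dominates
     the value attained. *)
  exists (fun p => \sum_(j < (fW p).+1) \sum_(m < (fn p).+1) f j (unit_frac m)), 0.
  move=> i di; rewrite expn0 muln1.
  have lW : #|W i| < (fW (par i)).+1 by rewrite ltnS pW.
  have ln : n i < (fn (par i)).+1 by rewrite ltnS pn.
  rewrite (bigD1 (Ordinal lW)) //= (bigD1 (Ordinal ln)) //= -!addnA.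
  exact: leq_addr.
apply: (comp_call (t := t) (b := b)
  (a := fun i => VNode (enc_rat (unit_frac (n i))) (VNode (enc_graph (Gamma i)) (enc_set (W i))))) => //.
- apply: comp_node; last exact: comp_node.
  have c1 : computable (fun i : C => enc_nat 1) by apply: comp_succ; apply: comp_leaf.
  by apply: comp_eq (comp_node c1 cn) => i /valid[n0 _ _]; rewrite enc_unit_frac.
- by move=> i v _; apply: val_sub_set.
move=> i /valid[n0 HW solG]; have [[k le_k run] _ _] := scheme_solveP n0 HW solG.
by exists k.
Qed.

End Solver.

(** * Instances of a scheme and transfer between parameters *)

Definition instance_ctx (P : graph_parameter) : ctx :=
  @Ctx {G : sgraph & (witness P G * rat)%type}
    (fun i => valid (tagged i).1 /\ (0 < (tagged i).2)%R)
    (fun i => VNode (enc_rat (tagged i).2)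
                (VNode (enc_graph (tag i)) (enc_witness (tagged i).1)))
    (fun i => (measure (tagged i).1, (tagged i).2))
    (fun i => #|tag i| + witness_size (tagged i).1).

Section Instances.
Variables (Pi : vertex_subset_problem) (P : graph_parameter).
Arguments Pi : clear implicits.
Let K := instance_ctx P.

Lemma scheme_of_computable (S : forall i : K, {set tag i}) :
  computable (fun i : K => enc_set (S i)) ->
  (forall (i : K) (Sopt : {set tag i}), dom i -> optimal Pi Sopt ->
     Pi (tag i) (S i) /\ (#|S i|%:R <= (1 + (tagged i).2) * #|Sopt|%:R)%R) ->
  FPT_AS Pi P.
Proof.
move=> [t [b [[f [c fb]] ev]]] SP.
exists t, (fun k e => f (k, e)), c => G w eps vw eps0.
pose i : K := existT _ G (w, eps); have di : @dom K i by [].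
have [k kb run] := ev i [::] di; exists (enc_set (S i)), k; split=> //.
  exact: leq_trans kb (fb i di).
by move=> Sopt /(SP i _ di)[]; exists (S i).
Qed.

Lemma comp_eps : computable (fun i : K => enc_rat (tagged i).2).
Proof. exact: comp_fst (comp_inp K). Qed.

Lemma comp_instance_graph : computable (fun i : K => enc_graph (tag i)).
Proof. exact: comp_fst (comp_snd (comp_inp K)). Qed.

Lemma comp_witness : computable (fun i : K => enc_witness (tagged i).1).
Proof. exact: comp_snd (comp_snd (comp_inp K)). Qed.

Lemma fpt_vertices : fpt (fun i : K => #|tag i|).
Proof. by apply: fpt_le (@fpt_len K) => i _; apply: leq_addr. Qed.

Lemma fpt_witness_size : fpt (fun i : K => witness_size (tagged i).1).
Proof. by apply: fpt_le (@fpt_len K) => i _; apply: leq_addl. Qed.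

Lemma fin_instance : fin (fun i : K => vert (tag i)).
Proof. exact: fin_graph fpt_vertices comp_instance_graph. Qed.

(** The program converts the witness and runs the scheme for [Q]. The run is handled directly, as on
    infeasible instances the output may be a closure that differs in the longer environment; only
    its time matters there. *)
Lemma scheme_transfer (Q : graph_parameter)
    (g : forall G, witness P G -> witness Q G) (h : nat -> nat) :
  computable (fun i : K => enc_witness (g (tag i) (tagged i).1)) ->
  (forall G (w : witness P G), valid w -> valid (g G w) /\ measure (g G w) <= h (measure w)) ->
  fpt (fun i : K => witness_size (g (tag i) (tagged i).1)) ->
  FPT_AS Pi Q -> FPT_AS Pi P.
Proof.
move=> cg gP fg [t [f [c tP]]].
have [u [b [[fb [cb le_b]] ev]]] := comp_node comp_eps (comp_node comp_instance_graph cg).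
pose time (i : K) := f (measure (g (tag i) (tagged i).1)) (tagged i).2 *
  (#|tag i| + witness_size (g (tag i) (tagged i).1)).+1 ^ c.
have ftime : fpt time.
  apply: fpt_mul; last first.
    apply: fpt_exp; apply: fpt_le (fpt_add (fpt_add fpt_vertices fg) (@fpt_const K 1)) => i _.
    by rewrite addn1.
  exists (fun p => \sum_(j < (h p.1).+1) f j p.2), 0 => i [vi _]; rewrite expn0 muln1.
  have lt_h : measure (g (tag i) (tagged i).1) < (h (measure (tagged i).1)).+1.
    by rewrite ltnS; apply: (gP _ _ vi).2.
  by rewrite /= (bigD1 (Ordinal lt_h)) //= leq_addr.
have [F [d Fd]] : fpt (fun i => b i + time i + 2).
  by apply: fpt_add (@fpt_const K 2); apply: fpt_add ftime; exists fb, cb.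
exists (tapp (tfix t) u), (fun k e => F (k, e)), d => G w eps vw eps0.
pose i : K := existT _ G (w, eps); have di : @dom K i by [].
have [out [k [run le_k outP]]] := tP G (g G w) eps (gP G w vw).1 eps0.
have [l le_l evl] := ev i [::] di.
have [out' run' sub] := runs_env (VClosure [:: inp i] t :: [:: inp i]) run.
have [m le_m evm] : eval_le [:: inp i] (tapp (tfix t) u) out' (l + k).+2.
  exact: (eval_le_let (ex_intro2 _ _ l (leqnn l) evl) (ex_intro2 _ _ k (leqnn k) run')).
exists out', m; split=> //.
  by apply: leq_trans le_m (leq_trans _ (Fd i di)); rewrite addn2 !ltnS leq_add.
move=> Sopt /outP[S [outE PS leS]]; exists S; split=> //.
by apply: val_sub_set; rewrite -outE.
Qed.

End Instances.

(** * Decoding a decomposition *)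

(** The encoding of an optional element is literally this unary number. It serves as a position in
    the list of singleton vectors preceded by the empty one, which decodes the parent pointers. *)
Definition option_rank (T : finType) (o : option T) : nat :=
  if o is Some x then (index x (enum T)).+1 else 0.

Lemma enc_option_rank (T : finType) (o : option T) :
  enc_option_elt o = enc_nat (option_rank o).
Proof. by case: o. Qed.

Lemma option_rank_le (T : finType) (o : option T) : option_rank o <= #|T|.
Proof. by case: o => //= x; rewrite cardE index_mem mem_enum. Qed.

Lemma nth_option_rank (T : finType) (o : option T) :
  nth VLeaf (enc_set (set0 : {set T}) :: [seq enc1 x | x <- enum T]) (option_rank o) =
  enc_set [set x | o == Some x].
Proof.
case: o => [x|] /=; last by congr enc_set; apply/setP => x; rewrite !inE.
rewrite (nth_map x) ?index_mem ?mem_enum // nth_index ?mem_enum //.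
by congr enc_set; apply/setP => y; rewrite !inE eq_sym.
Qed.

Section Decode.
Variables (C : ctx) (G : C -> sgraph) (D : forall i, decomposition (G i)).
Arguments D : clear implicits.
Hypothesis fN : fpt (fun i => #|node (D i)|).
Hypothesis cD : computable (fun i => enc_decomposition (D i)).

Lemma comp_parents : computable (fun i => tab (fun t : node (D i) => enc_option_elt (parent t))).
Proof. exact: comp_fst cD. Qed.

Lemma comp_bags : computable (fun i => tab (fun t : node (D i) => enc_set (bag t))).
Proof. exact: comp_fst (comp_snd cD). Qed.

Lemma comp_base : computable (fun i => enc_set (base (D i))).
Proof. exact: comp_snd (comp_snd cD). Qed.

Lemma fin_nodes : fin (fun i => node (D i)).
Proof. exact: fin_tab fN comp_parents. Qed.

Lemma comp_up : computable (fun i => enc_rel (@up _ (D i))).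
Proof.
apply: (comp_tab fin_nodes (v := fun i t => enc_set [set s | up t s])).
set K := elt_ctx _.
have f1 : fin (fun q : K => node (D (tag q))) by exact: (fin_weak _ _ fin_nodes).
have cp : computable (fun q : K => enc_nat (option_rank (parent (tagged q)))).
  have c1 : computable (fun q : K => enc_option_elt (parent (tagged q))).
    apply: (comp_lookup f1 (v := fun q t => enc_option_elt (parent t)) (x := fun q => tagged q)).
      exact: (comp_weak _ _ comp_parents).
    exact: comp_var.
  by apply: comp_eq c1 => q _; rewrite enc_option_rank.
have fp : fpt (fun q : K => option_rank (parent (tagged q))).
  by have [f _] := f1; apply: fpt_le f => q _; apply: option_rank_le.
have cs : computable (fun q : K => enc_seq (enc_set (set0 : {set node (D (tag q))}) ::
    [seq enc1 x | x <- enum (node (D (tag q)))])).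
  exact: comp_node (comp_set0 f1) f1.2.
apply: (comp_eq _ (comp_nth fp cp cs)) => q _.
exact: nth_option_rank.
Qed.

End Decode.

(** * Modulators versus tree decompositions *)

Lemma tw_scheme_of_mod (H : sgraph -> Prop) cv : graph_family H ->
  FPT_AS (problem cv) (mod_param H) -> FPT_AS (problem cv) (tw_param H).
Proof.
move=> famH [t [f [c schemeP]]].
pose solve := scheme_solve cv t f c.
have solveC : solver_computable H cv solve.
  by apply: scheme_solver_computable => G W eps; apply: schemeP.
pose K := instance_ctx (tw_param H).
pose b (i : K) := `|denq (tagged i).2|%N.
have fN : fpt (fun i : K => #|node (tagged i).1|) by exact: fpt_witness_size.
have cD : computable (fun i : K => enc_decomposition (tagged i).1) by exact: comp_witness.
have data : @dp_data H K (fun i => tag i) (fun i => (tagged i).1) b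
    (fun i => (width (tagged i).1).+1).
  split.
  - exact: fin_instance.
  - exact: comp_instance_graph.
  - exact: fin_nodes fN cD.
  - exact: comp_up fN cD.
  - exact: comp_bags cD.
  - exact: comp_base cD.
  - exact: comp_snd (comp_eps _).
  - by exists (fun p => `|denq p.2|%N).
  - by exists (fun p => p.1.+1).
  - by move=> i _; rewrite absz_gt0 denq_neq0.
  - by move=> i [].
  (* [width] is a truncated predecessor, so its successor bounds every boundary, even when the width
     is 0. *)
  move=> i _ s; apply: leq_trans (leqSpred _).
  exact: (leq_bigmax (F := fun s => #|bag s :\: base (tagged i).1|)).
apply: (scheme_of_computable (comp_answer famH solveC data)) => i Sopt [vi eps0] [solS _].
have b0 : 0 < b i by rewrite absz_gt0 denq_neq0.
have gadgetP (s : node (tagged i).1) (E : {set tag i * tag i}) (S : {set gadget E (bag s)}) :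
    leaf_node s -> E \subset setX (boundary s) (boundary s) -> problem cv S ->
    let Q := solve _ (gadget_modulator E (bag s) (boundary s)) (b i * #|boundary s|.+1) in
    problem cv Q /\ b i * #|boundary s|.+1 * #|Q| <= (b i * #|boundary s|.+1).+1 * #|S|.
  move=> leafs EX solG Q.
  have HW : is_modulator H (gadget_modulator E (bag s) (boundary s)).
    apply: modulator_valid => //; first exact: subsetDl.
    have [_ _ _ _ HD] := vi; have := HD s leafs.
    congr (H (induced _)); apply/setP => v; rewrite !inE /= negb_and negbK.
    by case: (v \in bag s); rewrite ?andbT ?orbF ?andbF.
  have n0 : 0 < b i * #|boundary s|.+1 by rewrite muln_gt0 b0.
  have [_ solQ leQ] := scheme_solveP schemeP n0 HW (ex_intro _ S solG).
  by split=> //; apply: leQ.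
have [solA leA] := answerP b0 vi gadgetP solS; split=> //.
apply: le_one_plus => //; apply: leq_trans leA _.
by rewrite mulSn addnC leq_add2r subset_leq_card // subsetIl.
Qed.

(** * Elimination decompositions versus tree decompositions *)

Section ToTree.
Variables (G : sgraph) (D : decomposition G).

(* The forest gets a new root, and every bag absorbs the bags above it. *)
Definition tree_parent (o : option (node D)) : option (option (node D)) :=
  if o is Some t then Some (parent t) else None.

Definition path_bag (t : node D) : {set G} :=
  [set v | [exists s, ancestor s t && (v \in bag s)]].

Definition to_tree : decomposition G :=
  @Decomposition G (option (node D)) tree_parent
    (fun o => if o is Some t then path_bag t else set0) (base D).

Variable H : sgraph -> Prop.
Hypothesis H0 : H (induced (set0 : {set G})).
Hypothesis elimD : is_elimination_decomposition H D.

Let forestD : rooted_forest D. Proof. by case: elimD. Qed.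

Lemma path_bagP v t : reflect (exists2 s : node D, ancestor s t & v \in bag s) (v \in path_bag t).
Proof.
by rewrite inE; apply: (iffP existsP) => [[s /andP[]]|[s st vs]]; exists s => //; apply/andP.
Qed.

Lemma to_tree_up (t s : node D) :
  ancestor s t -> connect (@up _ to_tree) (Some t) (Some s).
Proof.
move=> st.
apply: (@connect_elim _ (@up _ D) (fun u => connect (@up _ to_tree) (Some t) (Some u)) t s _ _ st).
  exact: connect0.
move=> u v _ cu /eqP uv; apply: connect_trans cu (connect1 _).
by rewrite /up /= uv.
Qed.

Lemma leaf_ancestor (a t : node D) : leaf_node a -> ancestor a t -> t = a.
Proof.
move=> leafa at_; have [//|ta] := eqVneq t a.
have [c ca _] := ancestor_child at_ ta; have := forallP leafa c.
by rewrite -/(up c a) ca.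
Qed.

Lemma base_leaf v (t : node D) : v \in base D -> v \in bag t -> leaf_node t.
Proof.
case: elimD => _ _ part [_ baseL] _ vL vt.
have [s [[leafs vs] _]] := baseL v vL; have [u [vu uniq_u]] := part v.
by rewrite -(uniq_u _ vt) (uniq_u _ vs).
Qed.

Lemma bag_unique v (s t : node D) : v \in bag s -> v \in bag t -> s = t.
Proof.
by case: elimD => _ _ part _ _ vs vt; have [u [_ uu]] := part v; rewrite -(uu _ vs) (uu _ vt).
Qed.

Lemma leaf_path_bag (t : node D) : leaf_node t -> path_bag t :&: base D = bag t.
Proof.
move=> leaft; have [_ _ _ [leafP _] _] := elimD; have [tL _] := leafP t leaft.
apply/setP => v; rewrite inE; apply/andP/idP => [[/path_bagP[s st vs] vL]|vt].
  by rewrite (leaf_ancestor (base_leaf vL vs) st).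
split; last exact: (subsetP tL).
by apply/path_bagP; exists t => //; apply: connect0.
Qed.

Lemma to_tree_leaf (t : node D) : leaf_node t -> @leaf_node _ to_tree (Some t).
Proof.
move=> /forallP leaft; apply/forallP => -[s|] //=.
by apply: contra (leaft s) => /eqP[->].
Qed.

Lemma to_tree_leaf_inv (t : node D) : @leaf_node _ to_tree (Some t) -> leaf_node t.
Proof.
move=> /forallP leaft; apply/forallP => s; apply: contra (leaft (Some s)) => /eqP st.
by rewrite /= st.
Qed.

(** A vertex of the bag of [t] now occurs exactly at the descendants of [t], which are connected
    through [t]; for a base vertex [t] is a leaf, so this is one node. If the forest is empty, the
    added root is itself a leaf with empty bag, hence [H0]. *)
Lemma to_tree_valid : is_tree_decomposition H to_tree.
Proof.
have [_ intP part [leafP baseL] edgeP] := elimD; split.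
- split; last by exists None; split=> // -[t|].
  have up_root (t : node D) : connect (@up _ to_tree) (Some t) None.
    have [r /eqP rr rt] := forestD t.
    by apply: connect_trans (to_tree_up rt) (connect1 _); rewrite /up /= rr.
  by case=> [t|]; exists None => //; [apply: up_root|apply: connect0].
- move=> v; have [t [vt uniq_t]] := part v; split.
    by exists (Some t); apply/path_bagP; exists t => //; apply: connect0.
  have bagE (s : node D) : (v \in path_bag s) = ancestor t s.
    apply/path_bagP/idP => [[a as_ va]|ts]; first by rewrite (uniq_t a va).
    by exists t.
  pose r := restr (@tree_adj _ to_tree) [set o | v \in @bag _ to_tree o].
  have r_sym : connect_sym r.
    by apply: sym_connect_sym; apply: restr_sym => x y; rewrite /tree_adj orbC.
  have to_t (s : node D) : ancestor t s -> connect r (Some s) (Some t).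
    case/connectP=> p; elim: p s => [|z p IH] s /=; first by move=> _ ->; apply: connect0.
    case/andP=> sz pz tE; apply: connect_trans (IH z pz tE); apply: connect1.
    have tz : ancestor t z by apply/connectP; exists p.
    have ts : ancestor t s by apply: (@connect_trans _ (@up _ D) z) => //; apply: connect1.
    apply/and3P; split; try by rewrite inE /= bagE.
    by rewrite /tree_adj /up /=; move: sz => /eqP ->; rewrite eqxx.
  have notN : (None \in [set o | v \in @bag _ to_tree o]) = false by rewrite inE /= in_set0.
  case=> [x|] [y|]; rewrite ?notN // inE /= bagE => tx; rewrite inE /= bagE => ty.
  by apply: (@connect_trans _ r (Some t)); [apply: to_t|rewrite r_sym; apply: to_t].
- move=> u v uv; have [s [us _]] := part u; have [t [vt _]] := part v.
  have in_path (a d : node D) x : ancestor a d -> x \in bag a -> x \in path_bag d.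
    by move=> ad xa; apply/path_bagP; exists a.
  case/orP: (edgeP u v s t uv us vt) => [st|ts].
    exists (Some t); rewrite /= (in_path s) // (in_path t) //; exact: connect0.
  exists (Some s); rewrite /= (in_path s) ?(in_path t) //; exact: connect0.
- move=> v vL; have [t [[leaft vt] _]] := baseL v vL.
  exists (Some t); first exact: to_tree_leaf.
  case=> [s|] /=; last by rewrite inE.
  apply/path_bagP/eqP => [[a as_ va]|[->]].
    by rewrite (leaf_ancestor _ as_) ?(bag_unique va vt) // -(bag_unique vt va).
  by exists t => //; apply: connect0.
case=> [t /to_tree_leaf_inv leaft|_] /=.
  by rewrite leaf_path_bag //; have [_] := leafP t leaft.
by rewrite set0I.
Qed.

(** Each node on the way to the root contributes at most one vertex outside the base: internal bags
    have at most one vertex and leaf bags lie in the base. Width and depth are predecessors of the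
    two maxima compared. *)
Lemma to_tree_width : width to_tree <= depth D.
Proof.
have [_ intP _ [leafP _] _] := elimD.
rewrite /width /depth -!subn1; apply: leq_sub2r; apply/bigmax_leqP => -[t|] _ /=; last first.
  by rewrite set0D cards0.
apply: leq_trans (leq_bigmax (F := fun t => #|[set s | ancestor s t]|) t).
have -> : path_bag t :\: base D = \bigcup_(s in [set s | ancestor s t]) (bag s :\: base D).
  apply/setP => v; rewrite inE; apply/andP/bigcupP => [[vL /path_bagP[s st vs]]|[s]].
    by exists s; rewrite ?inE // vL.
  by rewrite !inE => st /andP[vL vs]; split=> //; apply/existsP; exists s; rewrite st.
have card1 (s : node D) : #|bag s :\: base D| <= 1.
  have [leafs|nleaf] := boolP (leaf_node s); last first.
    have [le1 _] := intP s nleaf; apply: leq_trans le1.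
    by apply: subset_leq_card; apply: subsetDl.
  have [sL _] := leafP s leafs.
  have -> : bag s :\: base D = set0 by apply/eqP; rewrite setD_eq0.
  by rewrite cards0.
apply: leq_trans (_ : \sum_(s in [set s | ancestor s t]) #|bag s :\: base D| <= _).
  elim/big_rec2: _ => [|s n U _ IH]; first by rewrite cards0.
  by apply: leq_trans (leq_card_setU _ _).1 _; rewrite leq_add2l.
by rewrite -sum1_card; apply: leq_sum.
Qed.

End ToTree.

Lemma comp_to_tree C (G : C -> sgraph) (D : forall i, decomposition (G i)) :
  fin (fun i => vert (G i)) -> fpt (fun i => #|node (D i)|) ->
  computable (fun i => enc_decomposition (D i)) ->
  computable (fun i => enc_decomposition (to_tree (D i))).
Proof.
move=> fG fN0 cD; have fN := fin_nodes fN0 cD; have cup := comp_up fN0 cD.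
have cbag := comp_bags cD; have cpar := comp_parents cD.
apply: comp_node; last apply: comp_node; last exact: comp_base cD.
(* The enumeration of [option T] lists [None] first, so the index of a parent moves up by one, which
   is one more cell in unary. *)
- have rankE (T : finType) (o : option T) : enc_option_elt (Some o) = VNode VLeaf (enc_option_elt o).
    rewrite /enc_option_elt enumT unlock /= /option_enum -enumT; case: o => [x|//] /=.
    congr (VNode _ (enc_nat _.+1)); by rewrite index_map //; apply: Some_inj.
  apply: (comp_tab_option (v := fun i (o : option (node (D i))) => enc_option_elt (tree_parent o))).
    exact: comp_leaf.
  have c : computable (fun i => tab (fun t : node (D i) => VNode VLeaf (enc_option_elt (parent t)))).
    apply: (comp_tab fN (v := fun i (t : node (D i)) => VNode VLeaf (enc_option_elt (parent t)))).
    apply: comp_node; first exact: comp_leaf.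
    apply: (comp_lookup (fin_weak _ _ fN) (v := fun q t => enc_option_elt (parent t)) (x := fun q => tagged q)).
      exact: (comp_weak _ _ cpar).
    exact: comp_var.
  by apply: comp_eq c => i _; apply: eq_tab => t; rewrite -rankE.
apply: (comp_tab_option (v := fun i (o : option (node (D i))) => enc_set (@bag _ (to_tree (D i)) o))).
  exact: comp_set0 fG.
apply: (comp_tab fN (v := fun i (t : node (D i)) => enc_set (path_bag t))).
set K := elt_ctx _.
have fGK : fin (fun q : K => vert (G (tag q))) by exact: (fin_weak _ _ fG).
have fNK : fin (fun q : K => node (D (tag q))) by exact: (fin_weak _ _ fN).
have canc : computable (fun q : K => enc_set [set s | ancestor s (tagged q)]).
  have cupK : computable (fun q : K => enc_rel (@up _ (D (tag q)))) by exact: (comp_weak _ _ cup).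
  have ct : computable (fun q : K => enc1 (tagged q)) by exact: comp_var.
  exact: (comp_connect fNK cupK ct).
pose t (q : K) : node (D (tag q)) := tagged q.
apply: (comp_setb fGK (p := fun q v => [exists s, ancestor s (t q) && (v \in bag s)])).
set K2 := elt_ctx _.
have fNK2 : fin (fun q : K2 => node (D (tag (tag q)))) by exact: (fin_weak _ _ fNK).
apply: (comp_exists fNK2 (b := fun q s => ancestor s (t (tag q)) && (tagged q \in bag s))).
set K3 := elt_ctx _.
have fNK3 : fin (fun q : K3 => node (D (tag (tag (tag q))))) by exact: (fin_weak _ _ fNK2).
have fGK3 : fin (fun q : K3 => vert (G (tag (tag (tag q))))).
  exact: (fin_weak _ _ (fin_weak _ _ fGK)).
have cs : computable (fun q : K3 => enc1 (tagged q)) by exact: comp_var.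
have cv : computable (fun q : K3 => enc1 (tagged (tag q))) by exact: (comp_weak _ _ (comp_var _ _)).
apply: comp_andb.
  have canc3 : computable (fun q : K3 => enc_set [set s | ancestor s (t (tag (tag q)))]).
    exact: (comp_weak _ _ (comp_weak _ _ canc)).
  by apply: comp_eq (comp_mem fNK3 cs canc3) => q _; rewrite inE.
apply: (comp_mem fGK3 cv).
apply: (comp_lookup fNK3 (v := fun q s => enc_set (bag s)) _ cs).
exact: (comp_weak _ _ (comp_weak _ _ (comp_weak _ _ cbag))).
Qed.

Lemma empty_in_family (H : sgraph -> Prop) (G0 G : sgraph) :
  graph_family H -> hereditary H -> H G0 -> H (induced (set0 : {set G})).
Proof.
move=> famH herH /(herH _ set0); apply: famH.
have noelt (G' : sgraph) (x : induced (set0 : {set G'})) : False.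
  by have := valP x; rewrite inE.
exists (fun x => False_rect _ (noelt _ x)); last by move=> x; case: (noelt _ x).
by exists (fun x => False_rect _ (noelt _ x)) => x; case: (noelt _ x).
Qed.

Lemma leaf_exists (G : sgraph) (D : decomposition G) (t : node D) :
  rooted_forest D -> exists s : node D, leaf_node s.
Proof.
move=> forestD; have := height_lt_card forestD t.
elim: #|node D| t => //= n IH t ht.
have [leaft|] := boolP (leaf_node t); first by exists t.
by rewrite negb_forall => /existsP[s]; rewrite negbK => /eqP /ht /IH.
Qed.

(** The converted tree needs the empty graph in [H], which holds as soon as [H] contains some graph.
    If it contains none, a valid decomposition has no leaf, hence no node; the graph is then empty
    and so is the solution. *)
Lemma ed_scheme_of_tw (H : sgraph -> Prop) (Pi : vertex_subset_problem) :
  graph_family H -> hereditary H ->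
  FPT_AS Pi (tw_param H) -> FPT_AS Pi (ed_param H).
Proof.
move=> famH herH.
have [[G0 HG0]|noH] := classic (exists G0, H G0).
  apply: (scheme_transfer (g := fun G (D : witness (ed_param H) G) => to_tree D : witness (tw_param H) G)
    (h := id)).
  - apply: comp_to_tree; first exact: fin_instance.
      exact: fpt_witness_size.
    exact: comp_witness.
  - move=> G D vD; have H0 := empty_in_family G famH herH HG0.
    by split; [exact: to_tree_valid H0 vD|exact: to_tree_width vD].
  apply: fpt_le (fpt_add (@fpt_witness_size (ed_param H)) (@fpt_const _ 1)) => i _ /=.
  by rewrite card_option addn1.
move=> _; apply: (scheme_of_computable (S := fun i => set0)).
  exact: comp_set0 (fin_instance _).
move=> i Sopt [vi _] [solS _].
suff S0 : Sopt = set0 by rewrite S0 in solS *; rewrite cards0 mulr0.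
apply/setP => v; exfalso; apply: noH.
have [forestD _ part [leafP _] _] := vi.
have [t _] := part v; have [s leafs] := leaf_exists t forestD.
by exists (induced (bag s)); have [_] := leafP s leafs.
Qed.

(** * Modulators versus elimination decompositions *)

Section ToPath.
Variables (G : sgraph) (S : {set G}).

Definition path_parent (i : 'I_#|S|.+1) : option 'I_#|S|.+1 :=
  if val i is j.+1 then Some (inord j) else None.

(* Vertices outside [S] have index [#|S|], hence lie in the last bag. *)
Definition to_path : decomposition G :=
  @Decomposition G ('I_#|S|.+1 : finType) path_parent
    (fun i => [set x | index x (enum S) == i]) (~: S).

Lemma index_lt x : (index x (enum S) < #|S|) = (x \in S).
Proof. by rewrite cardE index_mem mem_enum. Qed.

Lemma index_le x : index x (enum S) < #|S|.+1.
Proof. by rewrite ltnS cardE index_size. Qed.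

Lemma index_max x : (index x (enum S) == #|S|) = (x \notin S).
Proof. by rewrite -index_lt -leqNgt eqn_leq -ltnS index_le. Qed.

Lemma path_ancestor (i j : node to_path) : (i : 'I__) <= (j : 'I__) -> ancestor i j.
Proof.
move: i j => [i lti] [j ltj] /=; elim: j ltj => [|j IH] ltj.
  by rewrite leqn0 => /eqP i0; subst; rewrite (bool_irrelevance lti ltj); apply: connect0.
rewrite leq_eqVlt => /orP[/eqP ij|]; first by subst; rewrite (bool_irrelevance lti ltj); apply: connect0.
rewrite ltnS => le_ij.
apply: (@connect_trans _ (@up _ to_path) (Ordinal (ltnW ltj))); last exact: IH.
apply: connect1; rewrite /up /= /path_parent /=; apply/eqP; congr Some; apply/val_inj.
by rewrite /= inordK // ltnW.
Qed.

Lemma path_leaf (i : node to_path) : leaf_node i -> i = ord_max.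
Proof.
move=> /forallP leafi; apply/val_inj/eqP; rewrite eqn_leq -ltnS ltn_ord /= leqNgt.
apply/negP => lti; have := leafi (Ordinal (lti : (val i).+1 < #|S|.+1)).
by rewrite /= /path_parent /= inord_val eqxx.
Qed.

Lemma path_leaf_max : @leaf_node _ to_path ord_max.
Proof.
apply/forallP => -[[|j] ltj] //; apply/eqP => -[/(congr1 val)] /=.
by rewrite inordK ?(ltnW ltj) // => jE; rewrite jE ltnn in ltj.
Qed.

(** All nodes lie on one path, so any two are in ancestor relation, and its only leaf carries the
    complement of [S]. *)
Lemma to_path_valid (H : sgraph -> Prop) :
  is_modulator H S -> is_elimination_decomposition H to_path.
Proof.
move=> HS; have bag_max : @bag _ to_path ord_max = ~: S.
  by apply/setP => x; rewrite !inE index_max.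
split.
- move=> i; exists (ord0 : 'I_#|S|.+1) => //; exact: path_ancestor.
- move=> i nleaf; have lti : val i < #|S|.
    rewrite ltn_neqAle -ltnS ltn_ord andbT; apply: contraNneq nleaf => iE.
    by have -> : i = ord_max by [apply/val_inj]; apply: path_leaf_max.
  split.
    apply/card_le1_eqP => x y; rewrite !inE => /eqP xi /eqP yi.
    have xS : x \in enum S by rewrite mem_enum -index_lt xi.
    by rewrite -(nth_index x xS) xi -yi nth_index // mem_enum -index_lt yi.
  rewrite -setI_eq0 -subset0; apply/subsetP => x; rewrite !inE => /andP[/eqP xi].
  rewrite -index_max xi => /eqP iE.
  by have : #|S| < #|S| by [rewrite -{1}iE]; rewrite ltnn.
- move=> v; exists (inord (index v (enum S)) : 'I_#|S|.+1); split.
    by rewrite inE inordK // index_le.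
  by move=> i; rewrite inE => /eqP vi; apply/val_inj; rewrite /= inordK // index_le.
- split=> [i /path_leaf ->|v]; first by rewrite bag_max.
  rewrite inE => vS; exists (ord_max : 'I_#|S|.+1); split.
    by split; [apply: path_leaf_max|rewrite bag_max inE].
  by move=> i [/path_leaf ->].
move=> u v s t _ _ _; apply/orP.
by case/orP: (leq_total s t) => le_st; [left|right]; apply: path_ancestor.
Qed.

Lemma to_path_depth : depth to_path <= #|S|.
Proof.
rewrite /depth -ltnS; apply: leq_trans (_ : (#|S|.+1).-1 < #|S|.+1) => //.
rewrite ltnS -!subn1 leq_sub2r //; apply/bigmax_leqP => i _.
by apply: leq_trans (max_card _) _; rewrite card_ord.
Qed.

(** Node [j] has no parent if [j] is 0 and parent [j - 1] otherwise. With the shift by one in the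
    encoding of optional elements, its entry is the numeral [j] in both cases. *)
Lemma enc_to_path : enc_decomposition to_path =
  VNode (enc_seq [seq enc_nat j | j <- iota 0 #|S|.+1])
   (VNode (enc_seq ([seq enc1 x | x <- enum S] ++ [:: enc_set (~: S)])) (enc_set (~: S))).
Proof.
rewrite /enc_decomposition; congr VNode; last congr VNode.
- rewrite -val_enum_ord -map_comp; congr enc_seq; apply: eq_map => i /=.
  rewrite /path_parent; case: i => -[|j] ltj //=.
  by rewrite index_enum_ord inordK // ltnW.
congr enc_seq; rewrite (eq_map (g := (fun j => enc_set [set x | index x (enum S) == j]) \o val)) //.
rewrite map_comp val_enum_ord -addn1 iotaD map_cat /=; congr cat; last first.
  by congr [:: enc_set _]; apply/setP => x; rewrite !inE add0n index_max.
rewrite cardE; apply: (@eq_from_nth _ VLeaf); first by rewrite !size_map size_iota.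
rewrite size_map size_iota => k ltk; rewrite (nth_map 0) ?size_iota // nth_iota // add0n.
have [x0 _] : exists x, x \in enum S by case: (enum S) ltk => // x l _; exists x; rewrite mem_head.
rewrite (nth_map x0) //; congr enc_set; apply/setP => x; rewrite !inE.
apply/eqP/eqP => [xk|->]; last by rewrite index_uniq // enum_uniq.
by rewrite -xk nth_index // -index_mem xk.
Qed.

End ToPath.

Lemma comp_iota C (n : C -> nat) : fpt n -> computable (fun i => enc_nat (n i)) ->
  computable (fun i => enc_seq [seq enc_nat j | j <- iota 0 (n i)]).
Proof.
move=> fn cn.
have Hit := @comp_iter C n (fun=> seq nat) (fun _ l => enc_seq [seq enc_nat j | j <- l])
  (fun _ l => 0 :: [seq j.+1 | j <- l]) (fun=> [::]) fn cn (comp_leaf _).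
have iotaE k : iter k (fun l => 0 :: [seq j.+1 | j <- l]) [::] = iota 0 k.
  by elim: k => //= k ->; rewrite -[X in 0 :: _ = 0 :: iota X _]addn0 iotaDl.
apply: (comp_eq _ (Hit _)); first by move=> i _; rewrite iotaE.
set K := extend _ _.
have cl : computable (fun p : K => enc_seq [seq enc_nat j | j <- tagged p]) by exact: comp_var.
have fl : fpt (fun p : K => size (tagged p)).
  by apply: fpt_le (fpt_weak _ _ fn) => -[i l] /= [_ [r lt_r ->]]; rewrite iotaE size_iota ltnW.
have cs : computable (fun p : K => enc_seq [seq enc_nat j.+1 | j <- tagged p]).
  apply: (comp_map fl cl (v := fun _ j => enc_nat j.+1)).
  by apply: comp_succ; apply: comp_var.
by apply: comp_eq (comp_node (comp_leaf _) cs) => p _; rewrite /= -map_comp.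
Qed.

Lemma mod_scheme_of_ed (H : sgraph -> Prop) (Pi : vertex_subset_problem) :
  FPT_AS Pi (ed_param H) -> FPT_AS Pi (mod_param H).
Proof.
apply: (scheme_transfer (g := fun G (S : witness (mod_param H) G) => to_path S : witness (ed_param H) G)
  (h := id)).
- pose K := instance_ctx (mod_param H).
  have fG : fin (fun i : K => vert (tag i)) by exact: fin_instance.
  have cS : computable (fun i : K => enc_set (tagged i).1) by exact: comp_witness.
  have fS : fpt (fun i : K => #|(tagged i).1|) by exact: (fpt_card fG (fun i => (tagged i).1)).
  have fS' : fpt (fun i : K => size (enum (tagged i).1)) by apply: fpt_le fS => i _; rewrite -cardE.
  have cC := comp_setC fG cS.
  have c1 : computable (fun i : K => enc_seq [seq enc_nat j | j <- iota 0 #|(tagged i).1|.+1]).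
    apply: comp_iota; last exact: comp_succ (comp_card fG cS).
    by apply: fpt_le (fpt_add fS (@fpt_const K 1)) => i _; rewrite addn1.
  have cC1 : computable (fun i : K => enc_seq [:: enc_set (~: (tagged i).1)]).
    exact: comp_node cC (comp_leaf _).
  have c2 := comp_cat fS' (comp_enum fG cS) cC1.
  by apply: comp_eq (comp_node c1 (comp_node c2 cC)) => i _; rewrite -enc_to_path.
- by move=> G S vS; split; [apply: to_path_valid|apply: to_path_depth].
apply: fpt_le (fpt_add (@fpt_vertices (mod_param H)) (@fpt_const _ 1)) => i _ /=.
by rewrite card_ord addn1 ltnS max_card.
Qed.

Theorem theorem12 (H : sgraph -> Prop) (Pi : vertex_subset_problem)
  (H_family : graph_family H) (H_well_behaved : well_behaved H)
  (Pi_problem : Pi = ConnectedVertexCover \/ Pi = ConnectedDominatingSet) :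
  (FPT_AS Pi (mod_param H) <-> FPT_AS Pi (ed_param H)) /\
  (FPT_AS Pi (ed_param H) <-> FPT_AS Pi (tw_param H)).
Proof.
have [herH _] := H_well_behaved.
have [cv ->] : exists cv, Pi = problem cv.
  by case: Pi_problem => ->; [exists true|exists false].
(* The three implications form a cycle, which yields both equivalences. *)
have tw_of_mod := @tw_scheme_of_mod H cv H_family.
have ed_of_tw := @ed_scheme_of_tw H (problem cv) H_family herH.
have mod_of_ed := @mod_scheme_of_ed H (problem cv).
by split; split; auto.
Qed.
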